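(* Let $p$ be a prime number. For any reduced noetherian $\mathbf{F}_p$-scheme $X$, the topological rigidification $X_{\mathrm{trig}}$ of $X$ is isomorphic to the perfection $X_{\mathrm{perf}}$ of $X$.
   Context: A scheme is coherent if it is quasicompact and quasiseparated. A morphism of schemes is a universal homeomorphism if every base change of it is a homeomorphism on underlying topological spaces. A coherent scheme $Y$ is topologically rigid if any universal homeomorphism $Y'\to Y$ with $Y'$ reduced is an isomorphism. The inclusion of the category of topologically rigid schemes into the category of coherent schemes (over a fixed coherent base) admits a right adjoint $Y\mapsto Y_{\mathrm{trig}}$, called the topological rigidification; explicitly, $Y_{\mathrm{trig}}$ is the (cofiltered) limit, in $Y$-schemes, of all universal homeomorphisms $Z\to Y$, and the counit $Y_{\mathrm{trig}}\to Y$ is a universal homeomorphism. For an $\mathbf{F}_p$-scheme $X$, with absolute $p$-th power Frobenius $\phi_X\colon X\to X$, the perfection $X_{\mathrm{perf}}$ is the limit of the diagram $\cdots\xrightarrow{\phi_X}X\xrightarrow{\phi_X}X$. *)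

(* Defs.v *)
From HB Require Import structures.
From mathcomp Require Import all_boot all_order all_algebra.
From mathcomp Require Import boolp classical_sets topology.

Set Implicit Arguments.
Unset Strict Implicit.
Unset Printing Implicit Defensive.

Import GRing.Theory.
Local Open Scope classical_set_scope.
Local Open Scope ring_scope.

(** Rings are [comPzRingType]s, so that the zero ring (the sections over the
    empty open set) is allowed. *)

Definition is_ideal (A : comPzRingType) (I : set A) : Prop :=
  [/\ I 0, forall a b, I a -> I b -> I (a + b) & forall a b, I b -> I (a * b)].

Definition is_prime_ideal (A : comPzRingType) (P : set A) : Prop :=
  [/\ is_ideal P, ~ P 1 & forall a b, P (a * b) -> P a \/ P b].

Definition ideal_span (A : comPzRingType) (s : seq A) : set A :=
  [set a | exists c : 'I_(size s) -> A, a = \sum_(i < size s) c i * s`_i].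

Definition noetherian_ring (A : comPzRingType) : Prop :=
  forall I : set A, is_ideal I -> exists s : seq A, I = ideal_span s.

Definition is_unit (A : comPzRingType) (a : A) : Prop := exists b, a * b = 1.

Definition is_localization (A B : comPzRingType) (f : A)
    (phi : {rmorphism A -> B}) : Prop :=
  [/\ is_unit (phi f),
      forall b : B, exists (a : A) (n : nat), b * phi f ^+ n = phi a &
      forall a : A, phi a = 0 -> exists n : nat, f ^+ n * a = 0].

Record opens (X : topologicalType) : Type := Opens {
  oset :> set X;
  oset_open : open oset }.

Lemma opens_ext (X : topologicalType) (U V : opens X) :
  (U : set X) = V -> U = V.
Proof.
case: U V => [U oU] [V oV] /= UV; subst V.
by rewrite (Prop_irrelevance oU oV).
Qed.

Definition opensT (X : topologicalType) : opens X := Opens openT.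

Definition opensI (X : topologicalType) (U V : opens X) : opens X :=
  Opens (openI (oset_open U) (oset_open V)).

Lemma preopen_subproof (X Y : topologicalType) (f : X -> Y) (cf : continuous f)
  (V : opens Y) : open (f @^-1` V).
Proof. by apply: open_comp => [x _|]; [exact: cf|exact: oset_open]. Qed.

Definition preopen (X Y : topologicalType) (f : X -> Y) (cf : continuous f)
  (V : opens Y) : opens X := Opens (preopen_subproof cf V).

Record ringed_space : Type := RingedSpace {
  rs_space :> topologicalType;
  sect : opens rs_space -> comPzRingType;
  res : forall U V : opens rs_space, U `<=` V -> {rmorphism sect V -> sect U};
  res_id : forall (U : opens rs_space) (UU : U `<=` U) s, res UU s = s;
  res_comp : forall (U V W : opens rs_space) (UV : U `<=` V) (VW : V `<=` W)
    (UW : U `<=` W) s, res UV (res VW s) = res UW s;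
  (* the sheaf axiom, including the empty cover of the empty open set *)
  sect_sheaf : forall (U : opens rs_space) (I : Type)
    (V : I -> opens rs_space) (VU : forall i, V i `<=` U)
    (s : forall i, sect (V i)),
    (U : set rs_space) `<=` \bigcup_i V i ->
    (forall i j, res (@subIsetl _ (V i) (V j) : opensI (V i) (V j) `<=` V i) (s i)
               = res (@subIsetr _ (V i) (V j) : opensI (V i) (V j) `<=` V j) (s j)) ->
    exists! t : sect U, forall i, res (VU i) t = s i }.

(** The germ of [s] at [x] is a unit of the stalk (false if [x] is not in [U]). *)
Definition germ_unit (X : ringed_space) (x : X) (U : opens X) (s : sect U) :
    Prop :=
  exists (W : opens X) (WU : W `<=` U), oset W x /\ is_unit (res WU s).

(** All stalks are local rings: they are nonzero and a sum of two non-units is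
    a non-unit. *)
Definition locally_ringed (X : ringed_space) : Prop :=
  forall (x : X) (U : opens X), oset U x ->
    (1 : sect U) <> 0 /\
    (forall s t : sect U,
       germ_unit x (s + t) -> germ_unit x s \/ germ_unit x t).

(** Morphisms of locally ringed spaces. The last field says that the induced
    maps on stalks are local homomorphisms. *)
Record lrs_hom (X Y : ringed_space) : Type := Hom {
  hom_map :> X -> Y;
  hom_cts : continuous hom_map;
  pull : forall V : opens Y, {rmorphism sect V -> sect (preopen hom_cts V)};
  pull_res : forall (U V : opens Y) (UV : U `<=` V) (s : sect V),
    pull U (res UV s) =
    res (@preimage_subset _ _ hom_map _ _ UV :
           preopen hom_cts U `<=` preopen hom_cts V) (pull V s);
  pull_local : forall (x : X) (V : opens Y) (s : sect V),
    germ_unit x (pull V s) -> germ_unit (hom_map x) s }.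


Arguments hom_cts {X Y} h : rename.
Arguments pull {X Y} h V : rename.

Lemma rmorph_ext (A B : pzSemiRingType) (f g : {rmorphism A -> B}) :
  f =1 g -> f = g.
Proof.
case: f g => [f [[f0] [f1]]] [g [[g0] [g1]]] /= /funext fg; subst g.
by rewrite (Prop_irrelevance f0 g0) (Prop_irrelevance f1 g1).
Qed.

Lemma hom_ext (X Y : ringed_space) (f g : lrs_hom X Y) :
  (forall x, f x = g x) ->
  (forall (V : opens Y) (s : sect V) (W : opens X)
     (Wf : W `<=` preopen (hom_cts f) V) (Wg : W `<=` preopen (hom_cts g) V),
     res Wf (pull f V s) = res Wg (pull g V s)) ->
  f = g.
Proof.
case: f g => [f cf pf rf lf] [g cg pg rg lg] /= /funext fg; subst g.
rewrite (Prop_irrelevance cg cf) in pg rg lg *.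
move=> H; have pfg : pf = pg.
  apply: functional_extensionality_dep => V; apply: rmorph_ext => s.
  by have := H V s (preopen cf V) (@subset_refl _ _) (@subset_refl _ _); rewrite !res_id.
subst pg.
by rewrite (Prop_irrelevance rf rg) (Prop_irrelevance lf lg).
Qed.

Lemma germ_unit_res (X : ringed_space) (x : X) (U V : opens X)
  (UV : U `<=` V) (s : sect V) : germ_unit x (res UV s) -> germ_unit x s.
Proof.
move=> [W [WU [Wx u]]]; exists W, (subset_trans WU UV); split => //.
by rewrite -(res_comp WU UV).
Qed.

Section Identity.
Variable X : ringed_space.

Definition id_cts : continuous (@idfun X) := fun x => @cvg_id _ (nbhs x).

Definition id_pull (V : opens X) : {rmorphism sect V -> sect (preopen id_cts V)} :=
  res (@subset_refl _ V : preopen id_cts V `<=` V).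

Lemma id_pull_res (U V : opens X) (UV : U `<=` V) (s : sect V) :
  id_pull U (res UV s) =
  res (@preimage_subset _ _ idfun _ _ UV :
         preopen id_cts U `<=` preopen id_cts V) (id_pull V s).
Proof. by rewrite /id_pull !(res_comp _ _ (UV : preopen id_cts U `<=` V)). Qed.

Lemma id_pull_local (x : X) (V : opens X) (s : sect V) :
  germ_unit x (id_pull V s) -> germ_unit x s.
Proof. exact: germ_unit_res. Qed.

Definition id_hom : lrs_hom X X := Hom id_pull_res id_pull_local.

End Identity.

Section Composition.
Variables (X Y Z : ringed_space) (g : lrs_hom Y Z) (f : lrs_hom X Y).

Lemma comp_cts : continuous (g \o f).
Proof. by move=> x; apply: continuous_comp; exact: hom_cts. Qed.

Definition comp_pull (V : opens Z) :
    {rmorphism sect V -> sect (preopen comp_cts V)} :=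
  res (@subset_refl _ (preopen comp_cts V) :
         preopen comp_cts V `<=` preopen (hom_cts f) (preopen (hom_cts g) V))
  \o (pull f (preopen (hom_cts g) V) \o pull g V).

Lemma comp_pull_res (U V : opens Z) (UV : U `<=` V) (s : sect V) :
  comp_pull U (res UV s) =
  res (@preimage_subset _ _ (g \o f) _ _ UV :
         preopen comp_cts U `<=` preopen comp_cts V) (comp_pull V s).
Proof.
have H : preopen comp_cts U `<=` preopen (hom_cts f) (preopen (hom_cts g) V).
  by move=> x; exact: UV.
by rewrite /comp_pull /= pull_res pull_res !(res_comp _ _ H).
Qed.

Lemma comp_pull_local (x : X) (V : opens Z) (s : sect V) :
  germ_unit x (comp_pull V s) -> germ_unit ((g \o f) x) s.
Proof. by move=> /germ_unit_res /pull_local /pull_local. Qed.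

Definition comp_hom : lrs_hom X Z := Hom comp_pull_res comp_pull_local.

End Composition.

Definition is_iso (X Y : ringed_space) (f : lrs_hom X Y) : Prop :=
  exists g : lrs_hom Y X, comp_hom g f = id_hom X /\ comp_hom f g = id_hom Y.

(** The open subspace [(U, O_X|U)] is isomorphic to [Spec A].

    Such an isomorphism amounts to a bijection [h] from [U] to the set of prime
    ideals of [A] that is a homeomorphism for the Zariski topology (whose closed
    sets are the [V(I) = {P | I <= P}]), and a ring map [phi : A -> O_X(U)]
    that induces [A_f = O_X(D(f))] for all [f]: the structure sheaf of [Spec A]
    is the sheaf given on the basis of the [D(f)] by the localizations [A_f]. *)
Definition affine_chart (X : ringed_space) (U : opens X) (A : comPzRingType) :
    Prop :=
  exists (h : X -> set A) (phi : {rmorphism A -> sect U}),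
    [/\ forall x, oset U x -> is_prime_ideal (h x),
        forall P : set A, is_prime_ideal P -> exists! x, oset U x /\ h x = P,
        forall C : set X, C `<=` U ->
          (open (U `\` C) <-> exists I : set A, C = [set x | oset U x /\ I `<=` h x]) &
        forall (f : A) (V : opens X) (VU : V `<=` U),
          (V : set X) = [set x | oset U x /\ ~ h x f] ->
          is_localization f (res VU \o phi : {rmorphism A -> sect V})].

Record scheme : Type := Scheme {
  sch :> ringed_space;
  sch_local : locally_ringed sch;
  sch_affine : forall x : sch, exists (U : opens sch) (A : comPzRingType),
    oset U x /\ affine_chart U A }.

Definition is_Spec (S : scheme) (A : comPzRingType) : Prop :=
  affine_chart (opensT S) A.

Definition reduced (X : scheme) : Prop :=
  forall (U : opens X) (s : sect U) (n : nat), s ^+ n = 0 -> s = 0.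

Definition quasicompact (X : scheme) : Prop := compact [set: X].

(** Equivalent, for a scheme, to quasi-compactness of its absolute diagonal. *)
Definition quasiseparated (X : scheme) : Prop :=
  forall U V : opens X, compact (U : set X) -> compact (V : set X) ->
    compact ((U : set X) `&` V).

Definition coherent (X : scheme) : Prop := quasicompact X /\ quasiseparated X.

Definition noetherian (X : scheme) : Prop :=
  quasicompact X /\
  forall x : X, exists (U : opens X) (A : comPzRingType),
    [/\ oset U x, affine_chart U A & noetherian_ring A].

Definition is_pullback (X Y X' Y' : scheme)
    (f : lrs_hom X Y) (g : lrs_hom Y' Y) (g' : lrs_hom X' X) (f' : lrs_hom X' Y') : Prop :=
  comp_hom f g' = comp_hom g f' /\
  forall (W : scheme) (a : lrs_hom W X) (b : lrs_hom W Y'), comp_hom f a = comp_hom g b ->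
    exists! c : lrs_hom W X', comp_hom g' c = a /\ comp_hom f' c = b.

Definition homeomorphism (S T : topologicalType) (f : S -> T) : Prop :=
  continuous f /\
  exists g : T -> S, [/\ continuous g, cancel f g & cancel g f].

Definition universal_homeomorphism (X Y : scheme) (f : lrs_hom X Y) : Prop :=
  forall (Y' X' : scheme) (g : lrs_hom Y' Y) (g' : lrs_hom X' X) (f' : lrs_hom X' Y'),
    is_pullback f g g' f' -> homeomorphism f'.

Definition topologically_rigid (Y : scheme) : Prop :=
  coherent Y /\
  forall (Y' : scheme) (f : lrs_hom Y' Y),
    reduced Y' -> universal_homeomorphism f -> is_iso f.

(** [t : T -> X] is the counit at the coherent scheme [X] of the right adjoint
    of the inclusion of topologically rigid schemes into coherent schemes.
    (A base scheme plays no role: a morphism to [X] determines the structure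
    morphism of its source.) *)
Definition is_topological_rigidification (X T : scheme) (t : lrs_hom T X) : Prop :=
  [/\ coherent X, topologically_rigid T &
      forall (Z : scheme) (f : lrs_hom Z X), topologically_rigid Z ->
        exists! g : lrs_hom Z T, comp_hom t g = f].

Definition Fp_scheme (p : nat) (X : scheme) : Prop :=
  exists (S : scheme) (_ : lrs_hom X S), is_Spec S 'F_p.

Section Frobenius.
Variables (p : nat) (pr_p : prime p) (X : scheme) (FpX : Fp_scheme p X).

Lemma Fp_scheme_char (U : opens X) : p%:R = 0 :> sect U.
Proof.
case: FpX => S [f [h [phi _]]].
have UX : U `<=` preopen (hom_cts f) (opensT S) by [].
have := congr1 (res UX \o pull f (opensT S) \o phi)
  (pcharf0 (pchar_Fp pr_p) : p%:R = 0 :> 'F_p).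
by rewrite rmorph_nat rmorph0.
Qed.

Section Power.
Variable U : opens X.

Definition frob_sect (s : sect U) : sect U := s ^+ p.

Lemma frob_sect_zmod : zmod_morphism frob_sect.
Proof.
have frobD s t : (s + t) ^+ p = s ^+ p + t ^+ p :> sect U.
  rewrite exprDn -(prednK (prime_gt0 pr_p)) big_ord_recl big_ord_recr /=.
  rewrite bin0 binn subn0 subnn !expr0 mulr1 mul1r big1 ?add0r // => i _.
  rewrite /bump /= add1n; set k := i.+1.
  have /dvdnP [m ->] : (p %| 'C(p.-1.+1, k))%N.
    have := ltn_ord i; rewrite -ltnS (prednK (prime_gt0 pr_p)) => ltip.
    exact: prime_dvd_bin.
  by rewrite -mulr_natr natrM Fp_scheme_char !mulr0.
by move=> s t; apply: (addIr (t ^+ p)); rewrite /frob_sect -frobD !subrK.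
Qed.

Lemma frob_sect_monoid : monoid_morphism frob_sect.
Proof. by split => [|s t]; rewrite /frob_sect ?expr1n ?exprMn. Qed.

HB.instance Definition _ := GRing.isZmodMorphism.Build _ _ _ frob_sect_zmod.
HB.instance Definition _ := GRing.isMonoidMorphism.Build _ _ _ frob_sect_monoid.
End Power.

Definition frob_pull (V : opens X) :
    {rmorphism sect V -> sect (preopen (@id_cts X) V)} :=
  @id_pull X V \o @frob_sect V.

Lemma frob_pull_res (U V : opens X) (UV : U `<=` V) (s : sect V) :
  frob_pull U (res UV s) =
  res (@preimage_subset _ _ idfun _ _ UV :
         preopen (@id_cts X) U `<=` preopen (@id_cts X) V) (frob_pull V s).
Proof. by rewrite /frob_pull /= /frob_sect -rmorphXn id_pull_res. Qed.

Lemma frob_pull_local (x : X) (V : opens X) (s : sect V) :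
  germ_unit x (frob_pull V s) -> germ_unit x s.
Proof.
move=> /germ_unit_res [W [WV [Wx [t]]]]; rewrite rmorphXn.
rewrite -(prednK (prime_gt0 pr_p)) exprS -mulrA => st.
by exists W, WV; split => //; eexists; exact: st.
Qed.

Definition frobenius : lrs_hom X X := Hom frob_pull_res frob_pull_local.

End Frobenius.

(** [P] with the projections [q n : P -> X] is the limit of the diagram
    [... -> X -> X -> X] indexed by [nat], whose transition maps from index
    [n.+1] to index [n] are all equal to the Frobenius of [X]. *)
Definition is_perfection (p : nat) (pr_p : prime p) (X : scheme)
    (FpX : Fp_scheme p X) (P : scheme) (q : nat -> lrs_hom P X) : Prop :=
  (forall n, comp_hom (frobenius pr_p FpX) (q n.+1) = q n) /\
  forall (W : scheme) (r : nat -> lrs_hom W X),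
    (forall n, comp_hom (frobenius pr_p FpX) (r n.+1) = r n) ->
    exists! c : lrs_hom W P, forall n, comp_hom (q n) c = r n.

(* Main.v *)
Require Import Defs.
From HB Require Import structures.
From mathcomp Require Import all_boot all_order all_algebra ring.
From mathcomp Require Import boolp classical_sets topology.

Set Implicit Arguments.
Unset Strict Implicit.
Unset Printing Implicit Defensive.

Import GRing.Theory.
Local Open Scope classical_set_scope.
Local Open Scope ring_scope.

(** Over [F_p], topologically rigid means perfect. A universal homeomorphism
    [f : Y -> P] with [Y] reduced and [P] perfect is an isomorphism: being a
    homeomorphism it is affine, and locally, for [A -> B], universal closedness and
    injectivity over the affine line of [A] make [b] integral over [A] with the
    spectrum of [A[b]] in bijection with that of [A] and with trivial residue
    extensions; as [A] is perfect, the conductor of [A] in [A[b]] is radical, hence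
    is everything. Conversely the perfection [Q -> T] of any [F_p]-scheme has the
    same underlying space as [T] and is terminal among perfect schemes over [T];
    by formal nonsense it is a universal homeomorphism, so if [T] is rigid then
    [T = Q] is perfect. So the rigidification, the limit perfection and [Q] are
    all terminal among perfect schemes over [X]. *)

(** * Commutative algebra *)

(** [universal_homeomorphism] speaks only of fibre squares that are given, so it yields nothing
    until a square is exhibited. Two are: the identity square, and the base change over an affine
    open [V] to the affine line of [V]. On that line [b X = 1] and [X = b] are closed conditions,
    which is why a single variable gives integrality, the primes of [A[b]] and the residue fields.
    In the other direction no fibre product is computed: the given one is compared with perfections,
    whose spaces are known. Perfectness enters the conductor argument through roots: if
    [(d b ^+ i) ^+ q] comes from [A], so does a [q]-th root of it, which equals [d b ^+ i] because
    Frobenius is injective on the reduced ring [B]. The spectrum of a polynomial ring and the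
    perfection are both built as sheaves of functions with prescribed rings of values and a
    prescribed local shape, so that the sheaf axiom holds by construction. The final comparison goes
    through [Q]: having the space of [X], it is coherent, hence rigid and a legitimate test object
    for the rigidification, which is not visible beforehand for the limit. *)

Definition mult_closed (A : comPzRingType) (S : set A) : Prop :=
  S 1 /\ forall a b, S a -> S b -> S (a * b).

Section Ideals.
Variable A : comPzRingType.
Implicit Types I P S : set A.

Lemma ideal_sub I a b : is_ideal I -> I a -> I b -> I (a - b).
Proof.
by move=> [_ ID IM] Ia Ib; apply: ID => //; rewrite -mulN1r; apply: IM.
Qed.

Lemma ideal_mulr I a b : is_ideal I -> I a -> I (a * b).
Proof. by move=> [_ _ IM] Ia; rewrite mulrC; apply: IM. Qed.

Lemma mult_closedX S a n : mult_closed S -> S a -> S (a ^+ n).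
Proof.
by move=> [S1 SM] Sa; elim: n => [|n IHn]; rewrite ?expr0 // exprS; apply: SM.
Qed.

Lemma prime_ideal_exp P a n : is_prime_ideal P -> P (a ^+ n) -> P a.
Proof.
move=> [_ P1 PM]; elim: n => [|n IHn]; first by rewrite expr0.
by rewrite exprS => /PM [].
Qed.

Lemma prime_ideal_compl P : is_prime_ideal P -> mult_closed (~` P).
Proof. by move=> [_ P1 PM]; split => // a b Pa Pb /PM []. Qed.

Lemma bigcup_chain_ideal (F : set (set A)) I0 :
  is_ideal I0 -> (forall I, F I -> is_ideal I /\ I0 `<=` I) ->
  total_on F subset -> F !=set0 ->
  is_ideal (\bigcup_(I in F) I) /\ I0 `<=` \bigcup_(I in F) I.
Proof.
move=> [I00 _ _] FI Ftot [J FJ]; split; last first.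
  by move=> a I0a; exists J => //; apply: (proj2 (FI _ FJ)).
split => [|a b [I FIa Ia] [I' FIb I'b]|a b [I FIb Ib]].
- by exists J => //; apply: (proj2 (FI _ FJ)).
- have [sub|sub] := Ftot _ _ FIa FIb.
  + by exists I' => //; have [[_ D _] _] := FI _ FIb; apply: D => //; apply: sub.
  + by exists I => //; have [[_ D _] _] := FI _ FIa; apply: D => //; apply: sub.
- by exists I => //; have [[_ _ M] _] := FI _ FIb; apply: M.
Qed.

(** An ideal maximal among those that contain [I] and miss [S] is prime. With [S] the powers of an
    element this describes radicals; with other sets [S] it is the source of all the primes
    constructed below. *)
Lemma krull I S : is_ideal I -> mult_closed S -> (forall a, I a -> ~ S a) ->
  exists P, [/\ is_prime_ideal P, I `<=` P & forall a, P a -> ~ S a].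
Proof.
move=> idI [S1 SM] IS.
pose good J := [/\ is_ideal J, I `<=` J & forall a, J a -> ~ S a].
have goodI : good I by split.
have [F chF Ftot|P [gP maxP]] := @Zorn_bigcup A (fun J => good J \/ J = set0).
  have [[J FJ Jn0]|allempty] := pselect (exists2 J, F J & J !=set0); last first.
    right; rewrite predeqE => a; split => // -[J FJ Ja].
    by apply: allempty; exists J => //; exists a.
  left; have Jgood K : (F `&` [set K | K !=set0]) K -> good K.
    by move=> [FK [x Kx]]; have [//|K0] := chF _ FK; rewrite K0 in Kx.
  have [||//|id Isub] := @bigcup_chain_ideal (F `&` [set K | K !=set0]) I idI.
  - by move=> K /Jgood [].
  - by move=> K K' [FK _] [FK' _]; apply: Ftot.
  - by exists J.
  have -> : \bigcup_(X in F) X = \bigcup_(X in F `&` [set K | K !=set0]) X.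
    rewrite predeqE => a; split => [[K FK Ka]|[K [FK _] Ka]]; last by exists K.
    by exists K => //; split => //; exists a.
  by split => // a [K /Jgood [_ _ KS] Ka]; apply: KS.
have {}gP : good P.
  case: gP => // P0; exfalso; apply: (maxP I); last by left.
  rewrite P0; split => // sub; have [I0 _ _] := idI; exact: (sub 0 I0).
have [idP IP PS] := gP; exists P; split=> //; split => //.
  by move=> P1; apply: (PS 1).
have [P0 PD PM] := idP.
(* By maximality, the ideal generated by [P] and any [a] outside [P] meets [S]. *)
have key a : ~ P a -> exists x c, P x /\ S (x + c * a).
  move=> nPa; apply: contrapT => noS.
  pose J := [set y | exists x c, P x /\ y = x + c * a].
  apply: (maxP J).
    split; first by move=> x Px; exists x, 0; rewrite mul0r addr0.
    by move=> sub; apply/nPa/sub; exists 0, 1; rewrite mul1r add0r.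
  left; split.
  - split; first by exists 0, 0; rewrite mul0r addr0.
    + move=> _ _ [x [c [Px ->]]] [x' [c' [Px' ->]]]; exists (x + x'), (c + c').
      by split; [exact: PD|ring].
    + move=> b _ [x [c [Px ->]]]; exists (b * x), (b * c).
      by split; [exact: PM|ring].
  - by move=> x /IP Px; exists x, 0; rewrite mul0r addr0.
  - by move=> _ [x [c [Px ->]]] Sx; apply: noS; exists x, c.
move=> a b Pab; apply: contrapT => /not_orP [/key [x [c [Px Sx]]] /key [y [d [Py Sy]]]].
apply: (PS _ _ (SM _ _ Sx Sy)).
have -> : (x + c * a) * (y + d * b) =
  (y + d * b) * x + (c * a) * y + (c * d) * (a * b) by ring.
by apply: (PD); [apply: (PD)|]; apply: PM.
Qed.

Lemma radical_primes I a : is_ideal I ->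
  (forall P, is_prime_ideal P -> I `<=` P -> P a) -> exists n, I (a ^+ n).
Proof.
move=> idI aP; apply: contrapT => noI.
have [|b Ib [n _ bE]|P [pP IP PS]] := @krull I [set a ^+ n | n in setT] idI.
- split; first by exists 0%N.
  by move=> _ _ [n _ <-] [m _ <-]; exists (n + m)%N; rewrite // exprD.
- by apply: noI; exists n; rewrite bE.
- by apply: (PS a (aP _ pP IP)); exists 1%N; rewrite ?expr1.
Qed.

(** Minimal primes, seen from their complements. *)
Lemma max_mult_closed I : is_ideal I -> ~ I 1 ->
  exists S, [/\ mult_closed S, forall a, I a -> ~ S a &
    forall S', mult_closed S' -> (forall a, I a -> ~ S' a) -> S `<=` S' -> S' = S].
Proof.
move=> idI I1.
pose good S := mult_closed S /\ forall a, I a -> ~ S a.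
have [F chF Ftot|S [gS maxS]] := @Zorn_bigcup A (fun S => good S \/ S = set0).
  have [[J FJ [x Jx]]|allempty] := pselect (exists2 J, F J & J !=set0); last first.
    right; rewrite predeqE => a; split => // -[J FJ Ja].
    by apply: allempty; exists J => //; exists a.
  have gF K y : F K -> K y -> good K.
    by move=> FK Ky; have [//|K0] := chF _ FK; rewrite K0 in Ky.
  left; split; last by move=> a Ia [K FK Ka]; have [_ KI] := gF _ _ FK Ka; apply: (KI a).
  split; first by exists J => //; have [[]] := gF _ _ FJ Jx.
  move=> a b [K FK Ka] [K' FK' K'b].
  have [[_ KM] _] := gF _ _ FK Ka; have [[_ KM'] _] := gF _ _ FK' K'b.
  have [sub|sub] := Ftot _ _ FK FK'.
  + by exists K' => //; apply: KM' => //; apply: sub.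
  + by exists K => //; apply: KM => //; apply: sub.
have {}gS : good S.
  case: gS => // S0; exfalso; apply: (maxS [set 1]).
    by rewrite S0; split => // sub; exact: (sub 1).
  left; split; last by move=> a Ia aE; apply: I1; rewrite -aE.
  by split => // a b -> ->; rewrite mulr1.
have [mS SI] := gS; exists S; split => // S' mS' S'I SS'.
apply: contrapT => ne; apply: (maxS S'); last by left.
by split=> // S'S; apply: ne; rewrite eqEsubset.
Qed.

(** [krull] gives a prime over [I] missing [S]; its complement is a multiplicative set containing
    [S], hence equal to [S] by maximality. *)
Lemma max_mult_closed_prime I S : is_ideal I -> mult_closed S ->
  (forall a, I a -> ~ S a) ->
  (forall S', mult_closed S' -> (forall a, I a -> ~ S' a) -> S `<=` S' -> S' = S) ->
  is_prime_ideal (~` S) /\ I `<=` ~` S.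
Proof.
move=> idI mS IS maxS; have [P [pP IP PS]] := krull idI mS IS.
suff <- : P = ~` S by [].
rewrite -(maxS (~` P)) ?setCK //; first exact: prime_ideal_compl.
- by move=> a /IP Pa; apply.
- by move=> a Sa /PS.
Qed.

End Ideals.

Lemma preimage_ideal (A B : comPzRingType) (f : {rmorphism A -> B}) (I : set B) :
  is_ideal I -> is_ideal (f @^-1` I).
Proof.
move=> [I0 ID IM]; split=> [|a b|a b]; rewrite /preimage /= ?rmorph0 //.
- by rewrite rmorphD; apply: ID.
- by rewrite rmorphM; apply: IM.
Qed.

Lemma preimage_prime (A B : comPzRingType) (f : {rmorphism A -> B}) (P : set B) :
  is_prime_ideal P -> is_prime_ideal (f @^-1` P).
Proof.
move=> [idP P1 PM]; split; first exact: preimage_ideal.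
- by rewrite /preimage /= rmorph1.
- by move=> a b; rewrite /preimage /= rmorphM => /PM.
Qed.

(** * Constructions of rings *)

Section NonzeroModel.
Variables (R : comPzRingType) (nzR : (1 : R) != 0).

(** [{poly R}] asks for a nonzero ring, while sections form a [comPzRingType]. The copy carries the
    proof of [1 != 0] as an argument because its instance depends on it. *)
Definition nz_model (_ : (1 : R) != 0) : Type := R.
Local Notation N := (nz_model nzR).
HB.instance Definition _ := GRing.ComPzRing.on N.
HB.instance Definition _ := GRing.PzSemiRing_isNonZero.Build N nzR.

Definition nz_in (a : R) : N := a.
Definition nz_out (a : N) : R := a.
Fact nz_in_zmod : zmod_morphism nz_in. Proof. by []. Qed.
Fact nz_in_monoid : monoid_morphism nz_in. Proof. by []. Qed.
Fact nz_out_zmod : zmod_morphism nz_out. Proof. by []. Qed.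
Fact nz_out_monoid : monoid_morphism nz_out. Proof. by []. Qed.
HB.instance Definition _ := GRing.isZmodMorphism.Build R N nz_in nz_in_zmod.
HB.instance Definition _ := GRing.isMonoidMorphism.Build R N nz_in nz_in_monoid.
HB.instance Definition _ := GRing.isZmodMorphism.Build N R nz_out nz_out_zmod.
HB.instance Definition _ := GRing.isMonoidMorphism.Build N R nz_out nz_out_monoid.
End NonzeroModel.

Lemma exists_comNzRing (R : comPzRingType) : (1 : R) <> 0 ->
  exists (R' : comNzRingType) (i : {rmorphism R -> R'}) (j : {rmorphism R' -> R}),
    cancel i j /\ cancel j i.
Proof. by move=> /eqP nz; exists (nz_model nz), (@nz_in R nz), (@nz_out R nz). Qed.

Section FieldModel.
Variables (R : comNzRingType) (inv : R -> R).
Hypotheses (invP : forall a : R, a != 0 -> inv a * a = 1) (inv0 : inv 0 = 0).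

Definition field_model (_ : forall a : R, a != 0 -> inv a * a = 1) (_ : inv 0 = 0) : Type := R.
Local Notation F := (field_model invP inv0).
HB.instance Definition _ := GRing.ComNzRing.on F.
HB.instance Definition _ := GRing.ComNzRing_isField.Build F invP inv0.
Definition field_in (a : R) : F := a.
Definition field_out (a : F) : R := a.
Fact field_in_zmod : zmod_morphism field_in. Proof. by []. Qed.
Fact field_in_monoid : monoid_morphism field_in. Proof. by []. Qed.
Fact field_out_zmod : zmod_morphism field_out. Proof. by []. Qed.
Fact field_out_monoid : monoid_morphism field_out. Proof. by []. Qed.
HB.instance Definition _ := GRing.isZmodMorphism.Build R F field_in field_in_zmod.
HB.instance Definition _ := GRing.isMonoidMorphism.Build R F field_in field_in_monoid.
HB.instance Definition _ := GRing.isZmodMorphism.Build F R field_out field_out_zmod.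
HB.instance Definition _ := GRing.isMonoidMorphism.Build F R field_out field_out_monoid.
End FieldModel.

Lemma exists_field (R : comPzRingType) : (1 : R) <> 0 ->
  (forall a : R, a <> 0 -> is_unit a) ->
  exists (K : fieldType) (i : {rmorphism R -> K}) (j : {rmorphism K -> R}),
    cancel i j /\ cancel j i.
Proof.
move=> nz unitR; have [R' [i [j [ij ji]]]] := exists_comNzRing nz.
have /choice [inv invP] (a : R') : exists b, (a != 0 -> b * a = 1) /\ (a = 0 -> b = 0).
  have [->|an0] := eqVneq a 0; first by exists 0.
  have [|b ab] := unitR (j a).
    by move/(congr1 i); rewrite ji rmorph0; apply/eqP.
  exists (i b); split=> [_|a0]; last by rewrite a0 eqxx in an0.
  by rewrite -[a]ji -rmorphM mulrC ab rmorph1.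
pose K : fieldType := field_model (fun a => proj1 (invP a)) (proj2 (invP 0) erefl).
exists K, (field_in (fun a => proj1 (invP a)) (proj2 (invP 0) erefl) \o i).
by exists (j \o @field_out _ _ (fun a => proj1 (invP a)) (proj2 (invP 0) erefl)).
Qed.

Lemma poly_rmorph_exists (B : comNzRingType) (R : comPzRingType)
    (f : {rmorphism B -> R}) (u : R) :
  exists F : {rmorphism {poly B} -> R}, (forall b, F b%:P = f b) /\ F 'X = u.
Proof.
(* [horner_morph] takes its values in a nonzero ring; into the zero ring the constant map serves. *)
have [R0|nz] := pselect ((1 : R) = 0).
  have all0 (x y : R) : x = y by rewrite -[x]mulr1 -[y]mulr1 R0 !mulr0.
  pose z (p : {poly B}) : R := 0.
  have zz : zmod_morphism z by move=> x y; exact: all0.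
  have zm : monoid_morphism z by split => [|x y]; exact: all0.
  pose F : {rmorphism {poly B} -> R} :=
    HB.pack z (GRing.isZmodMorphism.Build _ _ _ zz) (GRing.isMonoidMorphism.Build _ _ _ zm).
  by exists F; split => [b|]; exact: all0.
have [R' [i [j [ij ji]]]] := exists_comNzRing nz.
have cu : commr_rmorph (i \o f) (i u) by move=> b; rewrite /GRing.comm mulrC.
exists (j \o horner_morph cu); split => [b|] /=.
  by rewrite horner_morphC /= ij.
by rewrite horner_morphX ij.
Qed.

Lemma poly_rmorph_ext (B : comNzRingType) (R : comPzRingType)
    (f g : {rmorphism {poly B} -> R}) :
  (forall b, f b%:P = g b%:P) -> f 'X = g 'X -> f =1 g.
Proof.
move=> fgC fgX; elim/poly_ind => [|p b IHp]; first by rewrite !rmorph0.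
by rewrite !rmorphD !rmorphM IHp fgX fgC.
Qed.

(** Fractions modulo [loc_eq] form [S^-1 (A / J)]: a localization for [J = 0], a residue
    field for [J] prime and [S] its complement. *)
Section Localization.
Variables (A : comPzRingType) (S J : set A).
Hypotheses (mS : mult_closed S) (idJ : is_ideal J).

Definition loc_eq (x y : A * {s | S s}) : Prop :=
  exists u, S u /\ J (u * (x.1 * sval y.2 - y.1 * sval x.2)).

Lemma loc_eqxx x : loc_eq x x.
Proof.
by exists 1; split; [exact: (proj1 mS)|rewrite subrr mulr0; case: idJ].
Qed.

Lemma loc_eq_sym x y : loc_eq x y -> loc_eq y x.
Proof.
move=> [u [Su Ju]]; exists u; split => //.
by rewrite -opprB mulrN -[- _]mulN1r; case: idJ => _ _; apply.
Qed.

Lemma loc_eq_trans y x z : loc_eq x y -> loc_eq y z -> loc_eq x z.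
Proof.
case: x y z => [a [s Ss]] [b [t St]] [c [r Sr]] [u [Su /= Ju]] [v [Sv /= Jv]].
have [_ JD JM] := idJ; have [_ SM] := mS.
exists (u * v * t); split => /=; first exact: (SM _ _ (SM _ _ Su Sv) St).
have -> : u * v * t * (a * r - c * s) =
  (v * r) * (u * (a * t - b * s)) + (u * s) * (v * (b * r - c * t)) by ring.
by apply: JD; apply: (JM).
Qed.

(** The proofs are arguments because the ring structure depends on them. *)
Definition loc_type (_ : mult_closed S) (_ : is_ideal J) : Type :=
  {C : set (A * {s | S s}) | exists x, C = loc_eq x}.
Local Notation loc := (loc_type mS idJ).
HB.instance Definition _ := gen_eqMixin loc.
HB.instance Definition _ := gen_choiceMixin loc.

Definition frac (a s : A) (Ss : S s) : loc :=
  exist _ (loc_eq (a, exist _ s Ss)) (ex_intro _ _ erefl).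

Lemma eq_frac a s (Ss : S s) b t (St : S t) :
  frac a Ss = frac b St <-> exists u, S u /\ J (u * (a * t - b * s)).
Proof.
split.
- move=> /(congr1 sval) /= E.
  by have := loc_eqxx (b, exist _ t St); rewrite -E.
- move=> abst; apply: eq_exist; rewrite predeqE => z; split => H.
  + by apply: loc_eq_trans H; apply: loc_eq_sym.
  + by apply: loc_eq_trans H.
Qed.

Lemma fracP (x : loc) : exists a s (Ss : S s), x = frac a Ss.
Proof. by case: x => C [[a [s Ss]] CE]; exists a, s, Ss; exact: (@eq_exist _ _ _ _ _ _ CE). Qed.

Lemma frac_cancel a s (Ss : S s) t (Sts : S (t * s)) : frac (t * a) Sts = frac a Ss.
Proof.
apply/eq_frac; exists 1; split; first by case: mS.
by have -> : 1 * (t * a * s - a * (t * s)) = 0 :> A; [ring|case: idJ].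
Qed.

Lemma frac_common (x y : loc) : exists a b s (Ss : S s), x = frac a Ss /\ y = frac b Ss.
Proof.
have [a [s [Ss ->]]] := fracP x; have [b [t [St ->]]] := fracP y.
have [_ SM] := mS; have Sts := SM _ _ St Ss.
exists (t * a), (s * b), (t * s), Sts; rewrite frac_cancel; split => //.
have Sst := SM _ _ Ss St; rewrite -(frac_cancel b St Sst).
by apply/eq_frac; exists 1; split; [case: mS|rewrite mulrC [t * s]mulrC subrr mul0r; case: idJ].
Qed.

Lemma frac_common3 (x y z : loc) : exists a b c s (Ss : S s),
  [/\ x = frac a Ss, y = frac b Ss & z = frac c Ss].
Proof.
have [a [b [s [Ss [-> ->]]]]] := frac_common x y; have [c [t [St ->]]] := fracP z.
have [_ SM] := mS; have Sts := SM _ _ St Ss.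
exists (t * a), (t * b), (s * c), (t * s), Sts; rewrite !frac_cancel; split => //.
have Sst := SM _ _ Ss St; rewrite -(frac_cancel c St Sst).
by apply/eq_frac; exists 1; split; [case: mS|rewrite mulrC [t * s]mulrC subrr mul0r; case: idJ].
Qed.

Definition loc0 : loc := frac 0 (proj1 mS).
Definition loc1 : loc := frac 1 (proj1 mS).

(** Each operation is chosen as a value satisfying its formula for all representatives, so that the
    computation rule is immediate. Addition is specified on common denominators, which always exist,
    and so inherits its laws from [A]. *)
Fact loc_opp_ex (x : loc) : exists y, forall a s (Ss : S s), x = frac a Ss -> y = frac (- a) Ss.
Proof.
have [a [s [Ss ->]]] := fracP x; exists (frac (- a) Ss) => b t St /eq_frac [u [Su Ju]].
apply/eq_frac; exists u; split => //.
have -> : u * (- a * t - - b * s) = -1 * (u * (a * t - b * s)) by ring.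
by case: idJ => _ _; apply.
Qed.
Definition loc_opp x := sval (cid (loc_opp_ex x)).
Lemma loc_oppE a s (Ss : S s) : loc_opp (frac a Ss) = frac (- a) Ss.
Proof. by rewrite /loc_opp; case: cid => y /= /(_ _ _ _ erefl). Qed.

Fact loc_add_ex (x y : loc) : exists z, forall a b s (Ss : S s),
  x = frac a Ss -> y = frac b Ss -> z = frac (a + b) Ss.
Proof.
have [a [b [s [Ss [-> ->]]]]] := frac_common x y; exists (frac (a + b) Ss).
move=> a' b' t St /eq_frac [u [Su Ju]] /eq_frac [v [Sv Jv]].
apply/eq_frac; exists (u * v); split; first by case: mS => _; apply.
have -> : u * v * ((a + b) * t - (a' + b') * s) =
  v * (u * (a * t - a' * s)) + u * (v * (b * t - b' * s)) by ring.
by case: idJ => _ JD JM; apply: JD; apply: (JM).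
Qed.
Definition loc_add x y := sval (cid (loc_add_ex x y)).
Lemma loc_addE a b s (Ss : S s) : loc_add (frac a Ss) (frac b Ss) = frac (a + b) Ss.
Proof. by rewrite /loc_add; case: cid => y /= /(_ _ _ _ _ erefl erefl). Qed.

Fact loc_mul_ex (x y : loc) : exists z, forall a s (Ss : S s) b t (St : S t) (Sst : S (s * t)),
  x = frac a Ss -> y = frac b St -> z = frac (a * b) Sst.
Proof.
have [a [s [Ss ->]]] := fracP x; have [b [t [St ->]]] := fracP y.
have [_ SM] := mS; exists (frac (a * b) (SM _ _ Ss St)).
move=> a' s' Ss' b' t' St' Sst' /eq_frac [u [Su Ju]] /eq_frac [v [Sv Jv]].
apply/eq_frac; exists (u * v); split; first exact: SM.
have -> : u * v * (a * b * (s' * t') - a' * b' * (s * t)) =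
  (v * b * t') * (u * (a * s' - a' * s)) + (u * a' * s) * (v * (b * t' - b' * t)) by ring.
by case: idJ => _ JD JM; apply: JD; apply: (JM).
Qed.
Definition loc_mul x y := sval (cid (loc_mul_ex x y)).
Lemma loc_mulE a s (Ss : S s) b t (St : S t) (Sst : S (s * t)) :
  loc_mul (frac a Ss) (frac b St) = frac (a * b) Sst.
Proof. by rewrite /loc_mul; case: cid => y /= /(_ _ _ _ _ _ _ _ erefl erefl). Qed.

Lemma eq_frac_eq a s (Ss : S s) b t (St : S t) : a * t = b * s -> frac a Ss = frac b St.
Proof.
move=> E; apply/eq_frac; exists 1; split; first by case: mS.
by rewrite E subrr mulr0; case: idJ.
Qed.

Fact loc_addA : associative loc_add.
Proof.
move=> x y z; have [a [b [c [s [Ss [-> -> ->]]]]]] := frac_common3 x y z.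
by rewrite !loc_addE addrA.
Qed.
Fact loc_addC : commutative loc_add.
Proof.
move=> x y; have [a [b [s [Ss [-> ->]]]]] := frac_common x y.
by rewrite !loc_addE addrC.
Qed.
Fact loc_add0 : left_id loc0 loc_add.
Proof.
move=> x; have [a [s [Ss ->]]] := fracP x.
have -> : loc0 = frac 0 Ss by apply: eq_frac_eq; rewrite !mul0r.
by rewrite loc_addE add0r.
Qed.
Fact loc_addN : left_inverse loc0 loc_opp loc_add.
Proof.
move=> x; have [a [s [Ss ->]]] := fracP x; rewrite loc_oppE loc_addE addNr.
by apply: eq_frac_eq; rewrite !mul0r.
Qed.
HB.instance Definition _ := GRing.isZmodule.Build loc loc_addA loc_addC loc_add0 loc_addN.

Fact loc_mulA : associative loc_mul.
Proof.
move=> x y z; have [a [b [c [s [Ss [-> -> ->]]]]]] := frac_common3 x y z.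
have [_ SM] := mS; have Ss2 := SM _ _ Ss Ss.
rewrite !(loc_mulE _ _ _ _ Ss2) (loc_mulE _ _ _ _ (SM _ _ Ss Ss2)).
by rewrite (loc_mulE _ _ _ _ (SM _ _ Ss2 Ss)); apply: eq_frac_eq; ring.
Qed.
Fact loc_mulC : commutative loc_mul.
Proof.
move=> x y; have [a [b [s [Ss [-> ->]]]]] := frac_common x y.
have [_ SM] := mS; rewrite !(loc_mulE _ _ _ _ (SM _ _ Ss Ss)).
by apply: eq_frac_eq; ring.
Qed.
Fact loc_mul1 : left_id loc1 loc_mul.
Proof.
move=> x; have [a [s [Ss ->]]] := fracP x.
have [S1 SM] := mS; rewrite (loc_mulE _ _ _ _ (SM _ _ S1 Ss)).
by apply: eq_frac_eq; ring.
Qed.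
Fact loc_mulD : left_distributive loc_mul loc_add.
Proof.
move=> x y z; have [a [b [c [s [Ss [-> -> ->]]]]]] := frac_common3 x y z.
have [_ SM] := mS; have Ss2 := SM _ _ Ss Ss.
rewrite loc_addE !(loc_mulE _ _ _ _ Ss2) loc_addE.
by apply: eq_frac_eq; ring.
Qed.
HB.instance Definition _ := GRing.Zmodule_isComPzRing.Build loc
  loc_mulA loc_mulC loc_mul1 loc_mulD.

Definition loc_in (a : A) : loc := frac a (proj1 mS).
Fact loc_in_zmod : zmod_morphism loc_in.
Proof. by move=> a b; rewrite /loc_in -[RHS]/(loc_add _ (loc_opp _)) loc_oppE loc_addE. Qed.
Fact loc_in_monoid : monoid_morphism loc_in.
Proof.
split=> // a b; rewrite /loc_in -[RHS]/(loc_mul _ _).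
rewrite (loc_mulE _ _ _ _ (proj2 mS _ _ (proj1 mS) (proj1 mS))).
by apply: eq_frac_eq; ring.
Qed.
HB.instance Definition _ := GRing.isZmodMorphism.Build A loc loc_in loc_in_zmod.
HB.instance Definition _ := GRing.isMonoidMorphism.Build A loc loc_in loc_in_monoid.

Lemma loc_in0 a : loc_in a = 0 <-> exists u, S u /\ J (u * a).
Proof.
split=> [/eq_frac|] [u [Su Ju]]; last apply/eq_frac; exists u; split => //.
- by move: Ju; rewrite mulr1 mul0r subr0.
- by rewrite mulr1 mul0r subr0.
Qed.

Lemma loc_frac_mul a s (Ss : S s) : loc_in s * frac a Ss = loc_in a.
Proof.
rewrite -[LHS]/(loc_mul _ _) /loc_in (loc_mulE _ _ _ _ (proj2 mS _ _ (proj1 mS) Ss)).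
by apply: eq_frac_eq; ring.
Qed.

End Localization.

Lemma exists_localization (A : comPzRingType) (S J : set A) :
  mult_closed S -> is_ideal J ->
  exists (L : comPzRingType) (i : {rmorphism A -> L}),
  [/\ forall s, S s -> is_unit (i s),
      forall x, exists a s, S s /\ i s * x = i a &
      forall a, i a = 0 <-> exists u, S u /\ J (u * a)].
Proof.
move=> mS idJ; exists (loc_type mS idJ), (loc_in mS idJ); split => [s Ss|x|a].
- by exists (frac mS idJ 1 Ss); rewrite loc_frac_mul; exact: rmorph1.
- have [a [s [Ss ->]]] := fracP x; exists a, s; split => //; exact: loc_frac_mul.
- exact: loc_in0.
Qed.

(** [g x] is the unique solution [y] of [f s * y = f a] when [i s * x = i a]. The localization
    enters by its properties and not by its construction, so that the lemma applies to residue
    fields and to stalks as well. *)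
Lemma localization_rmorph (A L R : comPzRingType) (S : set A)
    (i : {rmorphism A -> L}) (f : {rmorphism A -> R}) :
  (forall s, S s -> is_unit (i s)) ->
  (forall x, exists a s, S s /\ i s * x = i a) ->
  mult_closed S ->
  (forall a, i a = 0 -> f a = 0) -> (forall s, S s -> is_unit (f s)) ->
  exists g : {rmorphism L -> R}, forall a, g (i a) = f a.
Proof.
move=> unitS iS [S1 SM] i0 unitf.
have unitK (T : comPzRingType) (u x y : T) : is_unit u -> u * x = u * y -> x = y.
  by move=> [v uv] uxy; rewrite -[x]mul1r -[y]mul1r -uv mulrC mulrA [x * _]mulrC uxy; ring.
have if0 a b : i a = i b -> f a = f b.
  by move=> E; apply/eqP; rewrite -subr_eq0 -rmorphB i0 // rmorphB E subrr.
have /choice [g gP] x : exists y, forall a s, S s -> i s * x = i a -> f s * y = f a.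
  have [a [s [Ss sx]]] := iS x; have [v sv] := unitf s Ss.
  exists (v * f a) => b t St tx; rewrite mulrCA -rmorphM.
  have -> : f (t * a) = f (s * b).
    by apply: if0; rewrite !rmorphM -sx -tx mulrCA.
  by rewrite rmorphM mulrA [v * _]mulrC sv mul1r.
have gB : zmod_morphism g.
  move=> x y; have [a [s [Ss sx]]] := iS x; have [b [t [St ty]]] := iS y.
  apply: (unitK _ (f (s * t))); first exact/unitf/SM.
  rewrite (gP _ (a * t - b * s)) //; first last.
  - by rewrite !(rmorphM, rmorphB) -sx -ty; ring.
  - exact: SM.
  by rewrite !(rmorphM, rmorphB) -(gP _ _ _ Ss sx) -(gP _ _ _ St ty); ring.
have gM : monoid_morphism g.
  split; first by have := gP 1 1 1 S1; rewrite !rmorph1 !mul1r; apply.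
  move=> x y; have [a [s [Ss sx]]] := iS x; have [b [t [St ty]]] := iS y.
  apply: (unitK _ (f (s * t))); first exact/unitf/SM.
  rewrite (gP _ (a * b)) //; first last.
  - by rewrite !rmorphM -sx -ty; ring.
  - exact: SM.
  by rewrite !rmorphM -(gP _ _ _ Ss sx) -(gP _ _ _ St ty); ring.
pose G : {rmorphism L -> R} :=
  HB.pack g (GRing.isZmodMorphism.Build _ _ _ gB) (GRing.isMonoidMorphism.Build _ _ _ gM).
exists G => a; have := gP (i a) a 1 S1.
by rewrite !rmorph1 !mul1r; apply.
Qed.

(** * Directed colimits of rings *)

Record directed_system := DirectedSystem {
  ds_index : Type;
  ds_le : ds_index -> ds_index -> Prop;
  ds_ring : ds_index -> comPzRingType;
  ds_tr : forall i j, ds_le i j -> {rmorphism ds_ring i -> ds_ring j};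
  ds_directed : forall i j, exists k, ds_le i k /\ ds_le j k;
  ds_trans : forall i j k, ds_le i j -> ds_le j k -> ds_le i k;
  ds_tr_comp : forall i j k (ij : ds_le i j) (jk : ds_le j k) (ik : ds_le i k) a,
    ds_tr jk (ds_tr ij a) = ds_tr ik a }.

Section Colimit.
Variable D : directed_system.
Let elt := {i : ds_index D & ds_ring i}.

Definition colim_eq (x y : elt) : Prop :=
  exists k (ik : ds_le (tag x) k) (jk : ds_le (tag y) k),
    ds_tr ik (tagged x) = ds_tr jk (tagged y).

Lemma colim_eqxx x : colim_eq x x.
Proof.
by have [k [ik _]] := ds_directed (tag x) (tag x); exists k, ik, ik.
Qed.

Lemma colim_eq_sym x y : colim_eq x y -> colim_eq y x.
Proof. by move=> [k [ik [jk E]]]; exists k, jk, ik. Qed.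

Lemma colim_eq_trans y x z : colim_eq x y -> colim_eq y z -> colim_eq x z.
Proof.
move=> [k [ik [jk E]]] [l [jl [ml E']]]; have [n [kn ln]] := ds_directed k l.
exists n, (ds_trans ik kn), (ds_trans ml ln).
rewrite -(ds_tr_comp ik kn) E -(ds_tr_comp ml ln) -E'.
by rewrite (ds_tr_comp _ _ (ds_trans jk kn)) (ds_tr_comp _ _ (ds_trans jk kn)).
Qed.

Definition colim : Type := {C : set elt | exists x, C = colim_eq x}.
HB.instance Definition _ := gen_eqMixin colim.
HB.instance Definition _ := gen_choiceMixin colim.

Definition to_colim i (a : ds_ring i) : colim :=
  exist _ (colim_eq (Tagged (@ds_ring D) a)) (ex_intro _ _ erefl).

Lemma eq_to_colim i (a : ds_ring i) j (b : ds_ring j) :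
  to_colim a = to_colim b <->
  exists k (ik : ds_le i k) (jk : ds_le j k), ds_tr ik a = ds_tr jk b.
Proof.
split.
- move=> /(congr1 sval) /= E.
  by have := colim_eqxx (Tagged (@ds_ring D) b); rewrite -E.
- move=> ab; apply: eq_exist; rewrite predeqE => z; split => H.
  + apply: colim_eq_trans H; exact: colim_eq_sym.
  + exact: colim_eq_trans H.
Qed.

Lemma to_colim_tr i k (ik : ds_le i k) (a : ds_ring i) : to_colim (ds_tr ik a) = to_colim a.
Proof.
have [l [kl _]] := ds_directed k k; apply/eq_to_colim.
by exists l, kl, (ds_trans ik kl); rewrite (ds_tr_comp _ _ (ds_trans ik kl)).
Qed.

Lemma colimP (x : colim) : exists i (a : ds_ring i), x = to_colim a.
Proof. by case: x => C [[i a] CE]; exists i, a; exact: (@eq_exist _ _ _ _ _ _ CE). Qed.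

Lemma colim_common (x y : colim) :
  exists i (a b : ds_ring i), x = to_colim a /\ y = to_colim b.
Proof.
have [i [a ->]] := colimP x; have [j [b ->]] := colimP y.
have [k [ik jk]] := ds_directed i j.
by exists k, (ds_tr ik a), (ds_tr jk b); rewrite !to_colim_tr.
Qed.

Lemma colim_common3 (x y z : colim) :
  exists i (a b c : ds_ring i), [/\ x = to_colim a, y = to_colim b & z = to_colim c].
Proof.
have [i [a [b [-> ->]]]] := colim_common x y; have [j [c ->]] := colimP z.
have [k [ik jk]] := ds_directed i j.
by exists k, (ds_tr ik a), (ds_tr ik b), (ds_tr jk c); rewrite !to_colim_tr.
Qed.

Section BinaryOperation.
Variable op : forall R : comPzRingType, R -> R -> R.
Hypothesis op_rmorph : forall (R R' : comPzRingType) (f : {rmorphism R -> R'}) a b,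
  f (op a b) = op (f a) (f b).

(** Addition, product and opposite are treated at once as operations natural in the ring; the
    opposite is a binary operation that ignores its second argument. *)
Fact colim_op_ex (x y : colim) : exists z, forall i (a b : ds_ring i),
  x = to_colim a -> y = to_colim b -> z = to_colim (op a b).
Proof.
have [i [a [b [-> ->]]]] := colim_common x y; exists (to_colim (op a b)).
move=> j a' b' /eq_to_colim [k [ik [jk E]]] /eq_to_colim [l [il [jl E']]].
have [n [kn ln]] := ds_directed k l; apply/eq_to_colim.
exists n, (ds_trans ik kn), (ds_trans jk kn); rewrite !op_rmorph.
rewrite -!(ds_tr_comp ik kn) -!(ds_tr_comp jk kn) E; congr (op _ _).
rewrite (ds_tr_comp ik kn (ds_trans il ln)) (ds_tr_comp jk kn (ds_trans jl ln)).
by rewrite -(ds_tr_comp il ln) E' (ds_tr_comp jl ln (ds_trans jl ln)).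
Qed.
Definition colim_op x y := sval (cid (colim_op_ex x y)).
Lemma colim_opE i (a b : ds_ring i) :
  colim_op (to_colim a) (to_colim b) = to_colim (op a b).
Proof. by rewrite /colim_op; case: cid => y /= /(_ _ _ _ erefl erefl). Qed.
End BinaryOperation.

Fact add_rmorph (R R' : comPzRingType) (f : {rmorphism R -> R'}) a b :
  f (a + b) = f a + f b.
Proof. exact: rmorphD. Qed.
Fact mul_rmorph (R R' : comPzRingType) (f : {rmorphism R -> R'}) a b :
  f (a * b) = f a * f b.
Proof. exact: rmorphM. Qed.
Fact opp_rmorph (R R' : comPzRingType) (f : {rmorphism R -> R'}) (a b : R) :
  f (- a) = - f a.
Proof. exact: rmorphN. Qed.

Definition colim_add := colim_op add_rmorph.
Definition colim_mul := colim_op mul_rmorph.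
Definition colim_opp x := colim_op opp_rmorph x x.

Variable i0 : ds_index D.

(** The index is only there to provide the zero and the unit. *)
Definition colim_ring (_ : ds_index D) : Type := colim.
Local Notation C := (colim_ring i0).
HB.instance Definition _ := Choice.on C.

Definition colim0 : C := to_colim (0 : ds_ring i0).
Definition colim1 : C := to_colim (1 : ds_ring i0).

Lemma colim0E i : colim0 = to_colim (0 : ds_ring i).
Proof.
have [k [ik jk]] := ds_directed i0 i; apply/eq_to_colim.
by exists k, ik, jk; rewrite !rmorph0.
Qed.
Lemma colim1E i : colim1 = to_colim (1 : ds_ring i).
Proof.
have [k [ik jk]] := ds_directed i0 i; apply/eq_to_colim.
by exists k, ik, jk; rewrite !rmorph1.
Qed.

Fact colim_addA : @associative C colim_add.
Proof.
move=> x y z; have [i [a [b [c [-> -> ->]]]]] := colim_common3 x y z.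
by rewrite /colim_add !colim_opE addrA.
Qed.
Fact colim_addC : @commutative C C colim_add.
Proof.
move=> x y; have [i [a [b [-> ->]]]] := colim_common x y.
by rewrite /colim_add !colim_opE addrC.
Qed.
Fact colim_add0 : @left_id C C colim0 colim_add.
Proof.
by move=> x; have [i [a ->]] := colimP x; rewrite (colim0E i) /colim_add colim_opE add0r.
Qed.
Fact colim_addN : @left_inverse C C C colim0 colim_opp colim_add.
Proof.
move=> x; have [i [a ->]] := colimP x.
by rewrite (colim0E i) /colim_add /colim_opp !colim_opE addNr.
Qed.
HB.instance Definition _ :=
  GRing.isZmodule.Build C colim_addA colim_addC colim_add0 colim_addN.

Fact colim_mulA : @associative C colim_mul.
Proof.
move=> x y z; have [i [a [b [c [-> -> ->]]]]] := colim_common3 x y z.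
by rewrite /colim_mul !colim_opE mulrA.
Qed.
Fact colim_mulC : @commutative C C colim_mul.
Proof.
move=> x y; have [i [a [b [-> ->]]]] := colim_common x y.
by rewrite /colim_mul !colim_opE mulrC.
Qed.
Fact colim_mul1 : @left_id C C colim1 colim_mul.
Proof.
by move=> x; have [i [a ->]] := colimP x; rewrite (colim1E i) /colim_mul colim_opE mul1r.
Qed.
Fact colim_mulD : @left_distributive C C colim_mul colim_add.
Proof.
move=> x y z; have [i [a [b [c [-> -> ->]]]]] := colim_common3 x y z.
by rewrite /colim_mul /colim_add !colim_opE mulrDl.
Qed.
HB.instance Definition _ := GRing.Zmodule_isComPzRing.Build C
  colim_mulA colim_mulC colim_mul1 colim_mulD.

Definition colim_in i (a : ds_ring i) : C := to_colim a.
Fact colim_in_zmod i : zmod_morphism (@colim_in i).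
Proof.
move=> a b; rewrite -[RHS]/(colim_add (to_colim a) (colim_opp (to_colim b))).
by rewrite /colim_opp /colim_add !colim_opE.
Qed.
Fact colim_in_monoid i : monoid_morphism (@colim_in i).
Proof.
split; first by rewrite -[RHS]/(colim1) (colim1E i).
move=> a b; rewrite -[RHS]/(colim_mul (to_colim a) (to_colim b)).
by rewrite /colim_mul colim_opE.
Qed.
HB.instance Definition _ i := GRing.isZmodMorphism.Build _ C (@colim_in i) (@colim_in_zmod i).
HB.instance Definition _ i :=
  GRing.isMonoidMorphism.Build _ C (@colim_in i) (@colim_in_monoid i).

End Colimit.

Section ColimitTheory.
Variables (D : directed_system) (i0 : ds_index D).

Lemma colim_in_tr i k (ik : ds_le i k) (a : ds_ring i) :
  colim_in i0 (ds_tr ik a) = colim_in i0 a.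
Proof. exact: to_colim_tr. Qed.

Lemma colim_inP (x : colim_ring i0) : exists i (a : ds_ring i), x = colim_in i0 a.
Proof. exact: colimP. Qed.

Lemma eq_colim_in i (a : ds_ring i) j (b : ds_ring j) :
  colim_in i0 a = colim_in i0 b ->
  exists k (ik : ds_le i k) (jk : ds_le j k), ds_tr ik a = ds_tr jk b.
Proof. by move=> /eq_to_colim. Qed.

Lemma colim_in_common (x y : colim_ring i0) :
  exists i (a b : ds_ring i), x = colim_in i0 a /\ y = colim_in i0 b.
Proof. exact: colim_common. Qed.

Lemma colim_rmorph_exists (R : comPzRingType) (f : forall i, {rmorphism ds_ring i -> R}) :
  (forall i k (ik : ds_le i k) (a : @ds_ring D i), f k (ds_tr ik a) = f i a) ->
  exists g : {rmorphism colim_ring i0 -> R}, forall i (a : ds_ring i), g (colim_in i0 a) = f i a.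
Proof.
move=> fE.
have /choice [g gP] (x : colim_ring i0) : exists y, forall i (a : ds_ring i),
    x = colim_in i0 a -> y = f i a.
  have [i [a ->]] := colim_inP x; exists (f i a) => j b /eq_colim_in [k [ik [jk E]]].
  by rewrite -(fE _ _ ik) -(fE _ _ jk) E.
have gE i (a : ds_ring i) : g (colim_in i0 a) = f i a by exact: gP.
have gB : zmod_morphism g.
  move=> x y; have [i [a [b [-> ->]]]] := colim_in_common x y.
  by rewrite -rmorphB !gE rmorphB.
have gM : monoid_morphism g.
  split=> [|x y]; first by rewrite -(rmorph1 (@colim_in _ i0 i0)) gE rmorph1.
  have [i [a [b [-> ->]]]] := colim_in_common x y.
  by rewrite -rmorphM !gE rmorphM.
pose G : {rmorphism colim_ring i0 -> R} :=
  HB.pack g (GRing.isZmodMorphism.Build _ _ _ gB) (GRing.isMonoidMorphism.Build _ _ _ gM).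
by exists G.
Qed.
End ColimitTheory.

(** * Iterated Frobenius and residue fields *)

Section FrobeniusPower.
Variables (p : nat) (pr_p : prime p) (R : comPzRingType) (pR : p%:R = 0 :> R).

Lemma frobenius_add (a b : R) : (a + b) ^+ p = a ^+ p + b ^+ p.
Proof.
rewrite exprDn -(prednK (prime_gt0 pr_p)) big_ord_recl big_ord_recr /=.
rewrite bin0 binn subn0 subnn !expr0 mulr1 mul1r big1 ?add0r // => i _.
rewrite /bump /= add1n; set k := i.+1.
have /dvdnP [m ->] : (p %| 'C(p.-1.+1, k))%N.
  have := ltn_ord i; rewrite -ltnS (prednK (prime_gt0 pr_p)) => ltip.
  exact: prime_dvd_bin.
by rewrite -mulr_natr natrM pR !mulr0.
Qed.

Lemma frobenius_iter_add n (a b : R) :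
  (a + b) ^+ (p ^ n) = a ^+ (p ^ n) + b ^+ (p ^ n).
Proof.
elim: n a b => [|n IHn] a b; first by rewrite !expr1.
by rewrite expnS !exprM frobenius_add IHn.
Qed.

Lemma frobenius_iter_sub n (a b : R) :
  (a - b) ^+ (p ^ n) = a ^+ (p ^ n) - b ^+ (p ^ n).
Proof.
by apply: (addIr (b ^+ (p ^ n))); rewrite -frobenius_iter_add !subrK.
Qed.

Definition frobenius_iter (_ : prime p) (_ : p%:R = 0 :> R) n (a : R) : R := a ^+ (p ^ n).
Fact frobenius_iter_zmod n : zmod_morphism (frobenius_iter pr_p pR n).
Proof. by move=> a b; exact: frobenius_iter_sub. Qed.
Fact frobenius_iter_monoid n : monoid_morphism (frobenius_iter pr_p pR n).
Proof. by split=> [|a b]; rewrite /frobenius_iter ?expr1n ?exprMn. Qed.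
HB.instance Definition _ n := GRing.isZmodMorphism.Build R R
  (frobenius_iter pr_p pR n) (frobenius_iter_zmod n).
HB.instance Definition _ n := GRing.isMonoidMorphism.Build R R
  (frobenius_iter pr_p pR n) (frobenius_iter_monoid n).
End FrobeniusPower.

Lemma residue_field (A : comPzRingType) (P : set A) : is_prime_ideal P ->
  exists (K : fieldType) (i : {rmorphism A -> K}),
    (forall a, i a = 0 <-> P a) /\
    (forall x, exists a s, ~ P s /\ i s * x = i a).
Proof.
move=> pP; have [idP P1 PM] := pP.
have [L [i [unitS iS i0]]] := exists_localization (prime_ideal_compl pP) idP.
have i0P a : i a = 0 <-> P a.
  rewrite i0; split=> [[u [Pu Pua]]|Pa]; first by case: (PM _ _ Pua).
  by exists 1; rewrite mul1r.
have [||K [f [g [fg gf]]]] := @exists_field L.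
- by rewrite -(rmorph1 i) => /i0P.
- move=> x xn0; have [a [s [Ps sx]]] := iS x.
  have [|v av] := unitS a.
    move=> /i0P a0; apply: xn0; have [v sv] := unitS s Ps.
    by rewrite -[x]mul1r -sv mulrAC sx a0 mul0r.
  by exists (i s * v); rewrite mulrA [x * _]mulrC sx.
exists K, (f \o i); split=> [a|x] /=.
  rewrite -i0P; split=> [/(congr1 g)|->]; last exact: rmorph0.
  by rewrite fg rmorph0.
have [a [s [Ps sx]]] := iS (g x); exists a, s; split => //.
by rewrite -sx rmorphM gf.
Qed.

(** * Extensions of a perfect ring whose spectra are homeomorphic over the affine line *)

Section PerfectExtension.
Variables (p : nat) (pr_p : prime p) (A B : comNzRingType) (j : {rmorphism A -> B}).
Hypotheses (pA : p%:R = 0 :> A) (perfA : forall a : A, exists a', a' ^+ p = a).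
Hypotheses (redB : forall (b : B) n, b ^+ n = 0 -> b = 0).
Let m : {rmorphism {poly A} -> {poly B}} := map_poly j.
Hypothesis contraction_inj : forall N N', is_prime_ideal N -> is_prime_ideal N' ->
  m @^-1` N = m @^-1` N' -> N = N'.
Hypothesis contraction_surj : forall Q, is_prime_ideal Q ->
  exists2 N, is_prime_ideal N & m @^-1` N = Q.
Hypothesis contraction_closed : forall J : set {poly B}, exists I : set {poly A},
  forall Q, is_prime_ideal Q ->
    (I `<=` Q <-> exists N, [/\ is_prime_ideal N, J `<=` N & m @^-1` N = Q]).

(** [A[b]] is never formed: it is handled as [{poly A}] modulo the kernel of [ev b], and its primes
    as the primes of [{poly A}] containing that kernel. *)
Let ev (c : B) (g : {poly A}) : B := (m g).[c].

Let ev_rmorph c : {rmorphism {poly A} -> B} := horner_eval c \o m.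

Let evE c g : ev_rmorph c g = ev c g. Proof. by []. Qed.

(** Surjectivity is carried from the line to [A] by the zero section: the primes over the pullback
    of [P] under [X := 0] are restricted to constants. Uniqueness below uses the same section. *)
Lemma lying_over P : is_prime_ideal P -> exists2 n, is_prime_ideal n & j @^-1` n = P.
Proof.
move=> pP; have [|N pN NE] := @contraction_surj (horner_eval 0 @^-1` P).
  exact: preimage_prime.
exists (polyC @^-1` N); first exact: preimage_prime.
rewrite predeqE => a; rewrite /preimage /=.
have -> : P a = (horner_eval 0 @^-1` P) a%:P by rewrite /preimage /= /horner_eval hornerC.
by rewrite -NE /preimage /= map_polyC.
Qed.

Lemma prime_over_unique n n' : is_prime_ideal n -> is_prime_ideal n' ->
  j @^-1` n = j @^-1` n' -> n = n'.
Proof.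
move=> pn pn' E.
have : @horner_eval B 0 @^-1` n = @horner_eval B 0 @^-1` n'.
  apply: contraction_inj; try exact: preimage_prime.
  rewrite predeqE => g; rewrite /preimage /= /horner_eval !horner_coef0 coef_map.
  by have := congr1 (fun X => X g`_0) E; rewrite /preimage /= => ->.
move=> F; rewrite predeqE => c.
by have := congr1 (fun X => X c%:P) F; rewrite /preimage /= /horner_eval hornerC => ->.
Qed.

Let eval_dvd (G : {poly B}) c : exists H, G = G.[c]%:P + H * ('X - c%:P).
Proof.
have : root (G - G.[c]%:P) c by rewrite /root !hornerE subrr.
by move=> /factor_theorem [H HE]; exists H; rewrite -HE addrC subrK.
Qed.

(** The closed set [b X = 1] has closed image in the affine line, missing the
    zero section: this forces [b] to be integral. *)
Lemma integral_of_closed b : exists2 g : {poly A}, g \is monic & ev b g = 0.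
Proof.
have [I clI] := contraction_closed [set b%:P * 'X - 1].
(* [I0] is the radical of [I], the functions vanishing on the image of [b X = 1]. A prime containing
   [I0] and [X] would be contracted from one containing [b X - 1] and [X], hence 1; so [I0] and [X]
   generate the unit ideal. *)
pose I0 := [set g | forall Q, is_prime_ideal Q -> I `<=` Q -> Q g].
have [g [h [I0g gh]]] : exists g h, I0 g /\ 1 = g + h * 'X.
  apply: contrapT => no1.
  have [|||Q [pQ JQ Q1]] := @krull _ [set x | exists g h, I0 g /\ x = g + h * 'X] [set 1].
  - split; first by exists 0, 0; rewrite mul0r addr0; split => // Q [[]].
    + move=> _ _ [g [h [Ig ->]]] [g' [h' [Ig' ->]]].
      exists (g + g'), (h + h'); split; last by ring.
      by move=> Q pQ IQ; have [[_ D _] _ _] := pQ; apply: D; [exact: Ig|exact: Ig'].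
    + move=> a _ [g [h [Ig ->]]]; exists (a * g), (a * h); split; last by ring.
      by move=> Q pQ IQ; have [[_ _ M] _ _] := pQ; apply: M; exact: Ig.
  - by split=> // a c -> ->; rewrite mulr1.
  - by move=> a [g [h gh]] a1; apply: no1; exists g, h; rewrite -a1.
  have /(clI _ pQ) [N [pN JN NE]] : I `<=` Q.
    move=> g Ig; apply: JQ; exists g, 0; rewrite mul0r addr0; split => //.
    by move=> Q' _; apply.
  have NX : N 'X.
    have : Q 'X by apply: JQ; exists 0, 1; rewrite mul1r add0r; split => // Q' [[]].
    by rewrite -NE /preimage /= map_polyX.
  have [idN N1 _] := pN; apply: N1.
  have -> : (1 : {poly B}) = b%:P * 'X - (b%:P * 'X - 1) by ring.
  by apply: ideal_sub => //; [case: idN => _ _; apply|apply: JN].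
(* Every prime containing [b X - 1] contracts into the closed set of [I], hence contains [m g]: some
   power of [m g] is a multiple of [b X - 1]. *)
have [||n [c cE]] := @radical_primes _ [set G | exists c, G = (b%:P * 'X - 1) * c] (m g).
- split; first by exists 0; rewrite mulr0.
  + by move=> _ _ [c ->] [d ->]; exists (c + d); rewrite mulrDr.
  + by move=> a _ [c ->]; exists (a * c); ring.
- move=> N pN JN.
  have pQ : is_prime_ideal (m @^-1` N) by exact: preimage_prime.
  suff IQ : I `<=` m @^-1` N by exact: (I0g _ pQ).
  apply/(clI _ pQ); exists N; split => // _ ->.
  by apply: JN; exists 1; rewrite mulr1.
pose f := g ^+ n.
have f0 : f`_0 = 1.
  rewrite /f -horner_coef0 horner_exp; have := congr1 (fun q => q.[0]) gh.
  by rewrite !hornerE => <-; rewrite expr1n.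
have fE i : j f`_i = (if i == 0%N then 0 else b * c`_i.-1) - c`_i.
  have : (m f)`_i = ((b%:P * 'X - 1) * c)`_i by rewrite /f rmorphXn /= cE.
  rewrite coef_map => ->; rewrite mulrBl mul1r coefB -mulrA coefCM coefXM.
  by case: eqP => _; rewrite ?mulr0.
(* By [fE] the coefficients are [b * c_(i-1) - c_i], so the sum telescopes once weighted by the
   powers of [b]. *)
have tele D : \sum_(i < D.+1) j f`_i * b ^+ (D - i) = - c`_D.
  elim: D => [|D IHD]; first by rewrite big_ord_recr big_ord0 fE /= expr0; ring.
  rewrite big_ord_recr /= subnn expr0 fE /=.
  rewrite (eq_bigr (fun i : 'I_D.+1 => b * (j f`_i * b ^+ (D - i)))); last first.
    by move=> i _; rewrite subSn ?exprS; [ring|rewrite -ltnS].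
  by rewrite -mulr_sumr IHD; ring.
(* For this [D] the leftover [c_D] is zero. The reversal [g1] of [f] in degree [D] has leading
   coefficient [f_0 = 1], and its value at [b] is the telescoped sum. *)
pose D := size c.
pose g1 : {poly A} := \poly_(i < D.+1) f`_(D - i).
have sg : size g1 = D.+1.
  by rewrite size_poly_eq // subnn f0 oner_neq0.
exists g1.
  by rewrite monicE lead_coefE sg coef_poly ltnSn /= subnn f0.
rewrite /ev (@horner_coef_wide _ D.+1); last first.
  by rewrite (leq_trans (size_poly _ _)) // sg.
rewrite (reindex_inj rev_ord_inj) /=.
rewrite (eq_bigr (fun i : 'I_D.+1 => j f`_i * b ^+ (D - i))) ?tele ?nth_default ?oppr0 //.
move=> i _; rewrite coef_map /= coef_poly subSS ltnS leq_subr.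
by rewrite subKn // -ltnS.
Qed.

(** The closed set [X = b] has as image the closed set of the kernel of [ev b]. *)
Lemma prime_of_kernel b Q : is_prime_ideal Q -> (forall g, ev b g = 0 -> Q g) ->
  exists2 n, is_prime_ideal n & forall g, Q g <-> n (ev b g).
Proof.
move=> pQ kQ; have [I clI] := contraction_closed [set 'X - b%:P].
have IQ : I `<=` Q.
  move=> g Ig; apply: kQ.
  suff [n] : exists n, [set 0] (ev b g ^+ n) by exact: redB.
  apply: radical_primes => [|n pn _].
    split=> // [a c -> ->|a c ->]; first by rewrite addr0.
    by rewrite /= mulr0.
  have pN : is_prime_ideal (@horner_eval B b @^-1` n) by exact: preimage_prime.
  have pQ' : is_prime_ideal (m @^-1` (@horner_eval B b @^-1` n)) by exact: preimage_prime.
  have [_] := clI _ pQ'; apply => //; exists (@horner_eval B b @^-1` n); split => // _ ->.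
  by rewrite /preimage /= /horner_eval !hornerE subrr; case: pn => [[]].
have /(clI _ pQ) [N [pN JN NE]] := IQ.
exists (polyC @^-1` N) => [|g]; first exact: preimage_prime.
(* [N] contains [X - b], so modulo [N] the polynomial [m g] is the constant [ev b g]. *)
rewrite -NE /preimage /=; have [H HE] := eval_dvd (m g) b.
have [idN _ _] := pN; have NH : N (H * ('X - b%:P)).
  by case: idN => _ _; apply; apply: JN.
rewrite /ev; split => Ng.
- have -> : (m g).[b]%:P = m g - H * ('X - b%:P) by rewrite {2}HE addrK.
  exact: ideal_sub.
- by rewrite HE; case: idN => _ D _; apply: D.
Qed.

Lemma perfect_iter (a : A) n : exists a', a' ^+ (p ^ n) = a.
Proof.
elim: n a => [|n IHn] a; first by exists a.
by have [a' <-] := perfA a; have [c <-] := IHn a'; exists c; rewrite expnSr exprM.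
Qed.

(** Purely inseparable residue field extensions are trivial because [A] is perfect. *)
Lemma residue_fraction b P n : is_prime_ideal P -> is_prime_ideal n -> j @^-1` n = P ->
  exists a s, ~ P s /\ n (j s * b - j a).
Proof.
move=> pP pn nP.
have [K [iA [iA0 iAS]]] := residue_field pP; have [L [iB [iB0 iBS]]] := residue_field pn.
have iAu s : ~ P s -> is_unit (iA s).
  move=> Ps; exists (iA s)^-1; rewrite divff //.
  by apply/eqP => /iA0.
have [|||i iE] := @localization_rmorph A K L (~` P) iA (iB \o j) iAu iAS.
- exact: prime_ideal_compl.
- by move=> a /iA0; rewrite -nP /= => /iB0.
- move=> s Ps; exists (iB (j s))^-1; rewrite /= divff //.
  by apply/eqP => /iB0 ns; apply: Ps; rewrite -nP.
pose be := iB b.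
pose alg mu := mu != 0 /\ (map_poly i mu).[be] = 0.
have [g0 mg0 g00] := integral_of_closed b.
have iAB (g : {poly A}) : map_poly i (map_poly iA g) = map_poly iB (m g).
  by apply/polyP => k; rewrite !coef_map /= iE.
have algg : alg (map_poly iA g0).
  split; first exact: monic_neq0 (monic_map _ mg0).
  by rewrite iAB horner_map -/(ev b g0) g00 rmorph0.
have exn : exists n, `[< exists2 mu, alg mu & size mu = n >].
  by exists (size (map_poly iA g0)); apply/asboolP; exists (map_poly iA g0).
case: (ex_minnP exn) => d /asboolP [mu [mu0 mube] szmu] mind.
have min_dvd g : (map_poly i g).[be] = 0 -> mu %| g.
  move=> gbe; apply/modp_eq0P/eqP; apply: contraT => r0.
  have := mind (size (g %% mu)).
  suff -> : `[< exists2 nu, alg nu & size nu = size (g %% mu) >].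
    by move=> /(_ isT); rewrite -szmu leqNgt ltn_modp mu0.
  apply/asboolP; exists (g %% mu) => //; split => //.
  have := gbe; rewrite {1}(divp_eq g mu) rmorphD rmorphM !hornerE mube.
  by rewrite mulr0 add0r.
(* The polynomials over [B] that the minimal polynomial [mu] of [be] divides over [L]. A prime over
   [E] contracts to a prime containing the kernel of [ev b], so injectivity makes it the pullback of
   a prime of [B] under evaluation at [b], and it contains [X - b]. Thus [mu] divides a power of
   [X - be]. *)
pose E := [set G : {poly B} | map_poly i mu %| map_poly iB G].
have [||k Ek] := @radical_primes _ E ('X - b%:P).
- split; rewrite /E /=; first by rewrite rmorph0 dvdp0.
  + by move=> G H; rewrite rmorphD; exact: dvdp_add.
  + by move=> G H; rewrite rmorphM; exact: dvdp_mull.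
- move=> N pN EN.
  have pQ : is_prime_ideal (m @^-1` N) by exact: preimage_prime.
  have [|n' pn' n'E] := @prime_of_kernel b _ pQ.
    move=> g gb; apply: EN; rewrite /E /= -iAB dvdp_map; apply: min_dvd.
    by rewrite iAB horner_map -/(ev b g) gb rmorph0.
  have <- : @horner_eval B b @^-1` n' = N.
    apply: contraction_inj => //; first exact: preimage_prime.
    by rewrite predeqE => g; rewrite n'E.
  by rewrite /preimage /= /horner_eval !hornerE subrr; case: pn' => [[]].
have pL : p%:R = 0 :> L.
  by rewrite -(rmorph_nat iB) -(rmorph_nat j) pA !rmorph0.
have pLX : p%:R = 0 :> {poly L} by rewrite -polyC_natr pL.
(* As [k <= p ^ k], [mu] divides [('X - be%:P) ^+ q], which Frobenius turns into
   [X ^ q - be ^ q]. *)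
pose q := (p ^ k)%N.
have dvd_q : map_poly i mu %| 'X^q - (be ^+ q)%:P.
  rewrite polyC_exp -(frobenius_iter_sub pr_p pLX).
  have kq : (k <= q)%N by rewrite ltnW // ltn_expl // prime_gt1.
  rewrite -/q -(subnK kq) exprD dvdp_mull //.
  by have := Ek; rewrite /E /= rmorphXn rmorphB /= map_polyX map_polyC.
have szmu1 : (1 < size mu)%N.
  rewrite ltnNge; apply/negP => /size1_polyC muC.
  move: mube mu0; rewrite muC map_polyC hornerC => /eqP.
  by rewrite fmorph_eq0 polyC_eq0 => ->.
(* The remainder of [X ^ q] and the constant [be ^ q] are congruent modulo [mu] and both of smaller
   degree, hence equal: [be ^ q] comes from [K]. *)
have rC : map_poly i ('X^q %% mu) = (be ^+ q)%:P.
  apply/eqP; rewrite -subr_eq0; apply: contraT => r0.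
  have : map_poly i mu %| map_poly i ('X^q %% mu) - (be ^+ q)%:P.
    have -> : map_poly i ('X^q %% mu) - (be ^+ q)%:P =
        ('X^q - (be ^+ q)%:P) - map_poly i ('X^q %/ mu) * map_poly i mu.
      have XE : 'X^q = map_poly i ('X^q %/ mu) * map_poly i mu + map_poly i ('X^q %% mu).
        by rewrite -rmorphM -rmorphD -divp_eq /= map_polyXn.
      by rewrite XE; ring.
    by rewrite dvdp_sub // dvdp_mull.
  move=> /(dvdp_leq r0); rewrite size_map_poly leqNgt => /negP [].
  apply: (leq_ltn_trans (size_polyD _ _)); rewrite gtn_max size_map_poly ltn_modp mu0 /=.
  by rewrite size_polyN (leq_ltn_trans (size_polyC_leq1 _)).
pose r := ('X^q %% mu)`_0.
have ir : i r = be ^+ q by have := congr1 (fun f : {poly L} => f`_0) rC; rewrite coef_map coefC.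
have [a [s [Ps sr]]] := iAS r.
(* With [r = a / s], the [q]-th power of [a' / s] is [a * s ^ (q - 1) / s ^ q = r], so [a' / s] maps
   to [be]. *)
have [a' a'E] := perfect_iter (a * s ^+ q.-1) k.
exists a', s; split => //; apply/iB0.
have q0 : (0 < q)%N by rewrite expn_gt0 prime_gt0.
suff /eqP : iB (j s * b - j a') ^+ q = 0 by rewrite expf_eq0 => /andP [_ /eqP].
have iBj x : iB (j x) = i (iA x) by rewrite iE.
rewrite rmorphB (frobenius_iter_sub pr_p pL) -/q rmorphM exprMn -/be -ir !iBj.
rewrite -[i (iA a') ^+ q]rmorphXn -[iA a' ^+ q]rmorphXn a'E !rmorphM !rmorphXn.
by rewrite -sr rmorphM -[in X in X - _](prednK q0) exprS; ring.
Qed.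

Lemma frobenius_iter_inj (x y : B) n : x ^+ (p ^ n) = y ^+ (p ^ n) -> x = y.
Proof.
have pB : p%:R = 0 :> B by rewrite -(rmorph_nat j) pA rmorph0.
move=> E; apply/eqP; rewrite -subr_eq0; apply/eqP.
by apply: (@redB _ (p ^ n)); rewrite (frobenius_iter_sub pr_p pB) E subrr.
Qed.

(** The conductor of [A] in [A[b]]. It is a radical ideal of [A[b]]; at a minimal
    prime [P] over it, [A[b]] has a single prime, with trivial residue extension,
    so that [s b] lies in [A] for some [s] outside [P], hence so does [s ^+ D]. *)
Lemma perfect_extension_surj b : exists a, j a = b.
Proof.
pose c := [set x | forall i, exists y, j y = j x * b ^+ i].
(* The image of the conductor is stable under [A[b]]: the product with any [ev b G] again comes from
   an element of [c]. *)
have cG x (G : {poly A}) : c x -> exists2 y, c y & j y = j x * ev b G.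
  move=> cx; have key : forall i, exists y, j y = j x * ev b G * b ^+ i.
    elim/poly_ind: G => [|G g IHG] i.
      by exists 0; rewrite /ev !rmorph0 horner0 mulr0 mul0r.
    have [y1 y1E] := IHG i.+1; have [y2 y2E] := cx i.
    exists (y1 + y2 * g); rewrite rmorphD rmorphM y1E y2E exprS.
    have -> : ev b (G * 'X + g%:P) = ev b G * b + j g.
      by rewrite /ev rmorphD rmorphM /= map_polyX map_polyC /= !hornerE.
    by ring.
  have [y yE] := key 0%N; exists y; last by rewrite yE mulr1.
  by move=> i; have [z zE] := key i; exists z; rewrite zE yE mulr1.
have evC x : ev b x%:P = j x by rewrite /ev /= map_polyC hornerC.
have idc : is_ideal c.
  split=> [i|x y cx cy i|x y cy i]; first by exists 0; rewrite rmorph0 mul0r.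
  - have [x' x'E] := cx i; have [y' y'E] := cy i.
    by exists (x' + y'); rewrite !rmorphD x'E y'E mulrDl.
  - have [y' y'E] := cy i.
    by exists (x * y'); rewrite !rmorphM y'E mulrA.
suff /(_ 1%N) [a aE] : c 1 by exists a; rewrite aE rmorph1 mul1r expr1.
apply: contrapT => c1.
have [S [mS cS maxS]] := max_mult_closed idc c1.
have [pP cP] := max_mult_closed_prime idc mS cS maxS.
have [S1 SM] := mS.
have [n pn nP] := lying_over pP.
have [a [s [/contrapT Ss ns]]] := residue_fraction b pP pn nP.
pose lin : {poly A} := s%:P * 'X - a%:P.
have evlin : ev b lin = j s * b - j a.
  by rewrite /ev /lin rmorphB rmorphM /= map_polyX !map_polyC /= !hornerE.
(* The goal is that the conductor, pulled back to [{poly A}] as [c'], contains some [u * lin ^ k]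
   with [u] in [S]: locally at the minimal prime, [s b - a] is nilpotent modulo the conductor. *)
pose Sig := [set G | exists u k, S u /\ G = u%:P * lin ^+ k].
have mSig : mult_closed Sig.
  split; first by exists 1, 0%N; rewrite expr0 mulr1.
  move=> _ _ [u [k [Su ->]]] [v [l [Sv ->]]]; exists (u * v), (k + l)%N.
  by split; [exact: SM|rewrite polyCM exprD; ring].
pose c' := [set g | exists2 x, c x & ev b g = j x].
have evM g h : ev b (g * h) = ev b g * ev b h by rewrite -!evE rmorphM.
have evX g k : ev b (g ^+ k) = ev b g ^+ k by rewrite -!evE rmorphXn.
have idc' : is_ideal c'.
  have [c0 cD cM] := idc; split.
  - by exists 0; rewrite // -evE !rmorph0.
  - move=> g h [x cx gx] [y cy hy]; exists (x + y); first exact: cD.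
    by rewrite -evE !rmorphD !evE gx hy.
  - move=> g h [y cy hy]; have [z cz zE] := cG _ g cy.
    by exists z; rewrite // zE evM hy mulrC.
have [u [k [Su [x cx xE]]]] : exists u k, S u /\ c' (u%:P * lin ^+ k).
  apply: contrapT => dis.
  have [|Q [pQ c'Q QSig]] := @krull _ c' Sig idc' mSig.
    by move=> g c'g [u [k [Su gE]]]; apply: dis; exists u, k; rewrite -gE.
  have [|n' pn' n'E] := @prime_of_kernel b _ pQ.
    by move=> g g0; apply: c'Q; exists 0; rewrite ?rmorph0 //; case: idc.
  have pT : is_prime_ideal (polyC @^-1` Q) by exact: preimage_prime.
  (* The contraction of [Q] to [A] contains [c] and misses [S], so by maximality it is the
     complement of [S]. Then [n'] lies over the same prime as [n], equals it, and puts [lin] in [Q],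
     which avoids [Sig]. *)
  have TS : ~` (polyC @^-1` Q) = S.
    apply: maxS; first exact: prime_ideal_compl.
    - by move=> y cy; apply; apply: c'Q; exists y.
    - move=> v Sv Qv; apply: (QSig _ Qv).
      by exists v, 0%N; rewrite expr0 mulr1.
  have nn' : n' = n.
    apply: prime_over_unique => //; rewrite nP -TS setCK predeqE => y.
    by rewrite /preimage /= n'E evC.
  have Qlin : Q lin by apply/n'E; rewrite nn' evlin.
  by apply: (QSig _ Qlin); exists 1, 1%N; rewrite mul1r expr1.
(* As [q >= k], the element [d ^+ q] is a multiple in [A[b]] of [u * lin ^ k], so it lies in the
   image of the conductor. *)
pose d := j u * ev b lin; pose q := (p ^ k)%N.
have q0 : (0 < q)%N by rewrite expn_gt0 prime_gt0.
have kq : (k <= q)%N by rewrite ltnW // ltn_expl // prime_gt1.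
have [y cy yE] : exists2 y, c y & j y = d ^+ q.
  have [y cy yE] := cG _ (u%:P ^+ q.-1 * lin ^+ (q - k)) cx.
  exists y => //; rewrite yE -xE !evM !evX !evC /d exprMn.
  have -> : j u ^+ q = j u * j u ^+ q.-1 by rewrite -exprS prednK.
  have -> : ev b lin ^+ q = ev b lin ^+ (q - k) * ev b lin ^+ k by rewrite -exprD subnK.
  by ring.
(* The radicality of the conductor: [(d b ^ i) ^ q] comes from [A], which has [q]-th roots, and
   these are unique in [B]. *)
have dA i : exists z, j z = d * b ^+ i.
  have [z zE] := cy (i * q)%N; have [w wE] := perfect_iter z k.
  exists w; apply: (@frobenius_iter_inj _ _ k).
  by rewrite -rmorphXn wE zE exprMn -exprM yE.
have [z zE] := dA 0%N.
(* [d = u (s b - a)] now comes from some [z] in [A], so [u s b] comes from [z + u a]. *)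
pose s1 := u * s; pose w := z + u * a.
have s1b : j s1 * b = j w.
  rewrite /s1 /w rmorphD !rmorphM zE expr0 mulr1 /d evlin; ring.
have [g mg g0] := integral_of_closed b.
pose D := size g.
(* By the monic equation [g], each power of [b] is a combination over [A] of the powers below [D],
   whose denominators [s1 ^+ D] clears. So [s1 ^+ D] is in the conductor, although it lies in
   [S]. *)
apply: (cS (s1 ^+ D)); last by apply: mult_closedX => //; exact: SM.
move=> i; pose r := Pdiv.CommonRing.rmodp 'X^i g.
have bi : b ^+ i = ev b r.
  have := Pdiv.RingMonic.rdivp_eq mg 'X^i => /(congr1 (ev b)).
  rewrite -[ev b (_ + _)]evE rmorphD rmorphM !evE g0 mulr0 add0r => <-.
  by rewrite evX /ev /= map_polyX hornerX.
have szr : (size r <= D)%N.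
  by rewrite ltnW // Pdiv.CommonRing.ltn_rmodp monic_neq0.
exists (\sum_(l < D) r`_l * s1 ^+ (D - l) * w ^+ l).
rewrite bi /ev (@horner_coef_wide _ D); last by rewrite (leq_trans (size_poly _ _)).
rewrite rmorph_sum mulr_sumr; apply: eq_bigr => l _.
rewrite !rmorphM !rmorphXn -s1b coef_map exprMn.
have -> : j s1 ^+ D = j s1 ^+ (D - l) * j s1 ^+ l.
  by rewrite -exprD subnK // ltnW.
by ring.
Qed.
End PerfectExtension.

(** * Stalks and morphisms of ringed spaces *)

Lemma is_unit_mul (R : comPzRingType) (a b : R) : is_unit a -> is_unit b -> is_unit (a * b).
Proof. by move=> [a' aE] [b' bE]; exists (a' * b'); rewrite mulrACA aE bE mulr1. Qed.

Lemma is_unit_mulP (R : comPzRingType) (a b : R) : is_unit (a * b) -> is_unit a /\ is_unit b.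
Proof.
by move=> [c cE]; split; [exists (b * c)|exists (a * c)]; rewrite -cE; ring.
Qed.

Lemma is_unitX (R : comPzRingType) (a : R) n : is_unit a -> is_unit (a ^+ n).
Proof.
move=> ua; elim: n => [|n IHn]; first by exists 1; rewrite mulr1.
by rewrite exprS; exact: is_unit_mul.
Qed.

Lemma is_unit_rmorph (R R' : comPzRingType) (f : {rmorphism R -> R'}) a :
  is_unit a -> is_unit (f a).
Proof. by move=> [b ab]; exists (f b); rewrite -rmorphM ab rmorph1. Qed.

Lemma is_unit_inj (R : comPzRingType) (u a b : R) : is_unit u -> u * a = u * b -> a = b.
Proof.
by move=> [v uv] E; rewrite -[a]mul1r -[b]mul1r -uv mulrAC E; ring.
Qed.

Section Stalk.
Variable X : ringed_space.

Lemma res_irr (U V : opens X) (UV UV' : U `<=` V) s : res UV s = res UV' s.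
Proof. by rewrite (Prop_irrelevance UV UV'). Qed.

Definition nbhd_index (x : X) := {U : opens X | oset U x}.
Definition nbhd_le (x : X) (i j : nbhd_index x) : Prop := sval j `<=` sval i.

Fact nbhd_directed x (i j : nbhd_index x) : exists k, nbhd_le i k /\ nbhd_le j k.
Proof.
by exists (exist _ (opensI (sval i) (sval j)) (conj (svalP i) (svalP j))); split => y [].
Qed.

Fact nbhd_trans x (i j k : nbhd_index x) : nbhd_le i j -> nbhd_le j k -> nbhd_le i k.
Proof. by move=> ij jk y /jk /ij. Qed.

Fact nbhd_tr_comp x (i j k : nbhd_index x) (ij : nbhd_le i j) (jk : nbhd_le j k)
  (ik : nbhd_le i k) (s : sect (sval i)) :
  res (jk : sval k `<=` sval j) (res (ij : sval j `<=` sval i) s) =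
  res (ik : sval k `<=` sval i) s.
Proof. exact: res_comp. Qed.

Definition stalk_system (x : X) : directed_system :=
  @DirectedSystem (nbhd_index x) (@nbhd_le x) (fun i => sect (sval i))
    (fun i j (ij : nbhd_le i j) => res (ij : sval j `<=` sval i))
    (@nbhd_directed x) (@nbhd_trans x) (@nbhd_tr_comp x).

Definition nbhdT (x : X) : ds_index (stalk_system x) := exist _ (opensT X) I.

Definition stalk (x : X) : comPzRingType := colim_ring (nbhdT x).

Definition germ (x : X) (U : opens X) (xU : oset U x) : {rmorphism sect U -> stalk x} :=
  let i : ds_index (stalk_system x) := exist _ U xU in
  (colim_in (nbhdT x) (i := i) : {rmorphism ds_ring i -> colim_ring (nbhdT x)}).
Arguments germ : simpl never.

Lemma germ_res x (U V : opens X) (VU : V `<=` U) (xV : oset V x) (xU : oset U x) s :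
  germ xV (res VU s) = germ xU s.
Proof.
exact: (@colim_in_tr _ (nbhdT x) (exist _ U xU) (exist _ V xV) VU s).
Qed.

Lemma germ_irr x (U : opens X) (xU xU' : oset U x) s : germ xU s = germ xU' s.
Proof. by rewrite (Prop_irrelevance xU xU'). Qed.

Lemma germP x (g : stalk x) : exists (U : opens X) (xU : oset U x) (s : sect U), g = germ xU s.
Proof. by have [[U xU] [s ->]] := colim_inP g; exists U, xU, s. Qed.

Lemma germ_common x (g h : stalk x) : exists (U : opens X) (xU : oset U x) (s t : sect U),
  g = germ xU s /\ h = germ xU t.
Proof. by have [[U xU] [s [t [-> ->]]]] := colim_in_common g h; exists U, xU, s, t. Qed.

Lemma eq_germ x (U V : opens X) (xU : oset U x) (xV : oset V x) s t :
  germ xU s = germ xV t ->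
  exists (W : opens X) (WU : W `<=` U) (WV : W `<=` V), oset W x /\ res WU s = res WV t.
Proof. by move=> /eq_colim_in [[W xW] [WU [WV E]]]; exists W, WU, WV. Qed.

Lemma sect_ext (U : opens X) (s t : sect U) :
  (forall x (xU : oset U x), germ xU s = germ xU t) -> s = t.
Proof.
move=> E; pose I := {W : opens X | exists WU : W `<=` U, res WU s = res WU t}.
have WU (i : I) : sval i `<=` U by case: i => W [].
have cov : (U : set X) `<=` \bigcup_(i : I) sval i.
  move=> x xU; have [W [WU1 [WU2 [xW st]]]] := eq_germ (E x xU).
  have ex : exists WU : W `<=` U, res WU s = res WU t.
    by exists WU1; rewrite st; exact: res_irr.
  by exists (exist _ W ex).
have [|v [_ uniq]] := @sect_sheaf X U I (fun i => sval i) WU (fun i => res (WU i) s) cov.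
  move=> i j; have H : opensI (sval i) (sval j) `<=` U by move=> x [xi _]; exact: (WU i).
  by rewrite !(res_comp _ _ H).
rewrite -(uniq s) // -(uniq t) // => i.
by case: (svalP i) => WU' E'; rewrite (res_irr _ WU') -E'; exact: res_irr.
Qed.

(** Gluing in which compatibility is replaced by a condition [Q] with at most one solution in each
    stalk: uniqueness supplies the agreement on overlaps. Inverses, [p]-th roots and pullbacks of
    sections are glued in this way. *)
Lemma glue_local (U : opens X) (Q : forall x, stalk x -> Prop) :
  (forall x g h, oset U x -> Q x g -> Q x h -> g = h) ->
  (forall x, oset U x -> exists (W : opens X) (t : sect W), oset W x /\
     forall y (yW : oset W y), Q y (germ yW t)) ->
  exists t : sect U, forall x (xU : oset U x), Q x (germ xU t).
Proof.
move=> Qu Qe;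
pose I := {W : opens X & {t : sect W | W `<=` U /\ forall y (yW : oset W y), Q y (germ yW t)}}.
have VU (i : I) : tag i `<=` U by case: (svalP (tagged i)).
have Qi (i : I) y (yW : oset (tag i) y) : Q y (germ yW (sval (tagged i))).
  by case: (svalP (tagged i)).
have cov : (U : set X) `<=` \bigcup_(i : I) tag i.
  move=> x xU; have [W [t [xW Qt]]] := Qe x xU.
  have sub : opensI W U `<=` W by move=> y [].
  have P : opensI W U `<=` U /\
      forall y (yW : oset (opensI W U) y), Q y (germ yW (res sub t)).
    split=> [y []//|y yW]; rewrite (germ_res sub yW (proj1 yW)); exact: Qt.
  exists (Tagged (fun W => {t : sect W | W `<=` U /\ forall y (yW : oset W y), Q y (germ yW t)})
    (exist _ (res sub t) P)) => //.
have [|v [vE _]] := @sect_sheaf X U I (fun i => tag i) VU (fun i => sval (tagged i)) cov.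
  move=> i j; apply: sect_ext => x xW; have [xi xj] := xW.
  rewrite (germ_res _ xW xi) (germ_res _ xW xj).
  by apply: Qu; [exact: VU xi|exact: Qi|exact: Qi].
exists v => x xU; have [i _ xi] := cov x xU.
by rewrite -(germ_res (VU i) xi xU) vE; exact: Qi.
Qed.

Lemma germ_unitP x (U : opens X) (xU : oset U x) (s : sect U) :
  germ_unit x s <-> is_unit (germ xU s).
Proof.
split=> [[W [WU [xW u]]]|[g]].
  by rewrite -(germ_res WU xW); exact: is_unit_rmorph.
have [V [xV [t ->]]] := germP g.
have sU : opensI U V `<=` U by move=> y [].
have sV : opensI U V `<=` V by move=> y [].
have xI : oset (opensI U V) x by [].
rewrite -(germ_res sU xI xU) -(germ_res sV xI xV) -rmorphM -(rmorph1 (germ xI)).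
move=> /eq_germ [W [WI [WI' [xW E]]]].
exists W, (subset_trans WI sU); split => //; exists (res (subset_trans WI sV) t).
rewrite -(res_comp WI sU) -(res_comp WI sV) -rmorphM E; exact: rmorph1.
Qed.

Lemma germ_unit_open (U : opens X) (s : sect U) : open [set x | germ_unit x s].
Proof.
rewrite openE => x [W [WU [xW u]]]; rewrite /interior nbhsE /=.
exists W; first by split => //; exact: oset_open.
by move=> y yW; exists W, WU.
Qed.

Lemma unit_local (U : opens X) (s : sect U) : (forall x, oset U x -> germ_unit x s) -> is_unit s.
Proof.
move=> us.
have [|x xU|t tE] := @glue_local U (fun x g => forall xU : oset U x, germ xU s * g = 1).
- move=> x g h xU gE hE; apply: (@is_unit_inj _ (germ xU s)); last by rewrite gE hE.
  by exists g.
- have [W [WU [xW [t st]]]] := us x xU; exists W, t; split => // y yW yU.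
  by rewrite -(germ_res WU yW) -rmorphM st rmorph1.
exists t; apply: sect_ext => x xU; rewrite rmorphM rmorph1; exact: tE.
Qed.

End Stalk.

Lemma local_stalk (X : ringed_space) : locally_ringed X -> forall x : X,
  (1 : stalk x) <> 0 /\
  forall g h : stalk x, is_unit (g + h) -> is_unit g \/ is_unit h.
Proof.
move=> lX x; split.
- rewrite -(rmorph1 (germ (I : oset (opensT X) x))) -(rmorph0 (germ (I : oset (opensT X) x))).
  move=> /eq_germ [W [WU [WU' [xW]]]]; rewrite rmorph1 rmorph0.
  by case: (lX x W xW).
- move=> g h; have [U [xU [s [t [-> ->]]]]] := germ_common g h.
  rewrite -rmorphD -!(germ_unitP xU); by have [_] := lX x U xU; apply.
Qed.

Lemma locally_ringedP (X : ringed_space) :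
  (forall x : X, (1 : stalk x) <> 0 /\
     forall g h : stalk x, is_unit (g + h) -> is_unit g \/ is_unit h) ->
  locally_ringed X.
Proof.
move=> lX x U xU; have [nz loc] := lX x; split.
  by move=> E; apply: nz; rewrite -(rmorph1 (germ xU)) E rmorph0.
by move=> s t; rewrite !(germ_unitP xU) rmorphD; exact: loc.
Qed.

(** * Morphisms seen on stalks *)

Section StalkMap.
Variables (X Y : ringed_space) (f : lrs_hom X Y).

Lemma stalk_map_exists (x : X) : exists g : {rmorphism stalk (f x) -> stalk x},
  forall (V : opens Y) (fxV : oset V (f x)) (xV : oset (preopen (hom_cts f) V) x) s,
    g (germ fxV s) = germ xV (pull f V s).
Proof.
pose F (i : nbhd_index (f x)) : {rmorphism sect (sval i) -> stalk x} :=
  (germ (svalP i : oset (preopen (hom_cts f) (sval i)) x)) \o pull f (sval i).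
have [|g gE] := @colim_rmorph_exists (stalk_system (f x)) (nbhdT (f x)) (stalk x) F.
  move=> [U xU] [V xV] /= VU s; rewrite pull_res; exact: germ_res.
exists g => V fxV xV s; rewrite (gE (exist _ V fxV)) /F /=; exact: germ_irr.
Qed.

Definition stalk_map (x : X) := sval (cid (stalk_map_exists x)).

Lemma stalk_mapE (x : X) (V : opens Y) (fxV : oset V (f x))
    (xV : oset (preopen (hom_cts f) V) x) s :
  stalk_map x (germ fxV s) = germ xV (pull f V s).
Proof. by rewrite /stalk_map; case: cid => g. Qed.

Lemma stalk_map_local (x : X) (g : stalk (f x)) : is_unit (stalk_map x g) -> is_unit g.
Proof.
have [V [fxV [s ->]]] := germP g.
rewrite (stalk_mapE fxV (fxV : oset (preopen (hom_cts f) V) x)) -!germ_unitP.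
exact: pull_local.
Qed.

End StalkMap.

Lemma hom_ext_stalk (X Y : ringed_space) (f g : lrs_hom X Y) :
  (forall x, f x = g x) ->
  (forall x (V : opens Y) (fxV : oset V (f x)) (gxV : oset V (g x)) s,
    stalk_map f x (germ fxV s) = stalk_map g x (germ gxV s)) ->
  f = g.
Proof.
move=> fg E; apply: hom_ext => // V s W Wf Wg; apply: sect_ext => x xW.
rewrite (germ_res Wf xW (Wf x xW)) (germ_res Wg xW (Wg x xW)).
have fxV : oset V (f x) := Wf x xW; have gxV : oset V (g x) := Wg x xW.
by rewrite -(stalk_mapE fxV) -(stalk_mapE gxV).
Qed.

Section MakeHom.
Variables (X Y : ringed_space) (c : X -> Y) (cc : continuous c).
Variable phi : forall x : X, {rmorphism stalk (c x) -> stalk x}.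
Hypothesis phi_sect : forall x (V : opens Y) (cxV : oset V (c x)) (s : sect V),
  exists (W : opens X) (t : sect W), oset W x /\
    forall y (yW : oset W y) (cyV : oset V (c y)), phi y (germ cyV s) = germ yW t.
Hypothesis phi_local : forall x g, is_unit (phi x g) -> is_unit g.

(** Ring maps on stalks assemble into a morphism once, as [phi_sect] asks, the images of the germs
    of a section are locally the germs of a section; the local sections then glue. *)
Fact mkhom_pull_ex (V : opens Y) (s : sect V) :
  exists t : sect (preopen cc V), forall x (xV : oset (preopen cc V) x),
    germ xV t = phi x (germ (xV : oset V (c x)) s).
Proof.
have [|x xV|t tE] := @glue_local X (preopen cc V)
  (fun x g => forall cxV : oset V (c x), g = phi x (germ cxV s)).
- by move=> x g h xV -> // ->.
- have [W [t [xW tE]]] := phi_sect xV s; exists W, t; split => // y yW cyV.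
  by rewrite tE.
- by exists t => x xV; exact: tE.
Qed.

Definition mkhom_fun V (s : sect V) : sect (preopen cc V) := sval (cid (mkhom_pull_ex s)).

Lemma mkhom_funE V (s : sect V) x (xV : oset (preopen cc V) x) (cxV : oset V (c x)) :
  germ xV (mkhom_fun s) = phi x (germ cxV s).
Proof.
rewrite /mkhom_fun; case: cid => t /= ->; congr (phi x _); exact: germ_irr.
Qed.

Fact mkhom_zmod V : zmod_morphism (@mkhom_fun V).
Proof.
move=> s t; apply: sect_ext => x xV; rewrite rmorphB !(mkhom_funE _ xV (xV : oset V (c x))).
by rewrite !rmorphB.
Qed.
Fact mkhom_monoid V : monoid_morphism (@mkhom_fun V).
Proof.
split=> [|s t]; apply: sect_ext => x xV.
  by rewrite !(mkhom_funE _ xV (xV : oset V (c x))) !rmorph1.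
by rewrite rmorphM !(mkhom_funE _ xV (xV : oset V (c x))) !rmorphM.
Qed.
HB.instance Definition _ V :=
  GRing.isZmodMorphism.Build _ _ (@mkhom_fun V) (@mkhom_zmod V).
HB.instance Definition _ V :=
  GRing.isMonoidMorphism.Build _ _ (@mkhom_fun V) (@mkhom_monoid V).

Definition mkhom_pull V : {rmorphism sect V -> sect (preopen cc V)} := @mkhom_fun V.

Fact mkhom_pull_res (U V : opens Y) (UV : U `<=` V) (s : sect V) :
  mkhom_pull U (res UV s) =
  res (@preimage_subset _ _ c _ _ UV : preopen cc U `<=` preopen cc V) (mkhom_pull V s).
Proof.
apply: sect_ext => x xU; have cxU : oset U (c x) := xU; have cxV := UV _ cxU.
rewrite (germ_res _ xU (cxV : oset (preopen cc V) x)) (mkhom_funE _ xU cxU).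
by rewrite (mkhom_funE _ (cxV : oset (preopen cc V) x) cxV) (germ_res _ _ cxV).
Qed.

Fact mkhom_pull_local (x : X) (V : opens Y) (s : sect V) :
  germ_unit x (mkhom_pull V s) -> germ_unit (c x) s.
Proof.
move=> u; have xV : oset (preopen cc V) x by case: u => W [WU [xW _]]; exact: WU.
move: u; rewrite (germ_unitP xV) (germ_unitP (xV : oset V (c x))).
by rewrite (mkhom_funE _ xV (xV : oset V (c x))); exact: phi_local.
Qed.

Definition mkhom : lrs_hom X Y := Defs.Hom mkhom_pull_res mkhom_pull_local.

Lemma stalk_map_mkhom x g : stalk_map mkhom x g = phi x g.
Proof.
have [V [cxV [s ->]]] := germP g.
rewrite (stalk_mapE (f := mkhom) cxV (cxV : oset (preopen (hom_cts mkhom) V) x)).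
exact: mkhom_funE.
Qed.

End MakeHom.

Lemma rmorph_inverse (R R' : comPzRingType) (f : {rmorphism R -> R'}) :
  injective f -> (forall y, exists x, f x = y) ->
  exists g : {rmorphism R' -> R}, cancel f g /\ cancel g f.
Proof.
move=> inj /choice [g gK].
have fK : cancel f g by move=> x; apply: inj; rewrite gK.
have gB : zmod_morphism g by move=> x y; apply: inj; rewrite rmorphB !gK.
have gM : monoid_morphism g.
  by split=> [|x y]; apply: inj; rewrite ?rmorph1 ?rmorphM !gK.
pose G : {rmorphism R' -> R} :=
  HB.pack g (GRing.isZmodMorphism.Build _ _ _ gB) (GRing.isMonoidMorphism.Build _ _ _ gM).
by exists G.
Qed.

(** Stalks at equal points are distinct types. The transport is known only by its effect on germs,
    so that no equality proof has to be computed with. *)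
Lemma stalk_cast_exists (X : ringed_space) (x y : X) (e : x = y) :
  exists F : {rmorphism stalk x -> stalk y},
    forall (U : opens X) (xU : oset U x) (yU : oset U y) s, F (germ xU s) = germ yU s.
Proof. by subst y; exists idfun => U xU yU s; exact: germ_irr. Qed.

Definition stalk_cast (X : ringed_space) (x y : X) (e : x = y) := sval (cid (stalk_cast_exists e)).

Lemma stalk_castE (X : ringed_space) (x y : X) (e : x = y) (U : opens X)
  (xU : oset U x) (yU : oset U y) s : stalk_cast e (germ xU s) = germ yU s.
Proof. by rewrite /stalk_cast; case: cid => F /=. Qed.

Lemma stalk_castK (X : ringed_space) (x y : X) (e : x = y) (e' : y = x) :
  cancel (stalk_cast e) (stalk_cast e').
Proof.
move=> g; have [U [xU [s ->]]] := germP g.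
have yU : oset U y by rewrite -e.
by rewrite (stalk_castE _ xU yU) (stalk_castE _ yU xU).
Qed.

Lemma stalk_map_id (X : ringed_space) (x : X) (g : stalk x) : stalk_map (id_hom X) x g = g.
Proof.
have [U [xU [s ->]]] := germP g.
rewrite (stalk_mapE (f := id_hom X) xU (xU : oset (preopen (hom_cts (id_hom X)) U) x)).
exact: germ_res.
Qed.

Lemma stalk_map_comp (X Y Z : ringed_space) (g : lrs_hom Y Z) (f : lrs_hom X Y) (x : X)
  (s : stalk (g (f x))) :
  stalk_map (comp_hom g f) x s = stalk_map f x (stalk_map g (f x) s).
Proof.
have [U [xU [t ->]]] := germP s.
have xU1 : oset (preopen (hom_cts g) U) (f x) := xU.
have xU2 : oset (preopen (hom_cts f) (preopen (hom_cts g) U)) x := xU.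
have xU3 : oset (preopen (hom_cts (comp_hom g f)) U) x := xU.
rewrite (stalk_mapE (f := g) xU xU1) (stalk_mapE xU1 xU2).
by rewrite (stalk_mapE (f := comp_hom g f) xU xU3); exact: germ_res.
Qed.

Section Category.

Lemma comp_homA (X Y Z T : ringed_space) (h : lrs_hom Z T) (g : lrs_hom Y Z) (f : lrs_hom X Y) :
  comp_hom h (comp_hom g f) = comp_hom (comp_hom h g) f.
Proof.
apply: hom_ext_stalk => // x V fxV gxV s; rewrite !stalk_map_comp.
by rewrite (germ_irr fxV gxV).
Qed.

Lemma comp_id_hom (X Y : ringed_space) (f : lrs_hom X Y) : comp_hom (id_hom Y) f = f.
Proof.
apply: hom_ext_stalk => // x V fxV gxV s; rewrite !stalk_map_comp stalk_map_id.
by rewrite (germ_irr fxV gxV).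
Qed.

Lemma comp_hom_id (X Y : ringed_space) (f : lrs_hom X Y) : comp_hom f (id_hom X) = f.
Proof.
apply: hom_ext_stalk => // x V fxV gxV s; rewrite !stalk_map_comp stalk_map_id.
by rewrite (germ_irr fxV gxV).
Qed.

End Category.

(** The inverse is made from the inverse homeomorphism and the inverse stalk maps. These send
    sections to sections locally: a preimage of the germ of [s] spreads to a section [t], and the
    equality between [s] and the pullback of [t] holds on a neighbourhood. *)
Lemma iso_of_stalks (X Y : ringed_space) (f : lrs_hom X Y) : homeomorphism f ->
  (forall x, injective (stalk_map f x)) ->
  (forall x g, exists h, stalk_map f x h = g) -> is_iso f.
Proof.
move=> [_ [c [cc fK cK]]] inj surj.
have ex (x : X) : exists g : {rmorphism stalk x -> stalk (f x)},
    cancel (stalk_map f x) g /\ cancel g (stalk_map f x).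
  exact: rmorph_inverse.
pose inv x := sval (cid (ex x)).
have invP x : cancel (stalk_map f x) (inv x) /\ cancel (inv x) (stalk_map f x).
  exact: svalP (cid (ex x)).
pose phi y : {rmorphism stalk (c y) -> stalk y} := stalk_cast (cK y) \o inv (c y).
have phiE y (g : stalk (f (c y))) : phi y (stalk_map f (c y) g) = stalk_cast (cK y) g.
  by rewrite /phi /=; have [-> _] := invP (c y).
have phi_sect y (V : opens X) (cyV : oset V (c y)) (s : sect V) :
    exists (W : opens Y) (t : sect W), oset W y /\
    forall z (zW : oset W z) (czV : oset V (c z)), phi z (germ czV s) = germ zW t.
  have [h hE] := surj (c y) (germ cyV s); have [W [fcyW [t tE]]] := germP h.
  have cyW' : oset (preopen (hom_cts f) W) (c y) := fcyW.
  move: hE; rewrite tE (stalk_mapE fcyW cyW') => /eq_germ [O [OW [OV [cyO E]]]].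
  pose W' := opensI W (preopen cc O).
  have W'W : W' `<=` W by move=> z [].
  exists W', (res W'W t); split; first by split => //; rewrite -(cK y).
  move=> z [zW zO] czV; have czW : oset W (f (c z)) by rewrite cK.
  have -> : germ czV s = stalk_map f (c z) (germ czW t).
    rewrite (stalk_mapE czW (czW : oset (preopen (hom_cts f) W) (c z))).
    by rewrite -(germ_res OW zO) -(germ_res OV zO) E.
  by rewrite phiE (stalk_castE _ czW zW) (germ_res _ _ zW).
have phi_local y g : is_unit (phi y g) -> is_unit g.
  move=> u; have [_ K] := invP (c y); rewrite -(K g); apply: is_unit_rmorph.
  rewrite -(stalk_castK (cK y) (esym (cK y)) (inv (c y) g)); exact: is_unit_rmorph.
exists (mkhom cc phi_sect phi_local); split; apply: hom_ext_stalk => //.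
- move=> x V fxV gxV s; rewrite stalk_map_comp stalk_map_mkhom stalk_map_id.
  have fcfV : oset V (c (f x)) by [].
  have [h hE] := surj (c (f x)) (germ fcfV s).
  rewrite (germ_irr fxV fcfV) -hE phiE.
  have [W [W1 [t tE]]] := germP h; rewrite tE in hE *.
  have W2 : oset W (f x) by rewrite -(cK (f x)).
  rewrite (stalk_castE _ W1 W2) (stalk_mapE W2 (W2 : oset (preopen (hom_cts f) W) x)).
  move: hE; rewrite (stalk_mapE W1 (W1 : oset (preopen (hom_cts f) W) (c (f x)))).
  move=> /eq_germ [O [OW [OV [xO E]]]].
  have xO' : oset O x by rewrite -(fK x).
  by rewrite -(germ_res OW xO') E; exact: germ_res.
- move=> y V fxV gxV s; rewrite stalk_map_comp stalk_map_mkhom phiE.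
  rewrite stalk_map_id; exact: stalk_castE.
Qed.

(** * Affine charts *)

(** In degree [i + j] every monomial is divisible by [a ^ i] or by [b ^ j]. *)
Lemma exprD_split (R : comPzRingType) (a b : R) i j :
  exists x y, (a + b) ^+ (i + j) = x * a ^+ i + y * b ^+ j.
Proof.
elim: i j => [|i IHi] j.
  by exists ((a + b) ^+ j), 0; rewrite expr0 mulr1 mul0r addr0.
elim: j => [|j [x' [y' E']]].
  by exists 0, ((a + b) ^+ (i.+1 + 0)); rewrite expr0 mulr1 mul0r add0r.
have [x [y E]] := IHi j.+1.
exists (x + b * x'), (a * y + y').
rewrite addSn exprS mulrDl {1}E addnS -addSn E' !exprS; ring.
Qed.

Section LocalChart.
Variables (X : ringed_space) (U : opens X) (A : comPzRingType) (phi : {rmorphism A -> sect U}).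

Definition chart_prime (x : X) : set A := [set a | ~ germ_unit x (phi a)].

(** A pointwise form of [affine_chart]: the points are the primes of [A], the nonvanishing loci of
    elements of [A] are a basis, and each stalk is the localization at the prime of its point. It
    can be checked one germ at a time; [affine_chart_of_local] and [local_chart_of_affine] show the
    equivalence. *)
Record local_chart : Prop := LocalChart {
  lc_prime : forall x, oset U x -> is_prime_ideal (chart_prime x);
  lc_point : forall P, is_prime_ideal P -> exists x, oset U x /\ chart_prime x = P;
  lc_inj : forall x y, oset U x -> oset U y -> chart_prime x = chart_prime y -> x = y;
  lc_basis : forall x (V : set X), oset U x -> open V -> V x ->
    exists d, germ_unit x (phi d) /\ forall y, germ_unit y (phi d) -> V y;
  lc_frac : forall x (xU : oset U x) (g : stalk x), exists a d,
    germ_unit x (phi d) /\ germ xU (phi d) * g = germ xU (phi a);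
  lc_ker : forall x (xU : oset U x) a, germ xU (phi a) = 0 ->
    exists e, germ_unit x (phi e) /\ e * a = 0 }.

Lemma germ_unit_in x (V : opens X) (s : sect V) : germ_unit x s -> oset V x.
Proof. by move=> [W [WV [xW _]]]; exact: WV. Qed.

Definition chart_open (f : A) : opens X := Opens (@germ_unit_open X U (phi f)).

Lemma chart_open_sub f : chart_open f `<=` U.
Proof. by move=> x /germ_unit_in. Qed.

Lemma chart_unitM x a b : oset U x ->
  germ_unit x (phi (a * b)) <-> germ_unit x (phi a) /\ germ_unit x (phi b).
Proof.
move=> xU; rewrite !(germ_unitP xU) !rmorphM; split; first exact: is_unit_mulP.
by move=> [ua ub]; exact: is_unit_mul.
Qed.

Hypothesis lc : local_chart.

Lemma chart_unit0 x : ~ germ_unit x (phi 0).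
Proof.
move=> u; have [[p0 _ _] _ _] := lc_prime lc (germ_unit_in u); exact: (p0 u).
Qed.

(** If a prime contains the annihilator of [a] but not [f], then [a] vanishes at its point and is
    killed by an element outside that prime, a contradiction. So [f] lies in the radical of the
    annihilator. *)
Lemma chart_kernel f a :
  (forall x (xU : oset U x), germ_unit x (phi f) -> germ xU (phi a) = 0) ->
  exists n, f ^+ n * a = 0.
Proof.
move=> fa; apply: (@radical_primes A [set e | e * a = 0] f).
  split => [|b c|b c] /=; first by rewrite mul0r.
    by rewrite mulrDl => -> ->; rewrite addr0.
  by rewrite -mulrA => ->; rewrite mulr0.
move=> P pP AP; have [x [xU xP]] := lc_point lc pP.
apply: contrapT => Pf.
have uf : germ_unit x (phi f) by apply: contrapT => nu; apply: Pf; rewrite -xP.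
have [e [ue ea]] := lc_ker lc (fa x xU uf).
by have := AP _ ea; rewrite -xP; apply.
Qed.

(** [J] consists of the [g] for which [sg] is a fraction with denominator [f ^ K * g ^ N] wherever
    [f] and [g] are units. It is an ideal contained in no prime of the locus of [f], so it contains
    a power of [f]. *)
Lemma chart_fraction f (sg : sect (chart_open f)) : exists a n,
  forall x (xU : oset U x) (xV : oset (chart_open f) x),
  germ xU (phi (f ^+ n)) * germ xV sg = germ xU (phi a).
Proof.
pose good g K N a := forall x (xU : oset U x) (xV : oset (chart_open f) x),
  germ_unit x (phi g) -> germ xU (phi (f ^+ K * g ^+ N)) * germ xV sg = germ xU (phi a).
pose J := [set g | exists K N a, good g K N a].
have good_up g K N a K' N' : good g K N a ->
    good g (K' + K)%N (N' + N)%N (f ^+ K' * g ^+ N' * a).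
  move=> gg x xU xV u; have := gg x xU xV u; rewrite !rmorphM !exprD !rmorphM => <-; ring.
have idJ : is_ideal J.
  split.
  - by exists 0%N, 0%N, 0 => x xU xV /chart_unit0.
  - move=> g1 g2 [K1 [N1 [a1 G1]]] [K2 [N2 [a2 G2]]].
    have {}G1 := good_up _ _ _ _ K2 N2 G1; have {}G2 := good_up _ _ _ _ K1 N1 G2.
    rewrite addnC [(N2 + N1)%N]addnC in G1.
    move: (_ * a1) (_ * a2) (K1 + K2)%N (N1 + N2)%N G1 G2 => {K1 K2 N1 N2}a1 {}a2 K N G1 G2.
    (* The numerators agree after cross-multiplication on the common locus, hence up to a power of
       [f g1 g2]. *)
    have [m mE] : exists m, (f * (g1 * g2)) ^+ m * (g2 ^+ N * a1 - g1 ^+ N * a2) = 0.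
      apply: chart_kernel => x xU /(chart_unitM _ _ xU) [uf /(chart_unitM _ _ xU) [u1 u2]].
      rewrite rmorphB [phi (g2 ^+ N * a1)]rmorphM [phi (g1 ^+ N * a2)]rmorphM rmorphB !rmorphM.
      rewrite -(G1 x xU uf u1) -(G2 x xU uf u2) !rmorphM; ring.
    (* Absorbing [mE] into the numerators makes [g2 ^ M b1 = g1 ^ M b2] exact. With [(g1 + g2) ^ (M
       + M) = x g1 ^ M + y g2 ^ M], the numerator for [g1 + g2] is [x b1 + y b2]. *)
    pose M := (m + N)%N; have [x [y xyE]] := exprD_split g1 g2 M M.
    pose b1 := f ^+ m * g1 ^+ m * a1; pose b2 := f ^+ m * g2 ^+ m * a2.
    have b12 : g2 ^+ M * b1 = g1 ^+ M * b2.
      apply/eqP; rewrite -subr_eq0 -mE /b1 /b2 /M !exprD !exprMn; apply/eqP; ring.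
    have H1 : good g1 (m + K)%N M b1 by exact: good_up.
    have H2 : good g2 (m + K)%N M b2 by exact: good_up.
    exists (m + K)%N, (M + M)%N, (x * b1 + y * b2) => z zU zV u.
    have {u} : germ_unit z (phi g1) \/ germ_unit z (phi g2).
      apply: contrapT => /not_orP [n1 n2]; have [[_ D _] _ _] := lc_prime lc zU.
      by apply: (D g1 g2 n1 n2).
    set G := germ zU; set S := germ zV sg.
    case=> u.
    + have ug : is_unit (G (phi (g1 ^+ M))).
        by rewrite !rmorphXn; apply: is_unitX; exact/germ_unitP.
      apply: (is_unit_inj ug).
      have := H1 z zU zV u; rewrite -/G -/S => HE.
      transitivity (G (phi ((g1 + g2) ^+ (M + M))) * (G (phi (f ^+ (m + K) * g1 ^+ M)) * S)).
        by rewrite !rmorphM; ring.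
      rewrite HE -!rmorphM; congr (G (phi _)).
      rewrite xyE mulrDl mulrDr -!mulrA b12; ring.
    + have ug : is_unit (G (phi (g2 ^+ M))).
        by rewrite !rmorphXn; apply: is_unitX; exact/germ_unitP.
      apply: (is_unit_inj ug).
      have := H2 z zU zV u; rewrite -/G -/S => HE.
      transitivity (G (phi ((g1 + g2) ^+ (M + M))) * (G (phi (f ^+ (m + K) * g2 ^+ M)) * S)).
        by rewrite !rmorphM; ring.
      rewrite HE -!rmorphM; congr (G (phi _)).
      rewrite xyE mulrDl mulrDr -!mulrA -b12; ring.
  - move=> c g [K [N [a G]]]; exists K, N, (c ^+ N * a) => x xU xV /(chart_unitM _ _ xU) [uc ug].
    have := G x xU xV ug; rewrite !rmorphM => <-.
    by rewrite !rmorphXn !rmorphM !exprMn; ring.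
(* At a point where [f] is a unit the germ of [sg] is [a / d]. That identity holds on a
   neighbourhood containing the locus of some [e], which puts [d * e] in [J]. *)
have [n [K [N [a G]]]] : exists n, J (f ^+ n).
  apply: radical_primes => // P pP JP; have [x [xU xP]] := lc_point lc pP.
  apply: contrapT => Pf.
  have uf : germ_unit x (phi f) by apply: contrapT => nu; apply: Pf; rewrite -xP.
  have [a [d [ud dE]]] := lc_frac lc xU (germ (uf : oset (chart_open f) x) sg).
  have VU := @chart_open_sub f.
  have xV : oset (chart_open f) x := uf.
  have : germ xV (res VU (phi d) * sg) = germ xU (phi a).
    by rewrite rmorphM (germ_res VU xV xU) -dE (germ_irr xV uf).
  move=> /eq_germ [W [WV [WU [xW E]]]].
  have [e [ue eW]] := lc_basis lc xU (oset_open W) xW.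
  have : P (d * e).
    apply: JP; exists 0%N, 1%N, (e * a) => y yU yV /(chart_unitM _ _ yU) [_ /eW yW].
    rewrite expr0 mul1r expr1 !rmorphM -(germ_res WU yW yU (phi a)) -E (germ_res WV yW yV).
    by rewrite rmorphM (germ_res VU yV yU); ring.
  by rewrite -xP; apply; apply/chart_unitM.
exists a, (K + n * N)%N => x xU xV.
rewrite exprD exprM; apply: G.
by rewrite rmorphXn; apply/(germ_unitP xU); rewrite rmorphXn; apply: is_unitX; apply/germ_unitP.
Qed.

Lemma chart_localization f (V : opens X) (VU : V `<=` U) :
  (V : set X) = chart_open f ->
  is_localization f (res VU \o phi : {rmorphism A -> sect V}).
Proof.
move=> VE; have {VE} VE : V = chart_open f by exact: opens_ext.
subst V; split.
- apply: unit_local => x xV; have xU := VU x xV.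
  by apply/(germ_unitP xV); rewrite (germ_res VU xV xU); apply/germ_unitP.
- move=> sg; have [a [n E]] := chart_fraction sg; exists a, n.
  apply: sect_ext => x xV; have xU := VU x xV.
  by rewrite -rmorphXn /= rmorphM !(germ_res VU xV xU) mulrC E.
- move=> a a0; apply: chart_kernel => x xU xf.
  by rewrite -(germ_res VU xf xU) -[res _ _]/((res VU \o phi) a) a0 rmorph0.
Qed.

Lemma affine_chart_of_local : affine_chart U A.
Proof.
exists chart_prime, phi; split.
- exact: lc_prime.
- move=> P pP; have [x [xU xP]] := lc_point lc pP; exists x; split => // y [yU yP].
  by apply: (lc_inj lc) => //; rewrite xP.
- move=> C CU; split.
  + move=> oC; exists [set a | forall x, C x -> chart_prime x a].
    rewrite predeqE => y; split; first by move=> Cy; split; [exact: CU|move=> a; apply].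
    move=> [yU Iy]; apply: contrapT => nCy.
    have [d [ud dC]] := lc_basis lc yU oC (conj yU nCy).
    by have : chart_prime y d by apply: Iy => x Cx /dC [].
  + move=> [I ->].
    have -> : U `\` [set x | oset U x /\ I `<=` chart_prime x] =
        \bigcup_(d in I) [set x | germ_unit x (phi d)].
      rewrite predeqE => x; split.
        move=> [xU nI]; apply: contrapT => H; apply: nI; split => // d Id u.
        by apply: H; exists d.
      move=> [d Id u]; split; first exact: germ_unit_in u.
      by move=> [_ /(_ d Id)].
    by apply: bigcup_open => d _; exact: germ_unit_open.
- move=> f V VU VE; apply: chart_localization; rewrite VE predeqE => x; split.
    by move=> [xU /contrapT].
  by move=> u; split; [exact: germ_unit_in u|move=> nu; exact: nu].
Qed.

Lemma local_chart_stalk x : oset U x -> (1 : stalk x) <> 0 /\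
  forall g h : stalk x, is_unit (g + h) -> is_unit g \/ is_unit h.
Proof.
move=> xU; split.
  move=> one0; have [|e [ue]] := @lc_ker lc x xU 1; first by rewrite !rmorph1.
  by rewrite mulr1 => e0; apply: (@chart_unit0 x); rewrite -e0.
move=> g h u.
have [a [d [ud dg]]] := lc_frac lc xU g; have [b [d' [ud' dh]]] := lc_frac lc xU h.
have uab : germ_unit x (phi (d' * a + d * b)).
  apply/(germ_unitP xU); rewrite !rmorphD !rmorphM -dg -dh.
  have -> : germ xU (phi d') * (germ xU (phi d) * g) + germ xU (phi d) * (germ xU (phi d') * h)
     = (germ xU (phi d) * germ xU (phi d')) * (g + h) by ring.
  by apply: is_unit_mul => //; apply: is_unit_mul; apply/germ_unitP.
have [ua|ub] : germ_unit x (phi a) \/ germ_unit x (phi b).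
  apply: contrapT => /not_orP [na nb]; have [[_ D M] _ _] := lc_prime lc xU.
  by apply: (D (d' * a) (d * b)) => //; apply: (M).
- left; move: ua; rewrite (germ_unitP xU) -dg => /is_unit_mulP []//.
- right; move: ub; rewrite (germ_unitP xU) -dh => /is_unit_mulP []//.
Qed.

End LocalChart.

(** The prime [h x] of the given chart turns out to be the set of functions that are not units at
    [x]; everything else is read off on the basic opens. *)
Lemma local_chart_of_affine (X : ringed_space) (U : opens X) (A : comPzRingType) :
  affine_chart U A -> exists phi : {rmorphism A -> sect U}, local_chart phi.
Proof.
move=> [h [phi [h_prime h_point h_closed h_loc]]]; exists phi.
have h_open d : open [set x | oset U x /\ ~ h x d].
  have -> : [set x | oset U x /\ ~ h x d] = U `\` [set x | oset U x /\ [set d] `<=` h x].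
    rewrite predeqE => x; split=> -[xU nd]; split => //.
      by move=> [_ /(_ d erefl)].
    by move=> hd; apply: nd; split => // _ ->.
  by apply/h_closed => [x []//|]; exists [set d].
have h_basis x (V : set X) : oset U x -> open V -> V x ->
    exists d, ~ h x d /\ forall y, oset U y -> ~ h y d -> V y.
  move=> xU oV xV.
  have CU : U `\` V `<=` U by move=> y [].
  have [|I CE] := proj1 (h_closed _ CU).
    by rewrite setDD; apply: openI => //; exact: oset_open.
  have [d [Id nd]] : exists d, I d /\ ~ h x d.
    apply: contrapT => H; have : (U `\` V) x.
      rewrite CE; split => // d Id; apply: contrapT => nd; apply: H.
      by exists d.
    by move=> [].
  exists d; split => // y yU ynd; apply: contrapT => nV.
  by have : (U `\` V) y by []; rewrite CE => -[_ /(_ d Id)].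
pose V d : opens X := Opens (h_open d).
have VU d : V d `<=` U by move=> x [].
have h_unit x a : oset U x -> ~ h x a -> germ_unit x (phi a).
  move=> xU na; have [u _ _] := h_loc a (V a) (@VU a) erefl.
  by exists (V a), (@VU a).
have h_kernel x (xU : oset U x) a : germ xU (phi a) = 0 -> exists e, ~ h x e /\ e * a = 0.
  rewrite -(rmorph0 (germ xU)) => /eq_germ [W [WU [WU' [xW]]]]; rewrite rmorph0 => E.
  have [d [nd dW]] := h_basis x W xU (oset_open W) xW.
  have VW : V d `<=` W by move=> y [yU yd]; exact: dW.
  have [_ _ /(_ a)] := h_loc d (V d) (@VU d) erefl.
  case => [|n nE].
    by rewrite /= -(res_comp VW WU (@VU d)) E rmorph0.
  exists (d ^+ n); split => //; move=> /(prime_ideal_exp (h_prime x xU)); exact: nd.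
have h_frac x (xU : oset U x) (g : stalk x) : exists a d,
    ~ h x d /\ germ xU (phi d) * g = germ xU (phi a).
  have [W [xW [t ->]]] := germP g.
  have [d [nd dW]] := h_basis x W xU (oset_open W) xW.
  have VW : V d `<=` W by move=> y [yU yd]; exact: dW.
  have [_ /(_ (res VW t)) [a [n E]] _] := h_loc d (V d) (@VU d) erefl.
  have xV : oset (V d) x by [].
  exists a, (d ^+ n); split; first by move=> /(prime_ideal_exp (h_prime x xU)).
  rewrite -(germ_res (@VU d) xV xU (phi a)) -[res _ (phi a)]/((res (@VU d) \o phi) a) -E.
  by rewrite rmorphM (germ_res VW xV xW) -!rmorphXn (germ_res (@VU d) xV xU) mulrC.
(* If [a] in [h x] had an inverse germ [c / d], some [e] outside [h x] would kill [a c - d], and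
   [e d] would lie in the prime [h x], unlike [e] and [d]. *)
have hE x : oset U x -> h x = chart_prime phi x.
  move=> xU; rewrite predeqE => a; split; last first.
    by move=> nu; apply: contrapT => /(h_unit x a xU).
  move=> ha /(germ_unitP xU) [g].
  have [c [d [nd dg]]] := h_frac x xU g; move=> ag.
  have : germ xU (phi (a * c - d)) = 0.
    rewrite !(rmorphB, rmorphM) -dg mulrCA ag mulr1; exact: subrr.
  move=> /h_kernel [e [ne eE]]; have [idh h1 hM] := h_prime x xU.
  have : h x (e * d).
    have -> : e * d = e * (c * a) - e * (a * c - d) by ring.
    by rewrite eE subr0; case: idh => _ _ M; apply: (M); apply: (M).
  by case/hM.
have punit x d : oset U x -> ~ h x d -> germ_unit x (phi d).
  by move=> xU; exact: h_unit.
split.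
- by move=> x xU; rewrite -hE //; exact: h_prime.
- move=> P /h_point [x [[xU xP] _]]; exists x; by rewrite -hE.
- move=> x y xU yU; rewrite -!hE // => E.
  have [z [_ uz]] := h_point _ (h_prime y yU).
  by rewrite -(uz x) // -(uz y).
- move=> x W xU oW xW; have [d [nd dW]] := h_basis x W xU oW xW.
  exists d; split; first exact: h_unit.
  move=> y u; apply: dW; first exact: germ_unit_in u.
  by rewrite hE //; exact: germ_unit_in u.
- move=> x xU g; have [a [d [nd E]]] := h_frac x xU g; exists a, d; split => //; exact: h_unit.
- move=> x xU a /h_kernel [e [ne E]]; exists e; split => //; exact: h_unit.
Qed.

Lemma scheme_of_charts (X : ringed_space) :
  (forall x : X, exists (U : opens X) (A : comPzRingType) (phi : {rmorphism A -> sect U}),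
     oset U x /\ local_chart phi) ->
  locally_ringed X /\
  (forall x : X, exists (U : opens X) (A : comPzRingType), oset U x /\ affine_chart U A).
Proof.
move=> ch; split.
  by apply: locally_ringedP => x; have [U [A [phi [xU lc]]]] := ch x; exact: (local_chart_stalk lc).
move=> x; have [U [A [phi [xU lc]]]] := ch x; exists U, A; split => //.
exact: affine_chart_of_local lc.
Qed.

Lemma scheme_chart (X : scheme) (x : X) : exists (U : opens X) (A : comPzRingType)
  (phi : {rmorphism A -> sect U}), oset U x /\ local_chart phi.
Proof.
have [U [A [xU /local_chart_of_affine [phi lc]]]] := sch_affine x.
by exists U, A, phi.
Qed.

(** Charted by its own ring of sections, so that no auxiliary ring has to be carried along. *)
Definition affine (X : ringed_space) (V : opens X) : Prop :=
  local_chart (idfun : {rmorphism sect V -> sect V}).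

(** Sections over the locus of [f] are the fractions with powers of [f] as denominators, and the
    primes of that localization are the primes of [A] not containing [f]. *)
Lemma chart_principal (X : ringed_space) (U : opens X) (A : comPzRingType)
  (phi : {rmorphism A -> sect U}) (f : A) : local_chart phi -> affine (chart_open phi f).
Proof.
move=> lc; set V := chart_open phi f; have VU := @chart_open_sub _ _ _ phi f.
have [uf frac _] := chart_localization lc VU (erefl (chart_open phi f : set X)).
have unitVU x (s : sect U) : oset V x -> germ_unit x (res VU s) <-> germ_unit x s.
  by move=> xV; rewrite (germ_unitP xV) (germ_unitP (VU x xV)) (germ_res VU xV (VU x xV)).
have fracV (s : sect V) : exists a n, s * res VU (phi f) ^+ n = res VU (phi a).
  by have [a [n E]] := frac s; exists a, n.
have unitV x (s : sect V) a n : oset V x -> s * res VU (phi f) ^+ n = res VU (phi a) ->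
    germ_unit x s <-> germ_unit x (phi a).
  move=> xV E; rewrite -unitVU // -E !(germ_unitP xV) rmorphM; split=> [us|/is_unit_mulP[]//].
  by apply: is_unit_mul => //; rewrite rmorphXn; apply: is_unitX; exact: is_unit_rmorph.
have primeV x : oset V x -> chart_prime phi x =
    (res VU \o phi : {rmorphism A -> sect V}) @^-1` chart_prime idfun x.
  by move=> xV; rewrite predeqE => a; rewrite /chart_prime /preimage /= unitVU.
split.
- move=> x xV; have [nz loc] := local_chart_stalk lc (VU x xV).
  have nu (s : sect V) : chart_prime idfun x s <-> ~ is_unit (germ xV s).
    by rewrite /chart_prime /= (germ_unitP xV).
  split.
  + split=> [|s t /nu ns /nu nt|s t /nu nt]; apply/nu.
    * by rewrite rmorph0 => -[g]; rewrite mul0r => /esym.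
    * by rewrite rmorphD => /loc [].
    * by rewrite rmorphM => /is_unit_mulP [].
  + by move=> /nu; apply; rewrite rmorph1; exists 1; rewrite mulr1.
  + move=> s t /nu; rewrite rmorphM => nst; apply: contrapT => /not_orP [ns nt].
    by apply: nst; apply: is_unit_mul; apply: contrapT => H; [apply: ns|apply: nt]; apply/nu.
- move=> P pP.
  have pP0 : is_prime_ideal ((res VU \o phi : {rmorphism A -> sect V}) @^-1` P).
    exact: preimage_prime.
  have [x [xU xP]] := lc_point lc pP0; have [idP P1 PM] := pP.
  have nPf n : ~ P (res VU (phi f) ^+ n).
    by have [v fv] := is_unitX n uf; move=> Pf; apply: P1; rewrite -fv; exact: ideal_mulr.
  have xV : oset V x.
    apply: contrapT => nV; have : chart_prime phi x f by [].
    by rewrite xP /preimage /= -[res _ _]expr1; exact: nPf.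
  exists x; split => //; rewrite predeqE => s; have [a [n E]] := fracV s.
  rewrite /chart_prime /= (unitV x s a n xV E).
  have -> : (~ germ_unit x (phi a)) = P (res VU (phi a)).
    by have := congr1 (fun X => X a) xP.
  rewrite -E; split=> [/PM [//|/nPf//]|Ps]; exact: ideal_mulr.
- move=> x y xV yV E; apply: (lc_inj lc (VU x xV) (VU y yV)).
  by rewrite !primeV // E.
- move=> x O xV oO xO; have [d [ud dO]] := lc_basis lc (VU x xV) oO xO.
  exists (res VU (phi d)); rewrite /= unitVU //; split => // y u.
  have yV := germ_unit_in u; apply: dO; exact/unitVU.
- move=> x xV g; have [a [d [ud E]]] := lc_frac lc (VU x xV) g.
  exists (res VU (phi a)), (res VU (phi d)); rewrite /= unitVU //; split => //.
  by rewrite !(germ_res VU xV (VU x xV)).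
- move=> x xV s s0; have {}s0 : germ xV s = 0 by []; have [a [n E]] := fracV s.
  have [|e [ue ea]] := @lc_ker _ _ _ _ lc x (VU x xV) a.
    by rewrite -(germ_res VU xV) -E rmorphM s0 mul0r.
  exists (res VU (phi e)); split; first by rewrite unitVU.
  apply: (is_unit_inj (is_unitX n uf)); rewrite mulr0 mulrC -mulrA E.
  by rewrite -[res VU _ * _]rmorphM -rmorphM ea !rmorph0.
Qed.

(** * Morphisms into an affine open *)

Section HomToChart.
Variables (X : ringed_space) (U : opens X) (A : comPzRingType) (phi : {rmorphism A -> sect U}).
Hypothesis lc : local_chart phi.
Variable W : ringed_space.

(** Stalk maps being local, the pullbacks of the elements of [A] decide which of them are units at
    the image of [w], hence the image itself; and every germ there is a fraction of such
    elements. *)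
Lemma hom_to_chart_unique (f g : lrs_hom W X) :
  (forall w, oset U (f w)) -> (forall w, oset U (g w)) ->
  (forall w (fU : oset U (f w)) (gU : oset U (g w)) a,
    stalk_map f w (germ fU (phi a)) = stalk_map g w (germ gU (phi a))) ->
  f = g.
Proof.
move=> fU gU E.
have point (k : lrs_hom W X) w (kU : oset U (k w)) a :
    germ_unit (k w) (phi a) <-> is_unit (stalk_map k w (germ kU (phi a))).
  by rewrite (germ_unitP kU); split; [exact: is_unit_rmorph|exact: stalk_map_local].
have fg w : f w = g w.
  apply: (lc_inj lc) => //; rewrite predeqE => a.
  by rewrite /chart_prime /= (point f w (fU w)) (point g w (gU w)) (E w (fU w) (gU w)).
apply: hom_ext_stalk => // w V fV gV s.
have [a [d [ud dE]]] := lc_frac lc (fU w) (germ fV s).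
have dE' : germ (gU w) (phi d) * germ gV s = germ (gU w) (phi a).
  rewrite -(stalk_castE (fg w) (fU w) (gU w)) -(stalk_castE (fg w) fV gV) -rmorphM dE.
  exact: stalk_castE.
have u : is_unit (stalk_map f w (germ (fU w) (phi d))).
  by apply: is_unit_rmorph; exact/germ_unitP.
apply: (is_unit_inj u).
by rewrite -rmorphM dE (E w (fU w) (gU w) a) (E w (fU w) (gU w) d) -rmorphM dE'.
Qed.

Hypothesis lW : locally_ringed W.
Variable psi : {rmorphism A -> sect (opensT W)}.

Let inT (w : W) : oset (opensT W) w := I.

(** The point [w] must go to the prime of those [a] whose image is not a unit at [w], a prime
    because the stalk is local. *)
Let point_ex (w : W) : exists x : X, oset U x /\
  chart_prime phi x = [set a | ~ germ_unit w (psi a)].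
Proof.
apply: (lc_point lc); have [nz loc] := local_stalk lW w.
have nu a : [set a | ~ germ_unit w (psi a)] a <-> ~ is_unit (germ (inT w) (psi a)).
  by rewrite /= (germ_unitP (inT w)).
split.
- split=> [|a b /nu na /nu nb|a b /nu nb]; apply/nu.
  + by rewrite !rmorph0 => -[g]; rewrite mul0r => /esym.
  + by rewrite !rmorphD => /loc [].
  + by rewrite !rmorphM => /is_unit_mulP [].
- by move=> /nu; apply; rewrite !rmorph1; exists 1; rewrite mulr1.
- move=> a b /nu; rewrite !rmorphM => nab; apply: contrapT => /not_orP [na nb].
  by apply: nab; apply: is_unit_mul; apply: contrapT => H; [apply: na|apply: nb]; apply/nu.
Qed.

Let c (w : W) : X := sval (cid (point_ex w)).
Let cU w : oset U (c w). Proof. exact: proj1 (svalP (cid (point_ex w))). Qed.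
Let c_unit w a : germ_unit (c w) (phi a) <-> germ_unit w (psi a).
Proof.
have := proj2 (svalP (cid (point_ex w))); rewrite predeqE => /(_ a) [E1 E2].
split=> u; apply: contrapT => nu; first exact: (E2 nu u).
exact: (E1 nu u).
Qed.

Let c_cts : continuous c.
Proof.
move=> w V; rewrite !nbhsE /= => -[O [oO Ocw] OV].
have [d [ud dO]] := lc_basis lc (cU w) oO Ocw.
exists [set w' | germ_unit w' (psi d)].
  by split; [exact: germ_unit_open|exact/c_unit].
by move=> w' /c_unit /dO /OV.
Qed.

Let stalk_ex w : exists g : {rmorphism stalk (c w) -> stalk w},
  forall a, g (germ (cU w) (phi a)) = germ (inT w) (psi a).
Proof.
apply: (@localization_rmorph A (stalk (c w)) (stalk w) (~` chart_prime phi (c w))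
  (germ (cU w) \o phi : {rmorphism A -> stalk (c w)})
  (germ (inT w) \o psi : {rmorphism A -> stalk w})).
- by move=> s /contrapT /(germ_unitP (cU w)).
- move=> x; have [a [d [ud E]]] := lc_frac lc (cU w) x; exists a, d; split => //.
- exact: prime_ideal_compl (lc_prime lc (cU w)).
- move=> a /= /(lc_ker lc) [e [ue ea]].
  apply: (@is_unit_inj _ (germ (inT w) (psi e))); first exact/germ_unitP/c_unit.
  by rewrite -!rmorphM ea !rmorph0 mulr0.
- by move=> s /contrapT /c_unit /(germ_unitP (inT w)).
Qed.

Let st w := sval (cid (stalk_ex w)).
Let stE w (cU' : oset U (c w)) a : st w (germ cU' (phi a)) = germ (inT w) (psi a).
Proof. by rewrite (germ_irr cU' (cU w)) /st; case: cid => g /= ->. Qed.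

Let st_sect w (V : opens X) (cV : oset V (c w)) (s : sect V) :
  exists (O : opens W) (t : sect O), oset O w /\
    forall y (yO : oset O y) (cyV : oset V (c y)), st y (germ cyV s) = germ yO t.
Proof.
have [a [d [ud E]]] := lc_frac lc (cU w) (germ cV s).
pose VU : opens X := opensI U V.
have VU1 : VU `<=` U by move=> y [].
have VU2 : VU `<=` V by move=> y [].
have cVU : oset VU (c w) by split; [exact: cU|].
have : germ cVU (res VU1 (phi d) * res VU2 s) = germ cVU (res VU1 (phi a)).
  by rewrite rmorphM (germ_res VU1 cVU (cU w)) (germ_res VU2 cVU cV) E (germ_res VU1 cVU (cU w)).
move=> /eq_germ [N [N1 [N2 [cN NE]]]].
have [O [OT [wO [v dv]]]] := proj1 (c_unit w d) ud.
pose O' := opensI O (preopen c_cts N).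
have O'O : O' `<=` O by move=> y [].
exists O', (res O'O (res OT (psi a) * v)); split => // y yO' cyV.
have yO := proj1 yO'; have cyN : oset N (c y) := proj2 yO';
have cyVU := N1 _ cyN; have cyU := VU1 _ cyVU.
have dvy : germ (inT y) (psi d) * germ yO v = 1.
  by rewrite -(germ_res OT yO (inT y)) -rmorphM dv rmorph1.
have Ey : germ cyU (phi d) * germ cyV s = germ cyU (phi a).
  have := congr1 (germ cyN) NE.
  rewrite (germ_res N1 cyN cyVU) (germ_res N2 cyN cyVU) rmorphM.
  by rewrite !(germ_res VU1 cyVU cyU) (germ_res VU2 cyVU cyV).
rewrite (germ_res O'O yO' yO) rmorphM (germ_res OT yO (inT y)).
apply: (@is_unit_inj _ (germ (inT y) (psi d))); first by exists (germ yO v).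
rewrite mulrCA dvy mulr1 -(stE cyU d) -rmorphM Ey; exact: stE.
Qed.

Let st_local w g : is_unit (st w g) -> is_unit g.
Proof.
have [a [d [ud E]]] := lc_frac lc (cU w) g; move=> u.
have : germ_unit w (psi a).
  rewrite (germ_unitP (inT w)) -(stE (cU w)) -E rmorphM; apply: is_unit_mul => //.
  by apply: is_unit_rmorph; exact/germ_unitP.
by move=> /c_unit /(germ_unitP (cU w)); rewrite -E => /is_unit_mulP [].
Qed.

(** With uniqueness, this is the universal property of an affine scheme: morphisms to it are ring
    maps into global sections. Here it allows any locally ringed source. *)
Lemma hom_to_chart_exists : exists f : lrs_hom W X,
  (forall w, oset U (f w)) /\
  (forall w (fU : oset U (f w)) (wT : oset (opensT W) w) a,
     stalk_map f w (germ fU (phi a)) = germ wT (psi a)).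
Proof.
exists (mkhom c_cts st_sect st_local); split=> // w fU wT a.
rewrite stalk_map_mkhom stE; exact: germ_irr.
Qed.

End HomToChart.

(** * Sheaves of locally representable functions *)

Definition sub_fun (T : topologicalType) (R : T -> comPzRingType) (W' W : opens T)
  (sub : W' `<=` W) (s : forall x, oset W x -> R x) : forall x, oset W' x -> R x :=
  fun x xW' => s x (sub x xW').

(** Sections will be the functions with values in [sd_ring x] that are locally [sd_good]. One,
    difference and product generate the ring structure, and [sd_sep] embeds each stalk in its ring
    of values, as [stalk_eval_inj] shows. *)
Record sheaf_data (T : topologicalType) := SheafData {
  sd_ring : T -> comPzRingType;
  sd_good : forall W : opens T, (forall x, oset W x -> sd_ring x) -> Prop;
  sd_res : forall (W' W : opens T) (sub : W' `<=` W) s,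
    @sd_good W s -> @sd_good W' (sub_fun sub s);
  sd_one : forall W : opens T, @sd_good W (fun _ _ => 1);
  sd_sub : forall (W : opens T) s t, @sd_good W s -> @sd_good W t ->
    @sd_good W (fun x xW => s x xW - t x xW);
  sd_mul : forall (W : opens T) s t, @sd_good W s -> @sd_good W t ->
    @sd_good W (fun x xW => s x xW * t x xW);
  sd_sep : forall (W : opens T) s x (xW : oset W x), @sd_good W s -> s x xW = 0 ->
    exists W' : opens T, oset W' x /\ forall y (yW : oset W y), oset W' y -> s y yW = 0 }.
Arguments sd_good {T} D {W} : rename.

Section FunctionSheaf.
Variables (T : topologicalType) (D : sheaf_data T).
Local Notation R := (sd_ring D).

Section Sections.
Variable U : opens T.

Definition is_fsect (s : forall x, oset U x -> R x) : Prop :=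
  forall x, oset U x -> exists (W : opens T) (sub : W `<=` U),
    oset W x /\ sd_good D (sub_fun sub s).

Definition fsect : Type := {s : forall x, oset U x -> R x | is_fsect s}.
HB.instance Definition _ := gen_eqMixin fsect.
HB.instance Definition _ := gen_choiceMixin fsect.

Definition fval (s : fsect) x (xU : oset U x) : R x := sval s x xU.

Lemma fsect_ext (s t : fsect) : (forall x (xU : oset U x), fval s xU = fval t xU) -> s = t.
Proof.
case: s t => [s hs] [t ht] /= E; apply: eq_exist.
by apply: functional_extensionality_dep => x; apply: functional_extensionality_dep => xU; exact: E.
Qed.

Lemma fsect_op_subproof (op : forall R : comPzRingType, R -> R -> R) :
  (forall (W : opens T) s t, sd_good D s -> sd_good D t ->
     sd_good D (fun x (xW : oset W x) => op _ (s x xW) (t x xW))) ->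
  forall s t : fsect, is_fsect (fun x xU => op _ (fval s xU) (fval t xU)).
Proof.
move=> opG [s hs] [t ht] x xU.
have [W1 [s1 [xW1 G1]]] := hs x xU; have [W2 [s2 [xW2 G2]]] := ht x xU.
have i1 : opensI W1 W2 `<=` W1 by move=> y [].
have i2 : opensI W1 W2 `<=` W2 by move=> y [].
have sub : opensI W1 W2 `<=` U := subset_trans i1 s1.
exists (opensI W1 W2), sub; split => //.
have E (u : forall x, oset U x -> R x) (W : opens T) (i : opensI W1 W2 `<=` W) (sW : W `<=` U) :
    sub_fun i (sub_fun sW u) = sub_fun sub u.
  apply: functional_extensionality_dep => y; apply: functional_extensionality_dep => yW.
  by rewrite /sub_fun; congr (u y _); exact: Prop_irrelevance.
have := opG _ _ _ (sd_res i1 G1) (sd_res i2 G2).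
by rewrite !E.
Qed.

Fact fsect_one_subproof : is_fsect (fun _ _ => 1).
Proof.
by move=> x xU; exists U, (@subset_refl _ U); split => //; exact: sd_one.
Qed.

Definition fone : fsect := exist _ _ fsect_one_subproof.
Definition fsub (s t : fsect) : fsect :=
  exist _ _ (@fsect_op_subproof (fun R a b => a - b) (@sd_sub _ D) s t).
Definition fmul (s t : fsect) : fsect :=
  exist _ _ (@fsect_op_subproof (fun R a b => a * b) (@sd_mul _ D) s t).
Definition fzero := fsub fone fone.
Definition fopp s := fsub fzero s.
Definition fadd s t := fsub s (fopp t).

Fact fvalZ x (xU : oset U x) : fval fzero xU = 0.
Proof. exact: subrr. Qed.
Fact fvalN s x (xU : oset U x) : fval (fopp s) xU = - fval s xU.
Proof. by rewrite -[LHS]/(fval fzero xU - fval s xU) fvalZ sub0r. Qed.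
Fact fvalA s t x (xU : oset U x) : fval (fadd s t) xU = fval s xU + fval t xU.
Proof. by rewrite -[LHS]/(fval s xU - fval (fopp t) xU) fvalN opprK. Qed.

Fact fadd_assoc : associative fadd.
Proof. by move=> s t u; apply: fsect_ext => x xU; rewrite !fvalA addrA. Qed.
Fact fadd_comm : commutative fadd.
Proof. by move=> s t; apply: fsect_ext => x xU; rewrite !fvalA addrC. Qed.
Fact fadd_zero : left_id fzero fadd.
Proof. by move=> s; apply: fsect_ext => x xU; rewrite !fvalA fvalZ add0r. Qed.
Fact fadd_opp : left_inverse fzero fopp fadd.
Proof. by move=> s; apply: fsect_ext => x xU; rewrite !fvalA fvalN fvalZ addNr. Qed.
HB.instance Definition _ := GRing.isZmodule.Build fsect fadd_assoc fadd_comm fadd_zero fadd_opp.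

Fact fmul_assoc : associative fmul.
Proof. by move=> s t u; apply: fsect_ext => x xU; exact: mulrA. Qed.
Fact fmul_comm : commutative fmul.
Proof. by move=> s t; apply: fsect_ext => x xU; exact: mulrC. Qed.
Fact fmul_one : left_id fone fmul.
Proof. by move=> s; apply: fsect_ext => x xU; exact: mul1r. Qed.
Fact fmul_add : left_distributive fmul fadd.
Proof.
move=> s t u; apply: fsect_ext => x xU; rewrite fvalA.
rewrite -[LHS]/(fval (fadd s t) xU * fval u xU) fvalA; exact: mulrDl.
Qed.
HB.instance Definition _ := GRing.Zmodule_isComPzRing.Build fsect
  fmul_assoc fmul_comm fmul_one fmul_add.

Definition feval x (xU : oset U x) (s : fsect) : R x := fval s xU.
Fact feval_zmod x (xU : oset U x) : zmod_morphism (feval xU).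
Proof. by move=> s t; rewrite /feval -[s - t]/(fadd s (fopp t)) fvalA fvalN. Qed.
Fact feval_monoid x (xU : oset U x) : monoid_morphism (feval xU).
Proof. by []. Qed.
HB.instance Definition _ x (xU : oset U x) :=
  GRing.isZmodMorphism.Build fsect (R x) (feval xU) (feval_zmod xU).
HB.instance Definition _ x (xU : oset U x) :=
  GRing.isMonoidMorphism.Build fsect (R x) (feval xU) (feval_monoid xU).

End Sections.

Section Restriction.
Variables (U V : opens T) (UV : U `<=` V).

Fact fres_subproof (s : fsect V) : is_fsect (sub_fun UV (sval s)).
Proof.
move=> x xU; have [W [sub [xW G]]] := svalP s x (UV xU).
have i : opensI W U `<=` W by move=> y [].
have j : opensI W U `<=` U by move=> y [].
exists (opensI W U), j; split => //.
have := sd_res i G; congr (sd_good D _).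
apply: functional_extensionality_dep => y; apply: functional_extensionality_dep => yW.
by rewrite /sub_fun; congr (sval s y _); exact: Prop_irrelevance.
Qed.
Definition fres (s : fsect V) : fsect U := exist _ _ (fres_subproof s).

Lemma fval_res s x (xU : oset U x) (xV : oset V x) : fval (fres s) xU = fval s xV.
Proof. by rewrite /fval /= /sub_fun; congr (sval s x _); exact: Prop_irrelevance. Qed.

Fact fres_zmod : zmod_morphism fres.
Proof.
move=> s t; apply: fsect_ext => x xU; rewrite (fval_res _ xU (UV xU)).
have fE (W : opens T) (xW : oset W x) (a b : fsect W) : fval (a - b) xW = fval a xW - fval b xW.
  exact: (rmorphB (feval xW)).
by rewrite !fE !(fval_res _ xU (UV xU)).
Qed.
Fact fres_monoid : monoid_morphism fres.
Proof. by split=> [|s t]; apply: fsect_ext. Qed.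
HB.instance Definition _ := GRing.isZmodMorphism.Build (fsect V) (fsect U) fres fres_zmod.
HB.instance Definition _ := GRing.isMonoidMorphism.Build (fsect V) (fsect U) fres fres_monoid.
End Restriction.

Lemma fval_irr (U : opens T) (s : fsect U) x (xU xU' : oset U x) : fval s xU = fval s xU'.
Proof. by rewrite (Prop_irrelevance xU xU'). Qed.

Fact fsheaf (U : opens T) (I : Type) (V : I -> opens T) (VU : forall i, V i `<=` U)
    (s : forall i, fsect (V i)) : (U : set T) `<=` \bigcup_i V i ->
    (forall i j, fres (@subIsetl _ (V i) (V j) : opensI (V i) (V j) `<=` V i) (s i)
               = fres (@subIsetr _ (V i) (V j) : opensI (V i) (V j) `<=` V j) (s j)) ->
    exists! t : fsect U, forall i, fres (VU i) t = s i.
Proof.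
move=> cov E.
have agree i j x (xi : oset (V i) x) (xj : oset (V j) x) : fval (s i) xi = fval (s j) xj.
  have xij : oset (opensI (V i) (V j)) x by [].
  rewrite -(fval_res (@subIsetl _ (V i) (V j) : opensI (V i) (V j) `<=` V i) (s i) xij xi).
  by rewrite E; exact: fval_res.
have pick x (xU : oset U x) : exists i, oset (V i) x by have [i _] := cov x xU; exists i.
pose t x (xU : oset U x) : R x := fval (s (sval (cid (pick x xU)))) (svalP (cid (pick x xU))).
have tE x (xU : oset U x) i (xi : oset (V i) x) : t x xU = fval (s i) xi by exact: agree.
have ht : is_fsect t.
  move=> x xU; have [i xi] := pick x xU.
  have [W [sub [xW G]]] := svalP (s i) x xi.
  exists W, (subset_trans sub (VU i)); split => //; move: G; congr (sd_good D _).
  apply: functional_extensionality_dep => y; apply: functional_extensionality_dep => yW.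
  by rewrite [RHS]/sub_fun (tE _ _ i (sub y yW)).
exists (exist _ t ht); split.
  move=> i; apply: fsect_ext => x xi; rewrite (fval_res _ _ xi (VU i x xi)).
  exact: tE.
move=> t' t'E; apply: fsect_ext => x xU; have [i xi] := pick x xU.
rewrite -[LHS]/(t x xU) (tE _ _ i xi) -(t'E i); exact: fval_res.
Qed.

Definition function_space : ringed_space.
Proof.
refine (@RingedSpace T (fun U => fsect U : comPzRingType)
  (fun U V UV => fres UV : {rmorphism fsect V -> fsect U}) _ _ fsheaf).
- by move=> U UU s; apply: fsect_ext => x xU; exact: fval_res.
- move=> U V W UV VW UW s; apply: fsect_ext => x xU.
  by rewrite (fval_res _ _ xU (UV x xU)) (fval_res _ _ (UV x xU) (UW x xU))
    (fval_res _ _ xU (UW x xU)).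
Defined.

Lemma stalk_eval_exists (x : function_space) : exists e : {rmorphism stalk x -> R x},
  forall (U : opens T) (xU : oset U x) (s : fsect U),
    e (germ (X := function_space) xU s) = fval s xU.
Proof.
pose F (i : nbhd_index x) : {rmorphism @sect function_space (sval i) -> R x} := feval (svalP i).
have [|g gE] := @colim_rmorph_exists (stalk_system x) (nbhdT x) (R x) F.
  move=> [U xU] [V xV] VU s; exact: fval_res.
exists g => U xU s; rewrite [LHS](gE (exist _ U xU) s); exact: fval_irr.
Qed.

Definition stalk_eval (x : function_space) := sval (cid (stalk_eval_exists x)).

Lemma stalk_evalE (x : function_space) (U : opens T) (xU : oset U x) (s : fsect U) :
  stalk_eval x (germ (X := function_space) xU s) = fval s xU.
Proof. by rewrite /stalk_eval; case: cid => g /= ->. Qed.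

Lemma fsect_good (x : T) (U : opens T) (xU : oset U x) (s : fsect U) :
  exists (W : opens T) (sub : W `<=` U), oset W x /\ sd_good D (sub_fun sub (sval s)).
Proof. exact: svalP s x xU. Qed.

Lemma stalk_eval_inj (x : function_space) : injective (stalk_eval x).
Proof.
move=> g h E; apply/eqP; rewrite -subr_eq0; apply/eqP.
have : stalk_eval x (g - h) = 0 by rewrite rmorphB E subrr.
move: (g - h) => {E h}g; have [U [xU [s ->]]] := germP g; rewrite stalk_evalE => s0.
have [W [sub [xW G]]] := fsect_good xU s.
have [|W' [xW' E]] := @sd_sep _ D W _ x xW G.
  by rewrite -[RHS]s0; exact: fval_irr.
pose V : opens function_space := opensI W' W.
have i : V `<=` U by move=> y [_ /sub].
have xI : oset V x by [].
rewrite -(@germ_res function_space x U V i xI) -(rmorph0 (germ xI)).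
congr (germ xI _); apply: fsect_ext => y yI; have [yW' yW] := yI.
have := E y yW yW'; rewrite /sub_fun => H.
transitivity (0 : R y); last by rewrite [RHS](rmorph0 (feval _)).
by rewrite -[RHS]H; exact: (@fval_res V U i s y yI (sub y yW)).
Qed.

Lemma good_fsect (W : opens T) (s : forall x, oset W x -> R x) :
  sd_good D s -> exists t : fsect W, forall x (xW : oset W x), fval t xW = s x xW.
Proof.
move=> G; have hs : is_fsect s.
  move=> x xW; exists W, (@subset_refl _ W); split => //; move: G; congr (sd_good D _).
  apply: functional_extensionality_dep => y; apply: functional_extensionality_dep => yW.
  by rewrite /sub_fun; congr (s y _); exact: Prop_irrelevance.
by exists (exist _ s hs).
Qed.

End FunctionSheaf.

(** * The spectrum of a ring *)

Section Spec.
Variable A : comPzRingType.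

Definition spec : Type := {P : set A | is_prime_ideal P}.
HB.instance Definition _ := gen_eqMixin spec.
HB.instance Definition _ := gen_choiceMixin spec.

Definition spec_open (V : set spec) : Prop :=
  forall P, V P -> exists d, ~ sval P d /\ forall Q : spec, ~ sval Q d -> V Q.

Fact spec_openT : spec_open setT.
Proof. by move=> [P [idP P1 PM]] _; exists 1. Qed.

Fact spec_openI U V : spec_open U -> spec_open V -> spec_open (U `&` V).
Proof.
move=> oU oV P [/oU [d [nd dU]] /oV [e [ne eV]]]; exists (d * e); split.
  by case: (svalP P) => _ _ PM /PM [].
move=> Q nde; split; [apply: dU|apply: eV] => H; apply: nde; case: (svalP Q) => idQ _ _.
  exact: ideal_mulr.
by case: idQ => _ _; apply.
Qed.

Fact spec_open_bigcup (I : Type) (f : I -> set spec) :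
  (forall i, spec_open (f i)) -> spec_open (\bigcup_i f i).
Proof.
move=> of_ P [i _ fP]; have [d [nd dV]] := of_ i P fP.
by exists d; split => // Q nQ; exists i => //; exact: dV.
Qed.

HB.instance Definition _ := isOpenTopological.Build spec spec_openT spec_openI spec_open_bigcup.

Lemma zero_ideal : is_ideal [set (0 : A)].
Proof. by split=> // [a b -> ->|a b ->] /=; rewrite ?addr0 ?mulr0. Qed.

Lemma local_ring_exists (P : spec) : exists (L : comPzRingType) (i : {rmorphism A -> L}),
  (forall s, ~ sval P s -> is_unit (i s)) /\
  (forall a, i a = 0 -> exists u, ~ sval P u /\ u * a = 0).
Proof.
have [L [i [u _ k]]] := exists_localization (prime_ideal_compl (svalP P)) zero_ideal.
by exists L, i; split => // a /k.
Qed.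

Definition local_ring (P : spec) : comPzRingType := sval (cid (local_ring_exists P)).
Definition to_local (P : spec) : {rmorphism A -> local_ring P} :=
  sval (cid (svalP (cid (local_ring_exists P)))).

Lemma to_local_unit (P : spec) s : ~ sval P s -> is_unit (to_local P s).
Proof. by have [u _] := svalP (cid (svalP (cid (local_ring_exists P)))); exact: u. Qed.

Lemma to_local0 (P : spec) a : to_local P a = 0 -> exists u, ~ sval P u /\ u * a = 0.
Proof. by have [_ k] := svalP (cid (svalP (cid (local_ring_exists P)))); exact: k. Qed.

Definition fraction_on (W : opens spec) (s : forall P, oset W P -> local_ring P) : Prop :=
  exists b d : A, forall P (PW : oset W P), ~ sval P d /\ to_local P d * s P PW = to_local P b.

Fact fraction_res (W' W : opens spec) (sub : W' `<=` W) s :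
  @fraction_on W s -> @fraction_on W' (sub_fun sub s).
Proof. by move=> [b [d H]]; exists b, d => P PW'; exact: H. Qed.

Fact fraction_one (W : opens spec) : @fraction_on W (fun _ _ => 1).
Proof.
exists 1, 1 => P PW; rewrite mulr1; split => //.
by have [_] := svalP P.
Qed.

Fact fraction_sub (W : opens spec) s t : @fraction_on W s -> @fraction_on W t ->
  @fraction_on W (fun P PW => s P PW - t P PW).
Proof.
move=> [b [d H]] [b' [d' H']]; exists (d' * b - d * b'), (d * d') => P PW.
have [nd E] := H P PW; have [nd' E'] := H' P PW; split.
  by have [_ _ PM] := svalP P; move=> /PM [].
by rewrite !(rmorphB, rmorphM) -E -E'; ring.
Qed.

Fact fraction_mul (W : opens spec) s t : @fraction_on W s -> @fraction_on W t ->
  @fraction_on W (fun P PW => s P PW * t P PW).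
Proof.
move=> [b [d H]] [b' [d' H']]; exists (b * b'), (d * d') => P PW.
have [nd E] := H P PW; have [nd' E'] := H' P PW; split.
  by have [_ _ PM] := svalP P; move=> /PM [].
by rewrite !rmorphM -E -E'; ring.
Qed.

Fact spec_D_open d : open [set P : spec | ~ sval P d].
Proof. by move=> P nd; exists d. Qed.

Definition spec_D d : opens spec := Opens (@spec_D_open d).

Fact fraction_sep (W : opens spec) s P (PW : oset W P) : @fraction_on W s -> s P PW = 0 ->
  exists W' : opens spec, oset W' P /\ forall Q (QW : oset W Q), oset W' Q -> s Q QW = 0.
Proof.
move=> [b [d H]] s0; have [nd] := H P PW; rewrite s0 mulr0 => /esym /to_local0 [u [nu ub]].
exists (spec_D u); split => // Q QW Qu; have [nd' E] := H Q QW.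
apply: (is_unit_inj (to_local_unit nd')); rewrite E mulr0.
apply: (is_unit_inj (to_local_unit Qu)).
by rewrite -rmorphM ub rmorph0 mulr0.
Qed.

Definition spec_data : sheaf_data spec :=
  SheafData fraction_res fraction_one fraction_sub fraction_mul fraction_sep.

Definition spec_space : ringed_space := function_space spec_data.

Fact spec_const_ex a : exists t : @sect spec_space (opensT spec_space),
  forall P (PT : oset (opensT spec_space) P), fval t PT = to_local P a.
Proof.
apply: (@good_fsect spec spec_data (opensT spec) (fun P _ => to_local P a)).
exists a, 1 => P _; rewrite rmorph1 mul1r; split => //; by have [_] := svalP P.
Qed.

Definition spec_const_fun a := sval (cid (spec_const_ex a)).
Lemma spec_constE a P (PT : oset (opensT spec_space) P) : fval (spec_const_fun a) PT = to_local P a.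
Proof. by rewrite /spec_const_fun; case: cid. Qed.

Fact spec_const_zmod : zmod_morphism spec_const_fun.
Proof.
move=> a b; apply: fsect_ext => P PT; rewrite spec_constE [RHS](rmorphB (feval PT)).
by rewrite /= /feval !spec_constE rmorphB.
Qed.
Fact spec_const_monoid : monoid_morphism spec_const_fun.
Proof.
split=> [|a b]; apply: fsect_ext => P PT; rewrite spec_constE.
  by rewrite rmorph1.
by rewrite [RHS](rmorphM (feval PT)) /= /feval !spec_constE rmorphM.
Qed.
HB.instance Definition _ := GRing.isZmodMorphism.Build _ _ spec_const_fun spec_const_zmod.
HB.instance Definition _ := GRing.isMonoidMorphism.Build _ _ spec_const_fun spec_const_monoid.
Definition spec_const : {rmorphism A -> @sect spec_space (opensT spec_space)} := spec_const_fun.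

Lemma eval_spec_const (P : spec_space) (PT : oset (opensT spec_space) P) a :
  stalk_eval P (germ PT (spec_const a)) = to_local P a.
Proof. by rewrite [LHS]stalk_evalE; exact: spec_constE. Qed.

Lemma spec_const_unit (P : spec_space) a : germ_unit P (spec_const a) <-> ~ sval P a.
Proof.
have PT : oset (opensT spec_space) P := I.
split=> [/(germ_unitP PT) [g ag]|na].
  move=> Pa; have [U [PU [s gE]]] := germP g.
  have [W [sub [PW [b [d H]]]]] := fsect_good PU s.
  have [nd dE] := H P PW; have [[P0 PD PM] P1 PP] := svalP P.
  have : to_local P (a * b - d) = 0.
    rewrite rmorphB rmorphM -dE mulrCA /sub_fun.
    have -> : to_local P a * sval s P (sub P PW) = stalk_eval P (germ PT (spec_const a) * g).
      by rewrite rmorphM eval_spec_const gE [X in _ = _ * X]stalk_evalE; congr (_ * _);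
        exact: (@fval_irr _ spec_data U s P (sub P PW) PU).
    by rewrite ag rmorph1 mulr1 subrr.
  move=> /to_local0 [u [nu uE]]; have : sval P (u * d).
    have -> : u * d = (u * b) * a - u * (a * b - d) by ring.
    by rewrite uE subr0; exact: PM.
  by case/PP.
have [v av] := to_local_unit na.
pose W : opens spec_space := spec_D a.
(* The value 0 is taken only where [a] vanishes, outside the open [W] on which [inv] is used. *)
pose inv (Q : spec) : local_ring Q :=
  if pselect (sval Q a) is right na then sval (cid (to_local_unit na)) else 0.
have invE (Q : spec) : ~ sval Q a -> to_local Q a * inv Q = 1.
  by move=> nQ; rewrite /inv; case: pselect => // n; exact: (svalP (cid (to_local_unit n))).
have G : sd_good spec_data (fun Q (QW : oset W Q) => inv Q).
  by exists 1, a => Q QW; rewrite rmorph1; split => //; exact: invE.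
have [t tE] := good_fsect G.
have WT : W `<=` opensT spec_space by [].
exists W, WT; split => //; exists t; apply: fsect_ext => Q QW.
rewrite [LHS](rmorphM (feval QW)) /= /feval.
rewrite [X in X * _](@fval_res _ spec_data W (opensT spec_space) WT _ Q QW I) spec_constE tE.
by rewrite invE.
Qed.

Lemma spec_local_chart : local_chart spec_const.
Proof.
have prE (P : spec_space) : chart_prime spec_const P = sval P.
  rewrite predeqE => a; rewrite /chart_prime /=; split => [n|Pa /spec_const_unit //].
  by apply: contrapT => /spec_const_unit.
split.
- by move=> P _; rewrite prE; exact: svalP.
- by move=> P pP; exists (exist _ P pP : spec); rewrite prE.
- by move=> P Q _ _; rewrite !prE; case: P Q => [P pP] [Q pQ] /= E; apply: eq_exist.
- move=> P V _ oV PV; have [d [nd dV]] := oV P PV.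
  by exists d; split=> [|Q /spec_const_unit nQ]; [exact/spec_const_unit|exact: dV].
- move=> P PT g; have [U [PU [s gE]]] := germP g.
  have [W [sub [PW [b [d H]]]]] := fsect_good PU s.
  have [nd dE] := H P PW; exists b, d; split; first exact/spec_const_unit.
  apply: stalk_eval_inj; rewrite rmorphM !eval_spec_const gE -dE; congr (_ * _).
  by rewrite [LHS]stalk_evalE; exact: (@fval_irr _ spec_data U s P PU (sub P PW)).
- move=> P PT a a0; have := eval_spec_const PT a; rewrite a0 rmorph0.
  by move=> /esym /to_local0 [u [nu uE]]; exists u; split => //; exact/spec_const_unit.
Qed.

Fact spec_charts (P : spec_space) : exists (U : opens spec_space) (B : comPzRingType)
  (phi : {rmorphism B -> sect U}), oset U P /\ local_chart phi.
Proof. by exists (opensT spec_space), A, spec_const; split => //; exact: spec_local_chart. Qed.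

Definition spec_scheme : scheme :=
  Scheme (proj1 (scheme_of_charts spec_charts)) (proj2 (scheme_of_charts spec_charts)).

End Spec.

(** * Perfections *)

Section PerfRing.
Variables (p : nat) (pr_p : prime p).

Section Construction.
Variables (R : comPzRingType) (pR : p%:R = 0 :> R).

(** Stage [i] of the colimit holds [p ^ i]-th roots: the same root is written at stage [j] by
    raising its radicand to the power [p ^ (j - i)]. *)
Definition perf_tr (i j : nat) (_ : (i <= j)%N) : {rmorphism R -> R} :=
  frobenius_iter pr_p pR (j - i).

Fact perf_directed (i j : nat) : exists k, (i <= k)%N /\ (j <= k)%N.
Proof. by exists (maxn i j); rewrite leq_maxl leq_maxr. Qed.
Fact perf_trans (i j k : nat) : (i <= j)%N -> (j <= k)%N -> (i <= k)%N.
Proof. exact: leq_trans. Qed.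
Fact perf_tr_comp i j k (ij : (i <= j)%N) (jk : (j <= k)%N) (ik : (i <= k)%N) a :
  perf_tr jk (perf_tr ij a) = perf_tr ik a.
Proof.
rewrite /perf_tr /= /frobenius_iter -exprM -expnD; congr (_ ^+ (_ ^ _)).
by rewrite addnC addnBA // subnK.
Qed.

Definition perf_system : directed_system :=
  @DirectedSystem nat (fun i j => (i <= j)%N) (fun _ => R) perf_tr
    perf_directed perf_trans perf_tr_comp.

Definition perf_ring : comPzRingType := @colim_ring perf_system 0%N.

(** [perf_in n a] is the [p ^ n]-th root of [a]. *)
Definition perf_in (n : nat) : {rmorphism R -> perf_ring} :=
  let i : ds_index perf_system := n in
  (@colim_in perf_system 0%N i : {rmorphism ds_ring i -> @colim_ring perf_system 0%N}).
Arguments perf_in : simpl never.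

Lemma perf_in_add n k a : perf_in (k + n) (a ^+ (p ^ k)) = perf_in n a.
Proof.
have nk : (n <= k + n)%N by rewrite leq_addl.
by rewrite -[RHS](@colim_in_tr perf_system 0%N n (k + n)%N nk a) /= /frobenius_iter addnK.
Qed.

Lemma perf_inX n a : perf_in n a ^+ (p ^ n) = perf_in 0 a.
Proof. by rewrite -rmorphXn -(perf_in_add 0 n a) addn0. Qed.

Lemma perf_inP (z : perf_ring) : exists n a, z = perf_in n a.
Proof. by have [n [a ->]] := colim_inP z; exists n, a. Qed.

Lemma perf_in0 n a : perf_in n a = 0 -> exists k, a ^+ (p ^ k) = 0.
Proof.
rewrite -(rmorph0 (perf_in n)) => /eq_colim_in [k [nk [nk' E]]]; exists (k - n)%N.
rewrite -[LHS]/(frobenius_iter pr_p pR (k - n) a).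
have : perf_tr nk a = perf_tr nk' 0 := E.
by rewrite rmorph0.
Qed.

Lemma perf_root (z : perf_ring) : exists w, w ^+ p = z.
Proof.
have [n [a ->]] := perf_inP z; exists (perf_in (1 + n) a).
by rewrite -rmorphXn -(perf_in_add n 1 a) expn1.
Qed.

Lemma perf_char : p%:R = 0 :> perf_ring.
Proof. by rewrite -(rmorph_nat (perf_in 0)) pR rmorph0. Qed.

Lemma perf_reduced (z : perf_ring) : z ^+ p = 0 -> z = 0.
Proof.
have [n [a ->]] := perf_inP z; rewrite -rmorphXn => /perf_in0 [k].
rewrite -exprM -expnS => ak; rewrite -(perf_in_add n k.+1) ak; exact: rmorph0.
Qed.

End Construction.

Definition perfect_ring (R : comPzRingType) : Prop :=
  (forall a : R, exists b, b ^+ p = a) /\ (forall a b : R, a ^+ p = b ^+ p -> a = b).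

Lemma frobenius_inj (R : comPzRingType) (pR : p%:R = 0 :> R) :
  (forall a : R, a ^+ p = 0 -> a = 0) -> forall a b : R, a ^+ p = b ^+ p -> a = b.
Proof.
move=> red a b E; apply/eqP; rewrite -subr_eq0; apply/eqP/red.
by rewrite -[p]expn1 (frobenius_iter_sub pr_p pR) expn1 E subrr.
Qed.

Lemma perf_ring_perfect (R : comPzRingType) (pR : p%:R = 0 :> R) : perfect_ring (perf_ring pR).
Proof.
split; first exact: perf_root.
apply: frobenius_inj; [exact: perf_char|exact: perf_reduced].
Qed.

Lemma perfect_ring_iter (R : comPzRingType) : perfect_ring R -> forall n,
  (forall a : R, exists b, b ^+ (p ^ n) = a) /\
  (forall a b : R, a ^+ (p ^ n) = b ^+ (p ^ n) -> a = b).
Proof.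
move=> [root inj]; elim=> [|n [IHr IHi]]; first by split=> [a|//]; exists a.
split=> [a|a b].
  have [b <-] := IHr a; have [c <-] := root b; exists c.
  by rewrite expnS exprM.
by rewrite expnS !exprM => /IHi /inj.
Qed.

(** [perf_in n a] must go to the [p ^ n]-th root of [f a], unique in a perfect ring; uniqueness and
    the additivity of Frobenius make this choice a ring map at each stage. *)
Lemma perf_ring_rmorph (R R' : comPzRingType) (pR : p%:R = 0 :> R) (f : {rmorphism R -> R'}) :
  perfect_ring R' -> exists g : {rmorphism perf_ring pR -> R'},
    forall n a, g (perf_in pR n a) ^+ (p ^ n) = f a.
Proof.
move=> pR'; have pR'0 : p%:R = 0 :> R' by rewrite -(rmorph_nat f) pR rmorph0.
have ex n (a : R) : exists b, b ^+ (p ^ n) = f a by have [r _] := perfect_ring_iter pR' n.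
pose h n a := sval (cid (ex n a)).
have hE n a : h n a ^+ (p ^ n) = f a by exact: svalP (cid (ex n a)).
have inj n : forall a b : R', a ^+ (p ^ n) = b ^+ (p ^ n) -> a = b.
  by have [] := perfect_ring_iter pR' n.
have hB n : zmod_morphism (h n).
  by move=> a b; apply: (inj n); rewrite (frobenius_iter_sub pr_p pR'0) !hE rmorphB.
have hM n : monoid_morphism (h n).
  split=> [|a b]; apply: (inj n); first by rewrite hE rmorph1 expr1n.
  by rewrite exprMn !hE rmorphM.
pose H n : {rmorphism R -> R'} := HB.pack (h n)
  (GRing.isZmodMorphism.Build _ _ _ (hB n)) (GRing.isMonoidMorphism.Build _ _ _ (hM n)).
have [|g gE] := @colim_rmorph_exists (perf_system pR) 0%N R' H.
  move=> i k ik a; apply: (inj k); rewrite [LHS]hE.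
  rewrite -[in RHS](subnKC ik) expnD exprM [X in X ^+ _]hE /= -rmorphXn.
  by [].
exists g => n a; have -> : g (perf_in pR n a) = h n a by exact: gE.
exact: hE.
Qed.

End PerfRing.
Arguments perf_in {p} pr_p {R} pR n : simpl never.

(** Asked of the stalks, which makes it local and visibly invariant under isomorphism; sections get
    their roots by gluing the unique local ones. *)
Definition perfect (p : nat) (X : ringed_space) : Prop :=
  forall x : X, perfect_ring p (stalk x).

(** * The perfection of a scheme *)

Section PerfScheme.
Variables (p : nat) (pr_p : prime p) (X : scheme) (FpX : Fp_scheme p X).

Fact stalk_char (x : X) : p%:R = 0 :> stalk x.
Proof.
by rewrite -(rmorph_nat (germ (I : oset (opensT X) x))) (Fp_scheme_char pr_p FpX) rmorph0.
Qed.

Definition perf_stalk (x : X) : comPzRingType := perf_ring pr_p (stalk_char x).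
Definition root_at (x : X) n : {rmorphism stalk x -> perf_stalk x} :=
  perf_in pr_p (stalk_char x) n.

(** The local shape of a function on the perfection: the [p ^ n]-th root of a section, with one
    exponent [n] for the whole open. *)
Definition is_root (W : opens X) (s : forall x, oset W x -> perf_stalk x) : Prop :=
  exists (t : sect W) (n : nat), forall x (xW : oset W x), s x xW = root_at x n (germ xW t).

Fact is_root_res (W' W : opens X) (sub : W' `<=` W) s : @is_root W s -> @is_root W' (sub_fun sub s).
Proof.
move=> [t [n E]]; exists (res sub t), n => x xW'.
by rewrite /sub_fun E (germ_res sub xW' (sub x xW')).
Qed.

Fact is_root_one (W : opens X) : @is_root W (fun _ _ => 1).
Proof. by exists 1, 0%N => x xW; rewrite !rmorph1. Qed.

Lemma root_at_add x n k g : root_at x (k + n) (g ^+ (p ^ k)) = root_at x n g.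
Proof. exact: perf_in_add. Qed.

Fact is_root_sub (W : opens X) s t : @is_root W s -> @is_root W t ->
  @is_root W (fun x xW => s x xW - t x xW).
Proof.
move=> [a [n E]] [b [m E']]; exists (a ^+ (p ^ m) - b ^+ (p ^ n)), (m + n)%N => x xW.
rewrite E E' !rmorphB; congr (_ - _); first by rewrite rmorphXn root_at_add.
by rewrite rmorphXn addnC root_at_add.
Qed.

Fact is_root_mul (W : opens X) s t : @is_root W s -> @is_root W t ->
  @is_root W (fun x xW => s x xW * t x xW).
Proof.
move=> [a [n E]] [b [m E']]; exists (a ^+ (p ^ m) * b ^+ (p ^ n)), (m + n)%N => x xW.
rewrite E E' !rmorphM; congr (_ * _); first by rewrite rmorphXn root_at_add.
by rewrite rmorphXn addnC root_at_add.
Qed.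

Fact is_root_sep (W : opens X) s x (xW : oset W x) : @is_root W s -> s x xW = 0 ->
  exists W' : opens X, oset W' x /\ forall y (yW : oset W y), oset W' y -> s y yW = 0.
Proof.
move=> [t [n E]]; rewrite E => /perf_in0 [k]; rewrite -rmorphXn -(rmorph0 (germ xW)).
move=> /eq_germ [W' [W'W [W'W' [xW' H]]]]; exists W'; split => // y yW yW'.
by rewrite E -(root_at_add n k) -rmorphXn -(germ_res W'W yW' yW) H !rmorph0.
Qed.

Definition perf_data : sheaf_data X :=
  SheafData is_root_res is_root_one is_root_sub is_root_mul is_root_sep.

Definition perf_space : ringed_space := function_space perf_data.

Fact root_ex (U : opens X) n (s : sect U) : exists t : @sect perf_space U,
  forall x (xU : oset U x), fval t xU = root_at x n (germ xU s).
Proof.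
by apply: (@good_fsect X perf_data U (fun x xU => root_at x n (germ xU s))); exists s, n.
Qed.

Definition root_fun U n s := sval (cid (@root_ex U n s)).
Lemma root_funE U n s x (xU : oset U x) : fval (root_fun n s) xU = root_at x n (germ xU s).
Proof. by rewrite /root_fun; case: cid. Qed.
Fact root_zmod U n : zmod_morphism (@root_fun U n).
Proof.
move=> s t; apply: fsect_ext => x xU.
rewrite root_funE [RHS](rmorphB (@feval X perf_data U x xU)) /= /feval.
by rewrite !root_funE !rmorphB.
Qed.
Fact root_monoid U n : monoid_morphism (@root_fun U n).
Proof.
split=> [|s t]; apply: fsect_ext => x xU; rewrite root_funE; first by rewrite !rmorph1.
by rewrite [RHS](rmorphM (@feval X perf_data U x xU)) /= /feval !root_funE !rmorphM.
Qed.
HB.instance Definition _ U n := GRing.isZmodMorphism.Build _ _ (@root_fun U n) (@root_zmod U n).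
HB.instance Definition _ U n := GRing.isMonoidMorphism.Build _ _ (@root_fun U n) (@root_monoid U n).
Definition root_sect (U : opens X) n : {rmorphism sect U -> @sect perf_space U} := @root_fun U n.

Lemma eval_root (x : perf_space) (U : opens X) (xU : oset U x) n (s : sect U) :
  stalk_eval x (germ (X := perf_space) (U := U) xU (root_sect U n s)) = root_at x n (germ xU s).
Proof. by rewrite [LHS]stalk_evalE; exact: root_funE. Qed.

Lemma germ_perf (x : perf_space) (g : stalk x) :
  exists (U : opens X) (xU : oset U x) n (s : sect U),
  g = germ (X := perf_space) (U := U) xU (root_sect U n s).
Proof.
have [V [xV [t ->]]] := germP g; have [W [sub [xW [s [n E]]]]] := fsect_good xV t.
exists W, xW, n, s; apply: stalk_eval_inj; rewrite eval_root -E [LHS]stalk_evalE.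
exact: (@fval_irr _ perf_data V t x xV (sub x xW)).
Qed.

Lemma stalk_eval_surj (x : perf_space) (z : perf_stalk x) : exists g, stalk_eval x g = z.
Proof.
have [n [a ->]] := perf_inP z; have [U [xU [s ->]]] := germP a.
by exists (germ (X := perf_space) (U := U) xU (root_sect U n s)); exact: eval_root.
Qed.

Lemma stalk_eval_unit (x : perf_space) g : is_unit (stalk_eval x g) -> is_unit g.
Proof.
move=> [z gz]; have [h hz] := stalk_eval_surj z; exists h; apply: stalk_eval_inj.
by rewrite rmorphM hz rmorph1 gz.
Qed.

Lemma perf_space_perfect : perfect p perf_space.
Proof.
move=> x; have [root inj] := perf_ring_perfect pr_p (stalk_char x); split=> [g|g h E].
  have [w wE] := root (stalk_eval x g); have [h hw] := stalk_eval_surj w.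
  by exists h; apply: stalk_eval_inj; rewrite rmorphXn hw.
by apply: stalk_eval_inj; apply: inj; rewrite -!rmorphXn E.
Qed.

(** An inverse [a ^ (1 / p ^ m)] of [g ^ (1 / p ^ n)] makes [g ^ (p ^ m) * a ^ (p ^ n) - 1]
    nilpotent; a further power of Frobenius turns this into the invertibility of a power of [g]. *)
Lemma perf_in_unit (x : X) n g : is_unit (root_at x n g) -> is_unit g.
Proof.
move=> [z]; have [m [a ->]] := perf_inP z.
rewrite -/(root_at x m) -(root_at_add n m) -(root_at_add m n) addnC -rmorphM.
rewrite -(rmorph1 (root_at x (n + m))) => E.
have : root_at x (n + m) (g ^+ (p ^ m) * a ^+ (p ^ n) - 1) = 0 by rewrite rmorphB E subrr.
move=> /perf_in0 [k]; rewrite (frobenius_iter_sub pr_p (stalk_char x)) expr1n => /eqP.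
rewrite subr_eq0 => /eqP H.
have : is_unit (g ^+ (p ^ m * p ^ k)).
  by exists ((a ^+ (p ^ n)) ^+ (p ^ k)); rewrite exprM -exprMn.
have q0 : (0 < p ^ m * p ^ k)%N by rewrite -expnD expn_gt0 prime_gt0.
by rewrite -(prednK q0) exprS => /is_unit_mulP [].
Qed.

Lemma perf_germ_unit (x : perf_space) (U : opens X) n (s : sect U) (xU : oset U x) :
  germ_unit (X := perf_space) x (root_sect U n s) <-> germ_unit (X := X) x s.
Proof.
rewrite (@germ_unitP perf_space x U xU) (@germ_unitP X x U xU); split=> u.
  by apply: (@perf_in_unit x n); rewrite -eval_root; exact: is_unit_rmorph.
by apply: stalk_eval_unit; rewrite eval_root; exact: is_unit_rmorph.
Qed.

Section Chart.
Variables (U : opens X) (aU : affine U).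
Let B : comPzRingType := perf_ring pr_p (Fp_scheme_char pr_p FpX U).
Let inB n : {rmorphism sect U -> B} := perf_in pr_p (Fp_scheme_char pr_p FpX U) n.

Lemma perf_chart_rmorph : exists psi : {rmorphism B -> @sect perf_space U},
  forall n s, psi (inB n s) = root_sect U n s.
Proof.
have [|g gE] := @colim_rmorph_exists (perf_system pr_p (Fp_scheme_char pr_p FpX U)) 0%N
    (@sect perf_space U) (root_sect U); last by exists g => n s; exact: gE.
move=> i k ik s; apply: fsect_ext => x xU; rewrite !root_funE /=.
by rewrite /frobenius_iter rmorphXn -(root_at_add i (k - i)) subnK.
Qed.

(** Over an affine open the chart is the perfection of the ring of sections. A prime contains a
    [p ^ n]-th root exactly when it contains the radicand, so the primes, and hence the points, are
    those of the original ring. *)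
Lemma perf_local_chart : exists psi : {rmorphism B -> @sect perf_space U}, local_chart psi.
Proof.
have [psi psiE] := perf_chart_rmorph; exists psi.
have prE (x : perf_space) n s : oset U x ->
    chart_prime psi x (inB n s) <-> chart_prime (X := X) idfun x s.
  by move=> xU; rewrite /chart_prime /= psiE perf_germ_unit.
have inB0 (P : set B) n s : is_prime_ideal P -> P (inB n s) <-> P (inB 0%N s).
  move=> pP; rewrite -(perf_inX pr_p _ n s); split; last exact: prime_ideal_exp.
  move=> Ps; have [[_ _ PM] _ _] := pP.
  have q0 : (0 < p ^ n)%N by rewrite expn_gt0 prime_gt0.
  by rewrite -(prednK q0) exprSr; exact: PM.
have prime_pr x : oset U x ->
    is_prime_ideal (chart_prime (X := X) (idfun : {rmorphism sect U -> sect U}) x).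
  exact: (@lc_prime _ _ _ _ aU x).
have common (z w : B) : exists n s t, z = inB n s /\ w = inB n t.
  by have [n [s [t [-> ->]]]] := colim_in_common z w; exists n, s, t.
split.
- move=> x xU; have [[p0 pD pM] p1 pP] := prime_pr x xU; split.
  + split=> [|z w|z w].
    * by rewrite -(rmorph0 (inB 0%N)) prE.
    * have [n [s [t [-> ->]]]] := common z w; rewrite -rmorphD !prE //; exact: pD.
    * have [n [s [t [-> ->]]]] := common z w; rewrite -rmorphM !prE //; exact: pM.
  + by rewrite -(rmorph1 (inB 0%N)) prE.
  + move=> z w; have [n [s [t [-> ->]]]] := common z w; rewrite -rmorphM !prE //; exact: pP.
- move=> P pP; have [x [xU xP]] := lc_point aU (preimage_prime (inB 0%N) pP).
  exists x; split => //; rewrite predeqE => z; have [n [s ->]] := perf_inP z.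
  by rewrite prE // xP [X in _ <-> X]inB0.
- move=> x y xU yU E; apply: (lc_inj aU) => //; rewrite predeqE => s.
  by rewrite -(prE x 0%N) // -(prE y 0%N) // E.
- move=> x V xU oV xV; have [d [ud dV]] := lc_basis aU xU oV xV.
  exists (inB 0%N d); rewrite psiE; split; first exact/perf_germ_unit.
  move=> y u; apply: dV; apply/(perf_germ_unit 0%N d (germ_unit_in u)); exact: u.
- move=> x xU g; have [W [xW [n [s gE]]]] := germ_perf g.
  have [a [d [ud E]]] := lc_frac aU xU (germ (X := X) xW s).
  exists (inB n a), (inB n d); rewrite !psiE; split; first exact/perf_germ_unit.
  apply: stalk_eval_inj; rewrite rmorphM gE !eval_root -rmorphM; congr (root_at x n _).
  exact: E.
- move=> x xU z; have [n [s ->]] := perf_inP z; rewrite psiE => E0.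
  have : root_at x n (germ (X := X) xU s) = 0 by rewrite -eval_root E0 rmorph0.
  move=> /perf_in0 [k]; rewrite -rmorphXn => /(lc_ker aU) [e [ue eE]].
  exists (inB 0%N e); rewrite psiE; split; first exact/perf_germ_unit.
  rewrite -(perf_in_add pr_p _ 0%N n e) addn0 -rmorphM -(perf_in_add pr_p _ n k) exprMn.
  have q0 : (0 < p ^ n * p ^ k)%N by rewrite -expnD expn_gt0 prime_gt0.
  by rewrite -exprM -(prednK q0) exprSr -mulrA eE mulr0 rmorph0.
Qed.

End Chart.

Lemma affine_nbhd (Y : scheme) (y : Y) (O : set Y) : open O -> O y ->
  exists V : opens Y, [/\ affine V, oset V y & V `<=` O].
Proof.
move=> oO Oy; have [U [A [phi [yU lc]]]] := scheme_chart y.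
have [d [ud dO]] := lc_basis lc yU oO Oy.
exists (chart_open phi d); split => //; exact: chart_principal lc.
Qed.

Fact perf_charts (x : perf_space) : exists (U : opens perf_space) (A : comPzRingType)
  (phi : {rmorphism A -> sect U}), oset U x /\ local_chart phi.
Proof.
have [V [aV xV _]] := @affine_nbhd X x setT openT I.
by have [psi lc] := perf_local_chart aV; exists V; eexists; exists psi.
Qed.

Definition perf_scheme : scheme :=
  Scheme (proj1 (scheme_of_charts perf_charts)) (proj2 (scheme_of_charts perf_charts)).

Fact perf_proj_cts : continuous (fun x : perf_scheme => x : X).
Proof. by move=> x; exact: cvg_id. Qed.

Definition perf_proj_pull (V : opens X) :
    {rmorphism sect V -> @sect perf_scheme (preopen perf_proj_cts V)} :=
  @res perf_scheme (preopen perf_proj_cts V) V (@subset_refl _ (oset V)) \o root_sect V 0.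

Lemma perf_proj_pullE (V : opens X) (s : sect V) (x : perf_scheme)
  (xV : oset (preopen perf_proj_cts V) x) (xV' : oset V x) :
  germ xV (perf_proj_pull V s) = germ (X := perf_scheme) (U := V) xV' (root_sect V 0 s).
Proof. exact: (@germ_res perf_scheme x V (preopen perf_proj_cts V)). Qed.

Fact perf_proj_res (U V : opens X) (UV : U `<=` V) (s : sect V) :
  perf_proj_pull U (res UV s) =
  res (@preimage_subset _ _ (fun x : perf_scheme => x : X) _ _ UV :
    preopen perf_proj_cts U `<=` preopen perf_proj_cts V) (perf_proj_pull V s).
Proof.
apply: sect_ext => x xU; have xV : oset (preopen perf_proj_cts V) x := UV x xU.
rewrite (germ_res _ xU xV) (perf_proj_pullE _ xU xU) (perf_proj_pullE _ xV xV).
apply: stalk_eval_inj; rewrite !eval_root; congr (root_at x 0 _).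
exact: (@germ_res X x V U UV xU xV).
Qed.

Fact perf_proj_local (x : perf_scheme) (V : opens X) (s : sect V) :
  germ_unit x (perf_proj_pull V s) -> germ_unit (X := X) x s.
Proof.
move=> u; have xV : oset V x := germ_unit_in u.
move: u; rewrite (germ_unitP (xV : oset (preopen perf_proj_cts V) x)).
rewrite (perf_proj_pullE _ _ xV) => u.
by rewrite -(perf_germ_unit 0 s xV) (@germ_unitP perf_space x V xV).
Qed.

Definition perf_proj : lrs_hom perf_scheme X := Defs.Hom perf_proj_res perf_proj_local.

Lemma stalk_eval_proj (x : perf_scheme) (g : stalk (perf_proj x)) :
  stalk_eval (D := perf_data) x (stalk_map perf_proj x g) = root_at x 0 g.
Proof.
have [V [xV [s ->]]] := germP g.
rewrite (stalk_mapE (f := perf_proj) xV (xV : oset (preopen (hom_cts perf_proj) V) x)).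
rewrite [X in stalk_eval _ X](perf_proj_pullE s _ xV); exact: eval_root.
Qed.

Lemma germ_root_exp (x : perf_scheme) (U : opens X) (xU : oset U x) n (s : sect U) :
  germ (X := perf_scheme) (U := U) xU (root_sect U n s) ^+ (p ^ n) =
  stalk_map perf_proj x (germ (X := X) xU s).
Proof.
apply: stalk_eval_inj; rewrite rmorphXn eval_root stalk_eval_proj; exact: perf_inX.
Qed.

End PerfScheme.

(** * Universal property of the perfection *)

Lemma perfect_iter_inj (p : nat) (W : ringed_space) (w : W) n (a b : stalk w) :
  perfect p W -> a ^+ (p ^ n) = b ^+ (p ^ n) -> a = b.
Proof. by move=> pW; have [_] := perfect_ring_iter (pW w) n; apply. Qed.

Section PerfUniversal.
Variables (p : nat) (pr_p : prime p) (X : scheme) (FpX : Fp_scheme p X).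
Local Notation Q := (perf_scheme pr_p FpX).
Local Notation proj := (perf_proj pr_p FpX).
Variables (W : ringed_space) (pW : perfect p W).

(** The projection is the identity on points, and a germ on [Q] is a [p ^ n]-th root of a germ on
    [X]; such roots are unique on [W]. *)
Lemma perf_hom_unique (g h : lrs_hom W Q) : comp_hom proj g = comp_hom proj h -> g = h.
Proof.
move=> E; have gh w : g w = h w.
  by have := congr1 (fun k : lrs_hom W X => k w) E.
apply: hom_ext_stalk => // w V gV hV s.
have [U [sub [gU [t [n tE]]]]] := fsect_good gV s.
have hU : oset U (h w) by rewrite -gh.
have root_germ (y : Q) (yU : oset U y) (yV : oset V y) :
    germ (X := Q) yV s = germ (X := Q) (U := U) yU (root_sect pr_p FpX U n t).
  apply: stalk_eval_inj; rewrite eval_root -tE [LHS]stalk_evalE.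
  exact: (@fval_irr _ (perf_data pr_p FpX) V s y yV (sub y yU)).
rewrite (root_germ _ gU) (root_germ _ hU).
apply: (@perfect_iter_inj p W w n) => //.
rewrite -[LHS]rmorphXn -[RHS]rmorphXn !germ_root_exp -!stalk_map_comp.
rewrite (stalk_mapE (f := comp_hom proj g) gU
  (gU : oset (preopen (hom_cts (comp_hom proj g)) U) w)).
rewrite (stalk_mapE (f := comp_hom proj h) hU
  (hU : oset (preopen (hom_cts (comp_hom proj h)) U) w)).
have : forall k k' : lrs_hom W X, k = k' -> forall (kU : oset (preopen (hom_cts k) U) w)
    (kU' : oset (preopen (hom_cts k') U) w), germ kU (pull k U t) = germ kU' (pull k' U t).
  by move=> k k' -> kU kU'; exact: germ_irr.
exact.
Qed.

Variable f : lrs_hom W X.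

Let st_ex w : exists g : {rmorphism perf_stalk pr_p FpX (f w) -> stalk w},
  forall n a, g (root_at pr_p FpX (f w) n a) ^+ (p ^ n) = stalk_map f w a.
Proof. exact: perf_ring_rmorph. Qed.

Let st w : {rmorphism stalk (f w : Q) -> stalk w} :=
  sval (cid (st_ex w)) \o stalk_eval (D := perf_data pr_p FpX) (f w : Q).

Let stE w (U : opens X) (fU : oset U (f w)) n (s : sect U) :
  st w (germ (X := Q) (U := U) fU (root_sect pr_p FpX U n s)) ^+ (p ^ n) =
  stalk_map f w (germ (X := X) fU s).
Proof. by rewrite /st /= eval_root; exact: (svalP (cid (st_ex w))). Qed.

Let f_cts : continuous (f : W -> Q).
Proof. exact: (hom_cts f). Qed.

Let st_sect w (V : opens Q) (fV : oset V (f w)) (s : sect V) :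
  exists (O : opens W) (t : sect O), oset O w /\
    forall y (yO : oset O y) (fyV : oset V (f y)), st y (germ (X := Q) fyV s) = germ yO t.
Proof.
have [U [sub [fU [t [n tE]]]]] := fsect_good fV s.
have root_germ (y : Q) (yU : oset U y) (yV : oset V y) :
    germ (X := Q) yV s = germ (X := Q) (U := U) yU (root_sect pr_p FpX U n t).
  apply: stalk_eval_inj; rewrite eval_root -tE [LHS]stalk_evalE.
  exact: (@fval_irr _ (perf_data pr_p FpX) V s y yV (sub y yU)).
have [root _] := perfect_ring_iter (pW w) n.
have wU : oset (preopen (hom_cts f) U) w := fU.
have [h] := root (germ wU (pull f U t)); have [O [wO [r ->]]] := germP h.
rewrite -rmorphXn => /eq_germ [N [NO [NU [wN E]]]].
exists N, (res NO r); split => // y yN fyV.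
have yU : oset (preopen (hom_cts f) U) y := NU y yN.
rewrite (root_germ _ yU); apply: (@perfect_iter_inj p W y n) => //.
rewrite stE -rmorphXn -rmorphXn E (germ_res NU yN yU); exact: stalk_mapE.
Qed.

Let st_local w (g : stalk (f w : Q)) : is_unit (st w g) -> is_unit g.
Proof.
have [U [fU [n [s ->]]]] := germ_perf g; move=> u.
have : is_unit (st w (germ (X := Q) (U := U) fU (root_sect pr_p FpX U n s)) ^+ (p ^ n)).
  exact: is_unitX.
rewrite stE => /stalk_map_local u'; apply: stalk_eval_unit; rewrite eval_root.
exact: is_unit_rmorph.
Qed.

(** On points the lift is [f]; on stalks it extracts the unique roots. A root of the germ of a
    pulled back section spreads to a neighbourhood, so sections go locally to sections. *)
Lemma perf_hom_exists : exists g : lrs_hom W Q, comp_hom proj g = f.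
Proof.
exists (mkhom f_cts st_sect st_local); apply: hom_ext_stalk => // w V fV fV' s.
rewrite stalk_map_comp stalk_map_mkhom -(germ_irr fV fV') -(stE fV 0 s).
by rewrite -(@germ_root_exp p pr_p X FpX (f w) V fV 0 s) rmorphXn.
Qed.

End PerfUniversal.

(** * Perfect schemes are topologically rigid *)

Lemma stalk_map_congr (X Y : ringed_space) (f g : lrs_hom X Y) (x : X) (V : opens Y)
  (fV : oset V (f x)) (gV : oset V (g x)) s : f = g ->
  stalk_map f x (germ fV s) = stalk_map g x (germ gV s).
Proof. by move=> E; subst g; rewrite (germ_irr fV gV). Qed.

(** * Base change to the affine line of an affine open *)

Section AffineLineBaseChange.
Variables (Y P : scheme) (f : lrs_hom Y P) (V : opens P).
Let V' : opens Y := preopen (hom_cts f) V.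
Hypotheses (affV : affine V) (affV' : affine V').
Variables (A B : comNzRingType).
Variables (iA : {rmorphism sect V -> A}) (jA : {rmorphism A -> sect V}).
Variables (iB : {rmorphism sect V' -> B}) (jB : {rmorphism B -> sect V'}).
Hypotheses (iAK : cancel iA jA) (jAK : cancel jA iA) (iBK : cancel iB jB) (jBK : cancel jB iB).

Let j : {rmorphism A -> B} := iB \o pull f V \o jA.
Let m : {rmorphism {poly A} -> {poly B}} := map_poly j.
Let SA := spec_scheme {poly A}.
Let SB := spec_scheme {poly B}.
Let constA : {rmorphism {poly A} -> sect (opensT SA)} := spec_const {poly A}.
Let constB : {rmorphism {poly B} -> sect (opensT SB)} := spec_const {poly B}.
Let chartA : local_chart constA := spec_local_chart {poly A}.
Let chartB : local_chart constB := spec_local_chart {poly B}.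

Let mC a : m a%:P = (j a)%:P.
Proof. exact: map_polyC. Qed.
Let mX : m 'X = 'X.
Proof. exact: map_polyX. Qed.

Lemma line_to_base : exists g : lrs_hom SA P, (forall w, oset V (g w)) /\
  forall w (gV : oset V (g w)) (wT : oset (opensT SA) w) s,
    stalk_map g w (germ gV s) = germ wT (constA (iA s)%:P).
Proof.
have [g [gV gE]] := hom_to_chart_exists affV (@sch_local SA)
  (constA \o (polyC \o iA) : {rmorphism sect V -> sect (opensT SA)}).
exists g; split => // w gw wT s; exact: (gE w gw wT s).
Qed.

Lemma line_to_cover : exists g' : lrs_hom SB Y, (forall w, oset V' (g' w)) /\
  forall w (gV : oset V' (g' w)) (wT : oset (opensT SB) w) s,
    stalk_map g' w (germ gV s) = germ wT (constB (iB s)%:P).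
Proof.
have [g [gV gE]] := hom_to_chart_exists affV' (@sch_local SB)
  (constB \o (polyC \o iB) : {rmorphism sect V' -> sect (opensT SB)}).
exists g; split => // w gw wT s; exact: (gE w gw wT s).
Qed.

Lemma line_to_line : exists f' : lrs_hom SB SA,
  forall w (fT : oset (opensT SA) (f' w)) (wT : oset (opensT SB) w) h,
    stalk_map f' w (germ fT (constA h)) = germ wT (constB (m h)).
Proof.
have [f' [_ f'E]] := hom_to_chart_exists chartA (@sch_local SB)
  (constB \o m : {rmorphism {poly A} -> sect (opensT SB)}).
by exists f'.
Qed.

Section Square.
Variables (g : lrs_hom SA P) (g' : lrs_hom SB Y) (f' : lrs_hom SB SA).
Hypotheses (gV : forall w, oset V (g w)) (g'V : forall w, oset V' (g' w)).
Hypothesis gE : forall w (gV : oset V (g w)) (wT : oset (opensT SA) w) s,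
    stalk_map g w (germ gV s) = germ wT (constA (iA s)%:P).
Hypothesis g'E : forall w (gV : oset V' (g' w)) (wT : oset (opensT SB) w) s,
    stalk_map g' w (germ gV s) = germ wT (constB (iB s)%:P).
Hypothesis f'E : forall w (fT : oset (opensT SA) (f' w)) (wT : oset (opensT SB) w) h,
    stalk_map f' w (germ fT (constA h)) = germ wT (constB (m h)).

Let inT (X : ringed_space) (x : X) : oset (opensT X) x := I.

Lemma line_square : comp_hom f g' = comp_hom g f'.
Proof.
apply: (hom_to_chart_unique affV) => [w|w|w fU gU s]; first exact: g'V.
  exact: gV.
rewrite !stalk_map_comp (gE gU (inT _)) (f'E _ (inT _)) mC.
rewrite (stalk_mapE (f := f) fU (fU : oset V' (g' w))) (g'E _ (inT _)).
by rewrite /j /= iAK.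
Qed.

(** A morphism to the spectrum of [{poly B}] is a ring map on [B], supplied by [a], together with an
    image of [X], supplied by [b]. The morphism [a] lands in [V'] because [f a = g b] lands in
    [V]. *)
Lemma line_pullback : is_pullback f g g' f'.
Proof.
split; first exact: line_square.
move=> W a b fagb.
have aV w : oset V' (a w).
  by have /= E := congr1 (fun k : lrs_hom W P => k w) fagb; rewrite /V' /preopen /preimage /= E.
have aT : opensT W `<=` preopen (hom_cts a) V' by move=> w _; exact: aV.
have bT : opensT W `<=` preopen (hom_cts b) (opensT SA) by [].
pose al : {rmorphism B -> sect (opensT W)} := res aT \o pull a V' \o jB.
pose be : {rmorphism {poly A} -> sect (opensT W)} := res bT \o pull b (opensT SA) \o constA.
have alE w y : germ (inT w) (al y) = stalk_map a w (germ (aV w) (jB y)).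
  by rewrite (germ_res aT (inT w) (aV w)) (stalk_mapE (aV w) (aV w : oset (preopen _ V') w)).
have beE w h : germ (inT w) (be h) = stalk_map b w (germ (inT (b w)) (constA h)).
  rewrite (germ_res bT (inT w) (inT (b w))).
  by rewrite (stalk_mapE (inT (b w)) (inT (b w) : oset (preopen _ (opensT SA)) w)).
have [F [FC FX]] := poly_rmorph_exists al (be 'X).
have Fm h : F (m h) = be h.
  apply: (@poly_rmorph_ext A _ (F \o m)) => [x|]; last by rewrite /= mX.
  rewrite /= mC FC; apply: sect_ext => w wT; rewrite !(germ_irr wT (inT w)) alE beE.
  have fV : oset V (f (a w)) := aV w.
  rewrite /j /= iBK -(stalk_mapE (f := f) fV (aV w)).
  rewrite -[x in RHS](jAK x) -(gE (gV (b w)) (inT (b w))) -!stalk_map_comp.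
  exact: stalk_map_congr.
have [c [_ cE]] := hom_to_chart_exists chartB (@sch_local W) F.
have g'c : comp_hom g' c = a.
  apply: (hom_to_chart_unique affV') => [w|//|w gU aU s]; first exact: g'V.
  rewrite stalk_map_comp (g'E gU (inT _)) (cE _ _ (inT _)) FC alE iBK.
  by rewrite (germ_irr aU (aV w)).
have f'c : comp_hom f' c = b.
  apply: (hom_to_chart_unique chartA) => [//|//|w fU bU h].
  rewrite stalk_map_comp (f'E fU (inT _)) (cE _ _ (inT _)) Fm beE.
  by rewrite (germ_irr bU (inT _)).
exists c; split => // c' [g'c' f'c'].
apply: (hom_to_chart_unique chartB) => [//|//|w cU cU' h].
pose r (k : lrs_hom W SB) : {rmorphism {poly B} -> stalk w} :=
  stalk_map k w \o germ (inT (k w)) \o constB.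
rewrite (germ_irr cU (inT _)) (germ_irr cU' (inT _)) -[LHS]/(r c h) -[RHS]/(r c' h).
apply: poly_rmorph_ext => [y|].
- have rC (k : lrs_hom W SB) :
      r k y%:P = stalk_map (comp_hom g' k) w (germ (g'V (k w)) (jB y)).
    by rewrite stalk_map_comp (g'E (g'V (k w)) (inT _)) jBK.
  by rewrite !rC; apply: stalk_map_congr; rewrite g'c.
- have rX (k : lrs_hom W SB) :
      r k 'X = stalk_map (comp_hom f' k) w (germ (inT (f' (k w))) (constA 'X)).
    by rewrite stalk_map_comp (f'E (inT _) (inT _)) mX.
  by rewrite !rX; apply: stalk_map_congr; rewrite f'c.
Qed.

(** The stalk maps of [f'] are local, so [h] is a unit at [f' N] exactly when [m h] is one at
    [N]. *)
Lemma line_contraction (N : SB) : sval (f' N) = m @^-1` sval N.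
Proof.
rewrite predeqE => h.
have u : germ_unit (f' N) (constA h) <-> germ_unit N (constB (m h)).
  rewrite (germ_unitP (inT _)) (germ_unitP (inT _)) -(f'E (inT _)); split.
    exact: is_unit_rmorph.
  exact: stalk_map_local.
have {}u : ~ sval (f' N) h <-> ~ sval N (m h) by rewrite -!spec_const_unit.
by split=> H; apply: contrapT => nH; [apply: (proj2 u nH)|apply: (proj1 u nH)].
Qed.

End Square.

Hypothesis univ_f : universal_homeomorphism f.

Lemma line_contraction_homeo :
  [/\ forall N N', is_prime_ideal N -> is_prime_ideal N' -> m @^-1` N = m @^-1` N' -> N = N',
      forall Q, is_prime_ideal Q -> exists2 N, is_prime_ideal N & m @^-1` N = Q &
      forall J : set {poly B}, exists I : set {poly A}, forall Q, is_prime_ideal Q ->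
        (I `<=` Q <-> exists N, [/\ is_prime_ideal N, J `<=` N & m @^-1` N = Q])].
Proof.
have [g [gV gE]] := line_to_base; have [g' [g'V g'E]] := line_to_cover.
have [f' f'E] := line_to_line.
have [_ [k [kc f'K kK]]] := univ_f (line_pullback gV g'V gE g'E f'E).
have f'N := line_contraction f'E.
pose mkA Q (pQ : is_prime_ideal Q) : SA := exist _ Q pQ.
pose mkB N (pN : is_prime_ideal N) : SB := exist _ N pN.
have kN Q (pQ : is_prime_ideal Q) : m @^-1` sval (k (mkA Q pQ)) = Q by rewrite -f'N kK.
split.
- move=> N N' pN pN' E; suff : mkB N pN = mkB N' pN' by move=> /(congr1 sval).
  rewrite -[LHS]f'K -[RHS]f'K; congr (k _).
  have : sval (f' (mkB N pN)) = sval (f' (mkB N' pN')) by rewrite !f'N.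
  by case: (f' _) (f' _) => [x px] [y py] /= xy; apply: eq_exist.
- move=> Q pQ; exists (sval (k (mkA Q pQ))); [exact: svalP|exact: kN].
- move=> J.
  have oC : open [set N : SB | ~ (J `<=` sval N)].
    move=> N nJ; have [d [Jd nd]] : exists d, J d /\ ~ sval N d.
      apply: contrapT => H; apply: nJ => d Jd; apply: contrapT => nd; apply: H.
      by exists d.
    by exists d; split => // N' nd' JN'; apply: nd'; exact: JN'.
  have oO : open (k @^-1` [set N : SB | ~ (J `<=` sval N)]).
    by apply: open_comp => // x _; exact: kc.
  (* The ideal of the image of the closed set of [J]: those [d] whose nonvanishing locus misses that
     image. *)
  exists [set d | forall Q : SA, ~ sval Q d -> ~ (J `<=` sval (k Q))] => Q pQ; split.
  + move=> IQ; exists (sval (k (mkA Q pQ))); split; [exact: svalP| |exact: kN].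
    apply: contrapT => nJ; have [d [nd dO]] := oO (mkA Q pQ) nJ.
    by apply: nd; apply: IQ.
  + move=> [N [pN JN NE]] d /= Id; apply: contrapT => nd; apply: (Id (mkA Q pQ) nd).
    suff -> : k (mkA Q pQ) = mkB N pN by [].
    rewrite -[RHS]f'K; congr (k _).
    have : sval (mkA Q pQ) = sval (f' (mkB N pN)) by rewrite f'N.
    by case: (mkA _ _) (f' _) => [x px] [y py] /= xy; apply: eq_exist.
Qed.

End AffineLineBaseChange.

Lemma universal_homeomorphism_homeo (X Y : scheme) (f : lrs_hom X Y) :
  universal_homeomorphism f -> homeomorphism f.
Proof.
move=> uf; apply: (uf Y X (id_hom Y) (id_hom X) f).
split; first by rewrite comp_hom_id comp_id_hom.
move=> W a b; rewrite comp_id_hom => <-; exists a; split; first by rewrite comp_id_hom.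
by move=> c [<- _]; rewrite comp_id_hom.
Qed.

Lemma perfect_sect (p : nat) (X : ringed_space) : perfect p X ->
  forall (U : opens X) (t : sect U), exists s, s ^+ p = t.
Proof.
move=> pX U t.
have [|x xU|s sE] := @glue_local X U (fun x g => forall xU : oset U x, g ^+ p = germ xU t).
- move=> x g h xU gE hE; have [_ inj] := pX x; apply: inj; by rewrite (gE xU) (hE xU).
- have [root _] := pX x; have [g] := root (germ xU t); have [V [xV [s ->]]] := germP g.
  rewrite -rmorphXn => /eq_germ [W [WV [WU [xW E]]]].
  exists W, (res WV s); split => // y yW yU.
  by rewrite -rmorphXn -rmorphXn E; exact: germ_res.
- by exists s; apply: sect_ext => x xU; rewrite rmorphXn; exact: sE.
Qed.

Lemma perfect_reduced (p : nat) (pr_p : prime p) (X : scheme) : perfect p X -> reduced X.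
Proof.
move=> pX U s n sn; apply: sect_ext => x xU; rewrite rmorph0.
apply: (@perfect_iter_inj p X x n) => //.
have np : (n <= p ^ n)%N by rewrite ltnW // ltn_expl // prime_gt1.
rewrite -rmorphXn -(subnK np) exprD sn mulr0 rmorph0 expr0n subnK //.
by rewrite expn_eq0 -leqn0 leqNgt prime_gt0.
Qed.

(** A homeomorphism is affine: small principal opens have principal preimages. *)
Lemma adapted_affine (Y P : scheme) (f : lrs_hom Y P) (y : Y) (O : set Y) :
  homeomorphism f -> open O -> O y ->
  exists V : opens P, [/\ oset V (f y), affine V, affine (preopen (hom_cts f) V) &
    preopen (hom_cts f) V `<=` O].
Proof.
move=> [_ [k [kc fK kK]]] oO Oy.
have ok (C : set Y) : open C -> open (k @^-1` C).
  by move=> oC; apply: open_comp => // x _; exact: kc.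
have [U' [affU' yU' U'O]] := affine_nbhd oO Oy.
have kyU' : (k @^-1` (U' : set Y)) (f y) by rewrite /preimage /= fK.
have [V0 [affV0 yV0 V0U']] := affine_nbhd (ok _ (oset_open U')) kyU'.
(* Shrinking in a zigzag: [W'] is principal in the affine [U'] and lies over [V0]; then [V],
   principal in [V0], is taken inside the image of [W']. *)
have [d [ud dV0]] := lc_basis affU' yU' (oset_open (preopen (hom_cts f) V0)) yV0.
pose W' := chart_open (X := Y) (idfun : {rmorphism sect U' -> sect U'}) d.
have affW' : affine W' := chart_principal d affU'.
have yW' : (k @^-1` (W' : set Y)) (f y) by rewrite /preimage /= fK.
have [e [ue eW']] := lc_basis affV0 yV0 (ok _ (oset_open W')) yW'.
pose V := chart_open (X := P) (idfun : {rmorphism sect V0 -> sect V0}) e.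
have W'V0 : W' `<=` preopen (hom_cts f) V0 by move=> z; exact: dV0.
pose r : sect W' := res W'V0 (pull f V0 e).
(* The preimage of [V] lies in [W'], where it is the locus on which the pullback of [e] is a unit,
   hence a principal open of an affine. *)
have VE : preopen (hom_cts f) V = chart_open (X := Y) (idfun : {rmorphism sect W' -> sect W'}) r.
  apply: opens_ext; rewrite predeqE => z; split=> u.
  - have zW' : oset W' z by rewrite -(fK z); exact: eW'.
    have zV0 : oset V0 (f z) := germ_unit_in u.
    apply/(germ_unitP zW'); rewrite (germ_res W'V0 zW' (zV0 : oset (preopen _ V0) z)).
    rewrite -(stalk_mapE zV0); apply: is_unit_rmorph; exact/germ_unitP.
  - have zW' : oset W' z := germ_unit_in u.
    have zV0 : oset V0 (f z) := W'V0 z zW'.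
    apply/(germ_unitP zV0); apply: (@stalk_map_local _ _ f).
    rewrite (stalk_mapE zV0 (zV0 : oset (preopen (hom_cts f) V0) z)).
    by move: u => /(germ_unitP zW'); rewrite (germ_res W'V0 zW' (zV0 : oset (preopen _ V0) z)).
exists V; split.
- exact: ue.
- exact: chart_principal affV0.
- by rewrite VE; exact: chart_principal affW'.
- by rewrite VE => z /germ_unit_in zW'; apply: U'O; exact: (germ_unit_in zW').
Qed.

(** * Universal homeomorphisms onto a perfect scheme *)

Section PerfectRigid.
Variables (p : nat) (pr_p : prime p) (P : scheme) (FpP : Fp_scheme p P) (pP : perfect p P).
Variables (Y : scheme) (f : lrs_hom Y P) (redY : reduced Y) (univ_f : universal_homeomorphism f).

Let homeo_f : homeomorphism f := universal_homeomorphism_homeo univ_f.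

(** [f] is surjective with nonzero stalks upstairs, so a section that pulls back to zero is a unit
    at no point of [V]: it lies in every prime, hence is nilpotent, and perfect schemes are
    reduced. *)
Lemma pull_injective (V : opens P) : affine V -> injective (pull f V).
Proof.
move=> affV s t E; apply/eqP; rewrite -subr_eq0; apply/eqP.
have : pull f V (s - t) = 0 by rewrite rmorphB E subrr.
move: (s - t) => {E s t}s s0.
have [_ [k [_ _ kK]]] := homeo_f.
have [|Q pQ _|n] := @radical_primes (sect V) [set 0] s; last exact: (perfect_reduced pr_p pP).
  by split=> // [a b -> ->|a b ->] /=; rewrite ?addr0 ?mulr0.
have [x [xV <-]] := lc_point affV pQ => u.
have xV' : oset V (f (k x)) by rewrite kK.
have : is_unit (stalk_map f (k x) (germ xV' s)).
  by apply: is_unit_rmorph; apply/(germ_unitP xV'); rewrite kK.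
rewrite (stalk_mapE xV' (xV' : oset (preopen (hom_cts f) V) (k x))) s0 rmorph0.
move=> [v]; rewrite mul0r => /esym; have [nz _] := local_stalk (@sch_local Y) (k x).
exact: nz.
Qed.

Lemma pull_surjective (V : opens P) (s : sect (preopen (hom_cts f) V)) :
  affine V -> affine (preopen (hom_cts f) V) -> exists a, pull f V a = s.
Proof.
(* The zero ring is set apart because polynomials are taken over nonzero rings. *)
move=> affV affV'; have [V0|nzV] := pselect ((1 : sect V) = 0).
  exists 0; rewrite rmorph0 -[s]mulr1 -(rmorph1 (pull f V)) V0.
  by rewrite rmorph0 mulr0.
have nzV' : (1 : sect (preopen (hom_cts f) V)) <> 0.
  by rewrite -(rmorph1 (pull f V)) -(rmorph0 (pull f V)) => /(pull_injective affV).
have [A [iA [jA [iAK jAK]]]] := exists_comNzRing nzV.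
have [B [iB [jB [iBK jBK]]]] := exists_comNzRing nzV'.
have [cinj csurj cclosed] :=
  line_contraction_homeo affV affV' iAK jAK iBK jBK univ_f.
have pA : p%:R = 0 :> A by rewrite -(rmorph_nat iA) (Fp_scheme_char pr_p FpP) rmorph0.
have perfA (a : A) : exists a', a' ^+ p = a.
  have [c cE] := perfect_sect pP (jA a); exists (iA c).
  by rewrite -rmorphXn cE jAK.
have redB (b : B) n : b ^+ n = 0 -> b = 0.
  move=> bn; rewrite -[b]jBK -(rmorph0 iB); congr (iB _).
  by apply: (redY (n := n)); rewrite -rmorphXn bn rmorph0.
have [a aE] := perfect_extension_surj pr_p pA perfA redB cinj csurj cclosed (iB s).
by exists (jA a); apply: (can_inj iBK); rewrite -aE.
Qed.

(** By [adapted_affine], the preimages of affine opens [V] with affine preimage form a neighbourhood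
    basis on [Y]; bijectivity of [pull f V] on these passes to the stalks. *)
Lemma perfect_rigid : is_iso f.
Proof.
have [_ [k [kc fK kK]]] := homeo_f.
apply: iso_of_stalks => // [y g h E|y g].
- apply/eqP; rewrite -subr_eq0; apply/eqP.
  have : stalk_map f y (g - h) = 0 by rewrite rmorphB E subrr.
  move: (g - h) => {E h}g; have [N [yN [t ->]]] := germP g.
  have yN' : oset (preopen (hom_cts f) N) y := yN.
  rewrite (stalk_mapE yN yN') -(rmorph0 (germ yN')) => /eq_germ [O [ON [ON' [yO E]]]].
  have [V [yV affV affV' VO]] := adapted_affine homeo_f (oset_open O) yO.
  have VN : V `<=` N.
    move=> z zV; rewrite -(kK z); apply: (ON (k z)); apply: VO.
    by rewrite /preimage /= kK.
  rewrite -(germ_res VN yV yN).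
  have -> : res VN t = 0.
    apply: (pull_injective affV); rewrite rmorph0 pull_res.
    by rewrite -(res_comp VO ON) E !rmorph0.
  exact: rmorph0.
- have [O [yO [s ->]]] := germP g.
  have [V [yV affV affV' VO]] := adapted_affine homeo_f (oset_open O) yO.
  have [a aE] := pull_surjective (res VO s) affV affV'.
  have yV' : oset (preopen (hom_cts f) V) y := yV.
  by exists (germ yV a); rewrite (stalk_mapE yV yV') aE; exact: germ_res.
Qed.

End PerfectRigid.

Lemma perfect_topologically_rigid (p : nat) (pr_p : prime p) (P : scheme) :
  Fp_scheme p P -> perfect p P -> coherent P -> topologically_rigid P.
Proof.
by move=> FpP pP cohP; split => // Y f redY; exact: (perfect_rigid pr_p FpP pP redY).
Qed.

(** * The perfection is a universal homeomorphism *)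

Lemma Fp_scheme_over (p : nat) (X Y : scheme) (f : lrs_hom X Y) : Fp_scheme p Y -> Fp_scheme p X.
Proof. by move=> [S [s specS]]; exists S, (comp_hom s f). Qed.

(** Let [Z'] be the given fibre product over [Z]. The perfection [QZ] maps to [QT], hence gives
    [c : QZ -> Z'] over [Z], and [QZ'] maps to [QZ] by [e]; the universal properties give
    [c e = pi']. As [QZ] and [QZ'] have the spaces of [Z] and [Z'], this says on points that [c] is
    a continuous inverse of [f']. *)
Lemma perf_proj_universal_homeomorphism (p : nat) (pr_p : prime p) (T : scheme)
    (FpT : Fp_scheme p T) :
  universal_homeomorphism (perf_proj pr_p FpT).
Proof.
move=> Z Z' g g' f' [sq univ].
have FpZ := Fp_scheme_over g FpT; have FpZ' := Fp_scheme_over f' FpZ.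
pose QT := perf_scheme pr_p FpT; pose QZ := perf_scheme pr_p FpZ; pose QZ' := perf_scheme pr_p FpZ'.
have pQZ : perfect p QZ := @perf_space_perfect p pr_p _ FpZ.
have pQZ' : perfect p QZ' := @perf_space_perfect p pr_p _ FpZ'.
pose pi := perf_proj pr_p FpZ; pose pi' := perf_proj pr_p FpZ'.
have [m mE] := perf_hom_exists pr_p FpT pQZ (comp_hom g pi).
have [c [[g'c f'c] _]] := univ QZ m pi mE.
have [e eE] := perf_hom_exists pr_p FpZ pQZ' (comp_hom f' pi').
have me : comp_hom m e = comp_hom g' pi'.
  apply: (perf_hom_unique pQZ').
  by rewrite comp_homA mE -comp_homA eE !comp_homA sq.
have ce : comp_hom c e = pi'.
  have [|d [_ uniq]] := univ QZ' (comp_hom m e) (comp_hom f' pi').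
    by rewrite me !comp_homA sq.
  have <- : d = comp_hom c e by apply: uniq; rewrite !comp_homA g'c f'c eE.
  by apply: uniq; rewrite me.
split; first exact: hom_cts.
have f'cE z : f' (c z) = z by have := congr1 (fun k : lrs_hom QZ Z => k z) f'c.
have ceE z : c (e z) = z by have := congr1 (fun k : lrs_hom QZ' Z' => k z) ce.
have eE' z : e z = f' z by have := congr1 (fun k : lrs_hom QZ' Z => k z) eE.
exists (c : Z -> Z'); split=> [|z|//].
  exact: (hom_cts c).
by rewrite -eE' ceE.
Qed.

(** Coherence concerns the underlying space alone, and that is the space of [X]. *)
Lemma perf_coherent (p : nat) (pr_p : prime p) (X : scheme) (FpX : Fp_scheme p X) :
  coherent X -> coherent (perf_scheme pr_p FpX).
Proof. by []. Qed.

Lemma stalk_map_iso (X Y : ringed_space) (f : lrs_hom X Y) : is_iso f ->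
  (forall x, injective (stalk_map f x)) /\ (forall x g, exists h, stalk_map f x h = g).
Proof.
move=> [k [kf fk]].
have kfE x : k (f x) = x by have := congr1 (fun l : lrs_hom X X => l x) kf.
split.
(* Stated for any morphism equal to the identity, since the types of the stalk maps depend on the
   composite and cannot be rewritten in place. *)
- have key (l : lrs_hom Y Y) y : l = id_hom Y -> injective (stalk_map l y).
    by move=> -> g h; rewrite !stalk_map_id.
  move=> x; rewrite -(kfE x); move: (f x) => y g h E.
  by apply: (key _ y fk); rewrite !stalk_map_comp E.
- have key (l : lrs_hom X X) x (g : stalk x) : l = id_hom X -> exists h, stalk_map l x h = g.
    by move=> ->; exists g; rewrite stalk_map_id.
  move=> x g; have [h <-] := key _ x g kf.
  by exists (stalk_map k (f x) h); rewrite stalk_map_comp.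
Qed.

Lemma perfect_iso (p : nat) (X Y : ringed_space) (f : lrs_hom X Y) :
  is_iso f -> perfect p X -> perfect p Y.
Proof.
move=> iso_f pX y; have [inj surj] := stalk_map_iso iso_f.
have [k [_ fk]] := iso_f.
have fkE : f (k y) = y by have := congr1 (fun l : lrs_hom Y Y => l y) fk.
rewrite -fkE; move: (k y) => x; have [root pinj] := pX x; split=> [g|g h E].
  have [r rE] := root (stalk_map f x g); have [h hE] := surj x r.
  by exists h; apply: (inj x); rewrite rmorphXn hE.
by apply: (inj x); apply: pinj; rewrite -!rmorphXn E.
Qed.

Lemma rigid_perfect (p : nat) (pr_p : prime p) (T : scheme) :
  Fp_scheme p T -> topologically_rigid T -> perfect p T.
Proof.
move=> FpT [_ rigT]; have pQ := @perf_space_perfect p pr_p _ FpT.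
apply: (perfect_iso _ (pQ : perfect p (perf_scheme pr_p FpT))).
apply: rigT; last exact: perf_proj_universal_homeomorphism.
exact: (perfect_reduced pr_p (pQ : perfect p (perf_scheme pr_p FpT))).
Qed.

(** * The limit perfection *)

Section LimitPerfection.
Variables (p : nat) (pr_p : prime p).

Lemma stalk_map_frobenius (X : scheme) (FpX : Fp_scheme p X) (x : X) (g : stalk x) :
  stalk_map (frobenius pr_p FpX) x g = g ^+ p.
Proof.
have [U [xU [s ->]]] := germP g.
rewrite (stalk_mapE (f := frobenius pr_p FpX) xU
  (xU : oset (preopen (hom_cts (frobenius pr_p FpX)) U) x)).
by rewrite -rmorphXn; exact: germ_res.
Qed.

Lemma frobenius_natural (W X : scheme) (FpW : Fp_scheme p W)
    (FpX : Fp_scheme p X) (f : lrs_hom W X) :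
  comp_hom (frobenius pr_p FpX) f = comp_hom f (frobenius pr_p FpW).
Proof.
apply: hom_ext_stalk => // w V fV fV' s; rewrite !stalk_map_comp !stalk_map_frobenius.
by rewrite rmorphXn (germ_irr fV fV').
Qed.

Lemma frobenius_iso (W : scheme) (FpW : Fp_scheme p W) :
  perfect p W <-> is_iso (frobenius pr_p FpW).
Proof.
split=> [pW|/stalk_map_iso [inj surj]].
- apply: iso_of_stalks.
  + by split; [exact: hom_cts|exists idfun; split => // x; exact: cvg_id].
  + by move=> x g h; rewrite !stalk_map_frobenius; have [_] := pW x; apply.
  + by move=> x g; have [root _] := pW x; have [h hE] := root g; exists h;
      rewrite stalk_map_frobenius.
- move=> x; split=> [g|g h E].
    by have [h hE] := surj x g; exists h; rewrite -hE stalk_map_frobenius.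
  by apply: (inj x); rewrite !stalk_map_frobenius.
Qed.

Variables (X : scheme) (FpX : Fp_scheme p X) (P : scheme) (q : nat -> lrs_hom P X).
Hypothesis perfX : is_perfection pr_p FpX q.

(** The shifted family [q n.+1] is again compatible; the endomorphism it induces is inverse to the
    Frobenius of [P]. *)
Lemma limit_perfect : perfect p P.
Proof.
have FpP := Fp_scheme_over (q 0%N) FpX; apply/(frobenius_iso FpP).
have [qF univ] := perfX.
have [c [cE _]] := univ P (fun n => q n.+1) (fun n => qF n.+1).
have [d [_ uniq]] := univ P q qF.
have idE : d = id_hom P by apply: uniq => n; rewrite comp_hom_id.
exists c; split; rewrite -idE; apply/esym; apply: uniq => n.
- by rewrite comp_homA cE -(frobenius_natural FpP FpX) qF.
- by rewrite comp_homA -(frobenius_natural FpP FpX) -comp_homA cE qF.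
Qed.

(** Frobenius is invertible on [W] and natural, so [f] extends in exactly one way to a compatible
    family, obtained by composing with the iterates of its inverse. *)
Lemma limit_terminal (W : scheme) (f : lrs_hom W X) : perfect p W ->
  exists! c : lrs_hom W P, comp_hom (q 0%N) c = f.
Proof.
move=> pW; have FpW := Fp_scheme_over f FpX; have [qF univ] := perfX.
have [G [GF FG]] := proj1 (frobenius_iso FpW) pW.
pose r := fix r n := if n is n'.+1 then comp_hom (r n') G else f.
have rF n : comp_hom (frobenius pr_p FpX) (r n.+1) = r n.
  by rewrite /= comp_homA (frobenius_natural FpW) -comp_homA FG comp_hom_id.
have [c [cE uniq]] := univ W r rF; exists c; split; first exact: (cE 0%N).
move=> c' c'0; apply: uniq; elim=> [|n IHn]; first exact: c'0.
have E : comp_hom (comp_hom (q n.+1) c') (frobenius pr_p FpW) = r n.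
  by rewrite -(frobenius_natural FpW FpX) comp_homA qF.
by rewrite /= -E -comp_homA FG comp_hom_id.
Qed.

End LimitPerfection.

Theorem theorem7p4 (p : nat) (pr_p : prime p) (X : scheme)
    (FpX : Fp_scheme p X) (redX : reduced X) (noethX : noetherian X)
    (Xtrig : scheme) (t : lrs_hom Xtrig X)
    (trigX : is_topological_rigidification t)
    (Xperf : scheme) (q : nat -> lrs_hom Xperf X)
    (perfX : is_perfection pr_p FpX q) :
  exists i : lrs_hom Xtrig Xperf, is_iso i /\ comp_hom (q 0%N) i = t.
Proof.
have [cohX rigT univT] := trigX.
have pT : perfect p Xtrig := rigid_perfect pr_p (Fp_scheme_over t FpX) rigT.
have pQ : perfect p (perf_scheme pr_p FpX) := @perf_space_perfect p pr_p _ FpX.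
have rigQ : topologically_rigid (perf_scheme pr_p FpX).
  exact: (perfect_topologically_rigid pr_p (Fp_scheme_over (perf_proj pr_p FpX) FpX) pQ
    (perf_coherent pr_p FpX cohX)).
have pP := limit_perfect perfX.
have [i [qi _]] := limit_terminal perfX t pT.
(* The inverse goes from [Xperf] to [Xtrig] through [Q]: [v] exists since [Xperf] is perfect, [u]
   since [Q] is rigid. Both composites lie over [X] and are identities by the two uniqueness
   statements. *)
have [u [tu _]] := univT _ (perf_proj pr_p FpX) rigQ.
have [v vE] := perf_hom_exists pr_p FpX pP (q 0%N).
exists i; split => //; exists (comp_hom u v); split.
- have [c [_ uniq]] := univT _ t rigT.
  rewrite -(uniq (id_hom Xtrig)) ?comp_hom_id //; apply/esym/uniq.
  by rewrite !comp_homA tu vE qi.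
- have [c [_ uniq]] := limit_terminal perfX (q 0%N) pP.
  rewrite -(uniq (id_hom Xperf)) ?comp_hom_id //; apply/esym/uniq.
  by rewrite comp_homA qi comp_homA tu vE.
Qed.
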